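(* Let $\lambda>\lambda_c$, $z_*=x_*+\frac{2i}{\lambda}$ and $Q(z)=Q(z;\lambda,x_* )$. Then there exist analytic arcs $\gamma_1$ and $\gamma_2$ with the following properties. (i) The arc $\gamma_2$ is in the right half plane, starts at $z_*$ and ends at $1$, and it is the unique such arc that satisfies $$\int_{z_*}^z\sqrt{Q(s)}\,ds\in i\mathbb R,\qquad z\in\gamma_2 .$$ (ii) The arc $\gamma_1$ is obtained as the reflection of $\gamma_2$ over the imaginary axis and satisfies $$\int_{-1}^z\sqrt{Q(s)}\,ds\in i\mathbb R,\qquad z\in\gamma_1 .$$
   Context: The number $\lambda_c$ is the unique positive solution of $2\log\left(\frac{2+\sqrt{\lambda^2+4}}{\lambda}\right)-\sqrt{\lambda^2+4}=0$. For $\lambda>0$, $x\in\mathbb R$ set $z_\lambda(x)=x+\frac{2i}{\lambda}$ and $$Q(z;\lambda,x)=-\frac{\lambda^2}{4}\,\frac{(z-z_\lambda(x))(z+\overline{z_\lambda(x)})}{z^2-1}.$$ For $\lambda>\lambda_c$, $x_*=x_*(\lambda)$ is the unique $x\in(0,1)$ with $\operatorname{Re}\int_{z_\lambda(x)}^1\sqrt{Q(s;\lambda,x)}\,ds=0$ (integral along the straight segment). The integrals in the claim are taken along the arcs $\gamma_2$ and $\gamma_1$, respectively, with a branch of the square root varying analytically along the arc; the conditions do not depend on the choice of branch. The reflection over the imaginary axis is $z\mapsto-\overline z$. *)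

(* Defs.v *)
From Stdlib Require Import Reals.
From Coquelicot Require Export Coquelicot.

Open Scope R_scope.

Definition lambda_c_function (l : R) : R :=
  2 * ln ((2 + sqrt (l ^ 2 + 4)) / l) - sqrt (l ^ 2 + 4).

Definition is_lambda_c (lc : R) : Prop :=
  unique (fun l => 0 < l /\ lambda_c_function l = 0) lc.

Definition z_lambda (lambda x : R) : C := (x + 2 * Ci / lambda)%C.

Definition Q (lambda x : R) (z : C) : C :=
  (- (lambda ^ 2 / 4) *
   ((z - z_lambda lambda x) * (z + Cconj (z_lambda lambda x)) /
    (z ^ 2 - 1)))%C.

Definition refl_im (z : C) : C := (- Cconj z)%C.

(* A path is a function of a real parameter, used on [0, 1] (and, for
   analyticity at the endpoints, near it). It is real-analytic at [t0] when it
   is, near [t0], the restriction to the real line of a holomorphic function. *)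
Definition analytic_at (g : R -> C) (t0 : R) : Prop :=
  exists F : C -> C,
    locally (RtoC t0) (fun z : C => ex_derive F z) /\
    locally t0 (fun t : R => g t = F (RtoC t)).

Definition path_derive (g : R -> C) (t : R) : C :=
  (Derive (fun s => Re (g s)) t, Derive (fun s => Im (g s)) t).

Definition is_analytic_arc_param (g : R -> C) : Prop :=
  (forall t, 0 <= t <= 1 -> analytic_at g t) /\
  (forall t, 0 <= t <= 1 -> path_derive g t <> RtoC 0) /\
  (forall s t, 0 <= s <= 1 -> 0 <= t <= 1 -> g s = g t -> s = t).

(* [A] is an analytic arc from [a] to [b], parametrized by [g]. *)
Definition analytic_arc (A : C -> Prop) (a b : C) (g : R -> C) : Prop :=
  is_analytic_arc_param g /\ g 0 = a /\ g 1 = b /\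
  (forall z, A z <-> exists t, 0 <= t <= 1 /\ g t = z).

(* The endpoints are left out: there the integrands below have a zero (where
   the root is not analytic) or a pole of [q]. *)
Definition sqrt_branch (q : C -> C) (g w : R -> C) : Prop :=
  forall t, 0 < t < 1 -> analytic_at w t /\ (w t * w t)%C = q (g t).

(* [l] is the integral of the branch [w] along [g], from [g 0] to [g t]. It is
   improper at both ends, since [q] may have a simple pole at [g 0] or [g 1]. *)
Definition is_path_integral (g w : R -> C) (t : R) (l : C) : Prop :=
  is_RInt_gen (V := C_R_NormedModule)
    (fun s => (w s * path_derive g s)%C) (at_right 0) (at_left t) l.

(* The integral of a square root of [q] from [g 0] to [g t] along [g] is purely
   imaginary for all [t]; it is trivially so at [t = 0]. *)
Definition imaginary_sqrt_integral (q : C -> C) (g : R -> C) : Prop :=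
  exists w, sqrt_branch q g w /\
    forall t, 0 < t <= 1 -> exists l, is_path_integral g w t l /\ Re l = 0.

Definition segment_path (a b : C) (t : R) : C := ((1 - t) * a + t * b)%C.

Definition is_x_star (lambda xs : R) : Prop :=
  unique
    (fun x => 0 < x < 1 /\
       let g := segment_path (z_lambda lambda x) 1 in
       exists w l,
         sqrt_branch (Q lambda x) g w /\ is_path_integral g w 1 l /\ Re l = 0)
    xs.

(* Main.v *)
Require Import Defs.
From Stdlib Require Import Reals Lra Lia Psatz Classical Ranalysis5.
From Stdlib Require Import IndefiniteDescription FunctionalExtensionality.
From Coquelicot Require Import Coquelicot.

(** With [b = 2 / lambda] the two zeros of [Q] are [x + i b] and [- x + i b].
Cross-multiplying shows that in the right half plane [Q] is real exactly on
the circle through [1], [-1] and the two zeros, and that in the half strip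
[strip] ([0 < Re z], [0 < Im z < b]) the real values of [Q] are positive. So
the principal root [sq] of [Q] is holomorphic there with positive real part,
and its imaginary part has the sign of the equation [circle_form] of the
circle. Let [phi] be a primitive of [sq] on [strip].

Existence. The trajectories are the level sets of [Re phi], which increases
strictly along horizontal lines. The condition that defines [x_star] says that
[Re phi] has the same limit at the pole [1] and at the zero [zs]
([equal_levels]). On a vertical line to the right of the circle, [Re phi]
decreases with the height; on one to the left of [zs] it increases. Comparing
both lines with the values close to [zs], on the top edge of the strip, gives
on each horizontal line one point of this common level ([level_exists]). The
level set is thus a graph over the height [y] in [[0, b]], from [1] to [zs].

Analyticity. Near a point [p] of the graph, including both endpoints, the
function [(phi - c)^2] is [(z - p)^k E(z)^2] with [E] holomorphic, [E p <> 0]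
and [k = 1] at the pole, [2] inside, [3] at the zero ([expansion]). With
[z = p + (y - Im p) (i + m)] this factors as [(y - Im p)^k N(m, y)], so the
graph solves [Im N = 0], and a holomorphic implicit function theorem gives [m]
as an analytic function of [y] across [y = Im p] ([analytic_graph]). The height
is therefore an analytic parameter on the closed arc.

Uniqueness. Along any competing arc the real part of a local primitive of a
root of [Q] is constant. Next to [1] this and the expansion at the pole force
the arc to arrive from above ([arrival_direction]), hence inside [strip] and on
the graph; it stays there when followed backwards, until it reaches [zs]
([continuation]). The arc [gamma1] is obtained from the symmetry
[Q (- conj z) = conj (Q z)].

Two devices keep the function theory elementary. Holomorphy is used in the
form [hol] of a uniform second-order expansion, from which the continuity of
the derivative follows without integral formulas. Of a competing arc only
differentiability is used; its integrals are handled by Darboux's form of the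
fundamental theorem ([RInt_derivative]).
*)

Open Scope R_scope.

(** * Moduli *)

Lemma Cmod_minus_sym (a b : C) : Cmod (a - b)%C = Cmod (b - a)%C.
Proof. rewrite <- Cmod_opp. f_equal. ring. Qed.

Lemma Cmod_diag (a : C) : Cmod (a - a)%C = 0.
Proof. replace (a - a)%C with (RtoC 0) by ring. apply Cmod_0. Qed.

Lemma Cmod_sub_le (a b : C) : Cmod (a - b)%C <= Cmod a + Cmod b.
Proof.
replace (a - b)%C with (a + - b)%C by ring.
rewrite <- (Cmod_opp b). apply Cmod_triangle.
Qed.

Lemma Cmod_le_sub (a b : C) : Cmod a <= Cmod b + Cmod (a - b)%C.
Proof.
replace a with (b + (a - b))%C at 1 by ring. apply Cmod_triangle.
Qed.

Lemma Cmod_sub_trans (a b c : C) :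
  Cmod (a - c)%C <= Cmod (a - b)%C + Cmod (b - c)%C.
Proof.
replace (a - c)%C with ((a - b) + (b - c))%C by ring. apply Cmod_triangle.
Qed.

Lemma Re_sub (a b : C) : Re (a - b)%C = Re a - Re b.
Proof. easy. Qed.

Lemma Im_sub (a b : C) : Im (a - b)%C = Im a - Im b.
Proof. easy. Qed.

Lemma im_le_Cmod (z : C) : Rabs (Im z) <= Cmod z.
Proof. apply Rle_trans with (2 := Rmax_Cmod z). apply Rmax_r. Qed.

Lemma Cmod_le_Rabs (z : C) : Cmod z <= Rabs (Re z) + Rabs (Im z).
Proof.
replace z with (RtoC (Re z) + Ci * RtoC (Im z))%C at 1.
2:{ apply injective_projections; simpl; unfold Re, Im; ring. }
eapply Rle_trans. apply Cmod_triangle.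
rewrite Cmod_mult, Cmod_Ci, !Cmod_R. lra.
Qed.

(** * Second-order expansions *)

(** A uniform quadratic remainder near [p]. It makes the derivative Lipschitz, so
that C1 arguments apply, and it is stable under the operations used here. *)
Definition hol (f f' : C -> C) (p : C) : Prop :=
  exists d M, 0 < d /\ 0 <= M /\
  forall z w, Cmod (z - p)%C < d -> Cmod (w - p)%C < d ->
  Cmod (f w - f z - f' z * (w - z))%C <= M * Cmod (w - z)%C ^ 2.

Definition near2 (d : R) (m0 y0 m y : C) : Prop :=
  Cmod (m - m0)%C < d /\ Cmod (y - y0)%C < d.

Definition dist2 (m y m' y' : C) : R := Cmod (m' - m)%C + Cmod (y' - y)%C.

(** The same expansion in two complex variables, with partial derivatives [A], [B].
The algebra is done once in this setting; [hol] is the case of one idle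
variable. *)
Definition hol2 (f A B : C -> C -> C) (m0 y0 : C) : Prop :=
  exists d M, 0 < d /\ 0 <= M /\
  forall m y m' y', near2 d m0 y0 m y -> near2 d m0 y0 m' y' ->
  Cmod (f m' y' - f m y - (A m y * (m' - m) + B m y * (y' - y)))%C
    <= M * dist2 m y m' y' ^ 2.

Lemma dist2_ge0 m y m' y' : 0 <= dist2 m y m' y'.
Proof.
unfold dist2. generalize (Cmod_ge_0 (m' - m)%C) (Cmod_ge_0 (y' - y)%C). lra.
Qed.

Lemma near2_mono d d' m0 y0 m y :
  d <= d' -> near2 d m0 y0 m y -> near2 d' m0 y0 m y.
Proof. unfold near2. lra. Qed.

Lemma near2_center d m0 y0 : 0 < d -> near2 d m0 y0 m0 y0.
Proof.
intros Hd. unfold near2.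
rewrite !Cmod_diag. lra.
Qed.

Lemma hol2_swap f A B m0 y0 :
  hol2 f A B m0 y0 ->
  hol2 (fun y m => f m y) (fun y m => B m y) (fun y m => A m y) y0 m0.
Proof.
intros [d [M [Hd [HM H]]]]. exists d, M. split; [easy|split;[easy|]].
intros y m y' m' [H1 H2] [H3 H4].
unfold dist2. rewrite (Rplus_comm (Cmod _)), (Cplus_comm (_ * _)).
apply H; split; easy.
Qed.

(** The remainder bound controls the derivative: expand [f] at the centre, at
[(m, y)] and at [(m + n, y)] with [n] the distance of [(m, y)] to the centre,
and compare. *)
Lemma hol2_partial_cont f A B m0 y0 :
  hol2 f A B m0 y0 ->
  exists d L, 0 < d /\ 0 <= L /\ forall m y, near2 d m0 y0 m y ->
  Cmod (A m y - A m0 y0)%C <= L * dist2 m0 y0 m y.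
Proof.
intros [d [M [Hd [HM H]]]]. exists (d/4), (6 * M). split; [lra|split;[lra|]].
intros m y Hn.
assert (Hn' : near2 d m0 y0 m y) by (eapply near2_mono; [|eassumption]; lra).
set (n := dist2 m0 y0 m y).
assert (Hn0 : 0 <= n) by apply dist2_ge0.
assert (Hnd : n < d / 2).
{ unfold n, dist2. destruct Hn. lra. }
destruct (Req_dec n 0) as [E|E].
- assert (m = m0 /\ y = y0) as [-> ->].
  { unfold n, dist2 in E.
    generalize (Cmod_ge_0 (m - m0)%C) (Cmod_ge_0 (y - y0)%C). intros.
    split.
    - replace m with (m0 + (m - m0))%C by ring.
      rewrite (Cmod_eq_0 (m - m0)%C) by lra. ring.
    - replace y with (y0 + (y - y0))%C by ring.
      rewrite (Cmod_eq_0 (y - y0)%C) by lra. ring. }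
  rewrite E. replace (A m0 y0 - A m0 y0)%C with (RtoC 0) by ring.
  rewrite Cmod_0. lra.
- assert (Hn1 : 0 < n) by lra.
  assert (Hs : near2 d m0 y0 (m + n)%C y).
  { split; [|apply Hn'].
    replace (m + n - m0)%C with ((m - m0) + n)%C by ring.
    eapply Rle_lt_trans. apply Cmod_triangle.
    rewrite Cmod_R, Rabs_pos_eq by lra. destruct Hn. lra. }
  assert (H0 : near2 d m0 y0 m0 y0) by (apply near2_center; lra).
  generalize (H _ _ _ _ H0 Hs) (H _ _ _ _ H0 Hn') (H _ _ _ _ Hn' Hs).
  intros H1 H2 H3.
  assert (E1 : dist2 m y (m + n)%C y = n).
  { unfold dist2. replace (m + n - m)%C with (RtoC n) by ring.
    rewrite Cmod_diag, Cmod_R, Rabs_pos_eq by lra. ring. }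
  assert (E2 : dist2 m0 y0 (m + n)%C y <= 2 * n).
  { unfold dist2.
    generalize (Cmod_sub_trans (m + n)%C m m0).
    replace (m + n - m)%C with (RtoC n) by ring.
    rewrite Cmod_R, Rabs_pos_eq by lra.
    assert (Hnn : n = Cmod (m - m0) + Cmod (y - y0)) by reflexivity.
  lra. }
  rewrite E1 in H3. fold n in H2.
  assert (H1' : Cmod (f (m + n)%C y - f m0 y0 -
       (A m0 y0 * (m + n - m0) + B m0 y0 * (y - y0)))%C <= 4 * M * n ^ 2).
  { eapply Rle_trans. apply H1.
    replace (4 * M * n ^ 2) with (M * (2 * n) ^ 2) by ring.
    apply Rmult_le_compat_l. easy. apply pow_incr. split.
    apply dist2_ge0. easy. }
  apply Rmult_le_reg_r with (1 := Hn1).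
  replace (Cmod (A m y - A m0 y0) * n) with (Cmod ((A m y - A m0 y0) * n)%C).
  2:{ rewrite Cmod_mult, Cmod_R, Rabs_pos_eq by lra. easy. }
  set (a := (f (m + n)%C y - f m0 y0 -
       (A m0 y0 * (m + n - m0) + B m0 y0 * (y - y0)))%C) in *.
  set (b := (f m y - f m0 y0 - (A m0 y0 * (m - m0) + B m0 y0 * (y - y0)))%C)
    in *.
  set (c := (f (m + n)%C y - f m y -
       (A m y * (m + n - m) + B m y * (y - y)))%C) in *.
  replace ((A m y - A m0 y0) * n)%C with (a - b - c)%C
    by (unfold a, b, c; ring).
  generalize (Cmod_sub_le (a - b) c) (Cmod_sub_le a b). intros. nra.
Qed.

Lemma hol2_bounds f A B m0 y0 :
  hol2 f A B m0 y0 ->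
  exists d M, 0 < d /\ 0 <= M /\
  (forall m y, near2 d m0 y0 m y ->
     Cmod (f m y) <= M /\ Cmod (A m y) <= M /\ Cmod (B m y) <= M) /\
  (forall m y m' y', near2 d m0 y0 m y -> near2 d m0 y0 m' y' ->
   Cmod (f m' y' - f m y)%C <= M * dist2 m y m' y' /\
   Cmod (f m' y' - f m y - (A m y * (m' - m) + B m y * (y' - y)))%C
    <= M * dist2 m y m' y' ^ 2).
Proof.
intros H.
destruct (hol2_partial_cont _ _ _ _ _ H) as [d1 [L1 [Hd1 [HL1 H1]]]].
destruct (hol2_partial_cont _ _ _ _ _ (hol2_swap _ _ _ _ _ H))
  as [d2 [L2 [Hd2 [HL2 H2]]]].
destruct H as [d [M [Hd [HM H]]]].
set (e := Rmin (Rmin d 1) (Rmin d1 d2)).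
assert (He : 0 < e /\ e <= d /\ e <= 1 /\ e <= d1 /\ e <= d2).
{ unfold e. generalize (Rmin_l (Rmin d 1) (Rmin d1 d2))
   (Rmin_r (Rmin d 1) (Rmin d1 d2)) (Rmin_l d 1) (Rmin_r d 1)
   (Rmin_l d1 d2) (Rmin_r d1 d2). intros.
  repeat split; try lra. repeat apply Rmin_pos; lra. }
destruct He as [He0 [He1 [He2 [He3 He4]]]].
set (KA := Cmod (A m0 y0) + 2 * L1).
set (KB := Cmod (B m0 y0) + 2 * L2).
set (Kf := Cmod (f m0 y0) + 2 * (KA + KB + 4 * M)).
assert (P1 := Cmod_ge_0 (A m0 y0)). assert (P2 := Cmod_ge_0 (B m0 y0)).
assert (P3 := Cmod_ge_0 (f m0 y0)).
assert (HKA : 0 <= KA) by (unfold KA; lra).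
assert (HKB : 0 <= KB) by (unfold KB; lra).
assert (HKf : 0 <= Kf) by (unfold Kf; lra).
assert (BA : forall m y, near2 e m0 y0 m y -> Cmod (A m y) <= KA).
{ intros m y Hn. generalize (H1 m y (near2_mono _ _ _ _ _ _ He3 Hn)).
  generalize (Cmod_le_sub (A m y) (A m0 y0)) (dist2_ge0 m0 y0 m y).
  assert (dist2 m0 y0 m y <= 2) by (unfold dist2; destruct Hn; lra).
  unfold KA. intros. nra. }
assert (BB : forall m y, near2 e m0 y0 m y -> Cmod (B m y) <= KB).
{ intros m y Hn. generalize (H2 y m).
  intros H2'. lapply H2'; [|destruct Hn; split; lra]. clear H2'.
  generalize (Cmod_le_sub (B m y) (B m0 y0)) (dist2_ge0 y0 m0 y m).
  assert (dist2 y0 m0 y m <= 2) by (unfold dist2; destruct Hn; lra).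
  unfold KB. intros. nra. }
assert (BL : forall m y m' y', near2 e m0 y0 m y -> near2 e m0 y0 m' y' ->
   Cmod (f m' y' - f m y)%C <= (KA + KB + 4 * M) * dist2 m y m' y').
{ intros m y m' y' Hn Hn'.
  generalize (H m y m' y' (near2_mono _ _ _ _ _ _ He1 Hn)
     (near2_mono _ _ _ _ _ _ He1 Hn')).
  generalize (Cmod_le_sub (f m' y' - f m y)
     (A m y * (m' - m) + B m y * (y' - y))).
  generalize (Cmod_triangle (A m y * (m' - m)) (B m y * (y' - y))).
  rewrite !Cmod_mult. generalize (BA _ _ Hn) (BB _ _ Hn).
  assert (dist2 m y m' y' <= 4).
  { unfold dist2. generalize (Cmod_sub_trans m' m0 m) (Cmod_sub_trans y' y0 y).
    rewrite (Cmod_minus_sym m0), (Cmod_minus_sym y0).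
    destruct Hn, Hn'. lra. }
  generalize (dist2_ge0 m y m' y').
  generalize (Cmod_ge_0 (A m y)) (Cmod_ge_0 (B m y))
   (Cmod_ge_0 (m' - m)) (Cmod_ge_0 (y' - y)).
  intros.
  assert (Cmod (A m y) * Cmod (m' - m) <= KA * dist2 m y m' y').
  { apply Rmult_le_compat; try easy. unfold dist2. lra. }
  assert (Cmod (B m y) * Cmod (y' - y) <= KB * dist2 m y m' y').
  { apply Rmult_le_compat; try easy. unfold dist2. lra. }
  assert (M * dist2 m y m' y' ^ 2 <= M * (4 * dist2 m y m' y')).
  { apply Rmult_le_compat_l. easy. nra. }
  lra. }
exists e, (Kf + KA + KB + 4 * M). split; [easy|split;[lra|split]].
- intros m y Hn. generalize (BA _ _ Hn) (BB _ _ Hn).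
  generalize (BL m0 y0 m y (near2_center _ _ _ He0) Hn).
  generalize (Cmod_le_sub (f m y) (f m0 y0)) (dist2_ge0 m0 y0 m y).
  assert (dist2 m0 y0 m y <= 2) by (unfold dist2; destruct Hn; lra).
  intros. assert (Cmod (f m y) <= Kf) by (unfold Kf; nra).
  repeat split; lra.
- intros m y m' y' Hn Hn'. split.
  + generalize (BL _ _ _ _ Hn Hn') (dist2_ge0 m y m' y'). intros. nra.
  + generalize (H m y m' y' (near2_mono _ _ _ _ _ _ He1 Hn)
     (near2_mono _ _ _ _ _ _ He1 Hn')) (dist2_ge0 m y m' y').
    intros.
    assert (0 <= dist2 m y m' y' ^ 2) by nra. nra.
Qed.

Lemma hol2_const (c : C) m0 y0 :
  hol2 (fun _ _ => c) (fun _ _ => RtoC 0) (fun _ _ => RtoC 0) m0 y0.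
Proof.
exists 1, 0. split; [lra|split;[lra|]]. intros.
replace (_ - _ - _)%C with (RtoC 0) by ring. rewrite Cmod_0. lra.
Qed.

Lemma hol2_fst m0 y0 :
  hol2 (fun m _ => m) (fun _ _ => RtoC 1) (fun _ _ => RtoC 0) m0 y0.
Proof.
exists 1, 0. split; [lra|split;[lra|]]. intros.
replace (_ - _ - _)%C with (RtoC 0) by ring. rewrite Cmod_0. lra.
Qed.

Lemma hol2_snd m0 y0 :
  hol2 (fun _ y => y) (fun _ _ => RtoC 0) (fun _ _ => RtoC 1) m0 y0.
Proof. exact (hol2_swap _ _ _ _ _ (hol2_fst y0 m0)). Qed.

Lemma hol2_eq f A B f1 A1 B1 m0 y0 :
  (forall m y, f m y = f1 m y) -> (forall m y, A m y = A1 m y) ->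
  (forall m y, B m y = B1 m y) -> hol2 f A B m0 y0 -> hol2 f1 A1 B1 m0 y0.
Proof.
intros Ef EA EB [d [M [Hd [HM H]]]]. exists d, M. split; [easy|split;[easy|]].
intros. rewrite <- !Ef, <- EA, <- EB. now apply H.
Qed.

Lemma hol2_plus f A B g A' B' m0 y0 :
  hol2 f A B m0 y0 -> hol2 g A' B' m0 y0 ->
  hol2 (fun m y => f m y + g m y)%C (fun m y => A m y + A' m y)%C
    (fun m y => B m y + B' m y)%C m0 y0.
Proof.
intros [d [M [Hd [HM H]]]] [d' [M' [Hd' [HM' H']]]].
exists (Rmin d d'), (M + M'). split; [now apply Rmin_pos|split;[lra|]].
intros m y m' y' Hn Hn'.
generalize (H m y m' y' (near2_mono _ _ _ _ _ _ (Rmin_l _ _) Hn)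
     (near2_mono _ _ _ _ _ _ (Rmin_l _ _) Hn')).
generalize (H' m y m' y' (near2_mono _ _ _ _ _ _ (Rmin_r _ _) Hn)
     (near2_mono _ _ _ _ _ _ (Rmin_r _ _) Hn')).
set (u := (f m' y' - f m y - _)%C). set (v := (g m' y' - g m y - _)%C).
intros.
replace (_ - _ - _)%C with (u + v)%C by (unfold u, v; ring).
generalize (Cmod_triangle u v). lra.
Qed.

Lemma hol2_mult f A B g A' B' m0 y0 :
  hol2 f A B m0 y0 -> hol2 g A' B' m0 y0 ->
  hol2 (fun m y => f m y * g m y)%C
    (fun m y => A m y * g m y + f m y * A' m y)%C
    (fun m y => B m y * g m y + f m y * B' m y)%C m0 y0.
Proof.
intros Hf Hg.
destruct (hol2_bounds _ _ _ _ _ Hf) as [d [M [Hd [HM [H1 H2]]]]].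
destruct (hol2_bounds _ _ _ _ _ Hg) as [d' [M' [Hd' [HM' [H1' H2']]]]].
exists (Rmin d d'), (3 * M * M'). split; [now apply Rmin_pos|split;[nra|]].
intros m y m' y' Hn Hn'.
destruct (H1 m y (near2_mono _ _ _ _ _ _ (Rmin_l _ _) Hn)) as [F _].
destruct (H1' m y (near2_mono _ _ _ _ _ _ (Rmin_r _ _) Hn)) as [G _].
destruct (H2 m y m' y' (near2_mono _ _ _ _ _ _ (Rmin_l _ _) Hn)
     (near2_mono _ _ _ _ _ _ (Rmin_l _ _) Hn')) as [F1 F2].
destruct (H2' m y m' y' (near2_mono _ _ _ _ _ _ (Rmin_r _ _) Hn)
     (near2_mono _ _ _ _ _ _ (Rmin_r _ _) Hn')) as [G1 G2].
set (u := (f m' y' - f m y - _)%C) in *.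
set (v := (g m' y' - g m y - _)%C) in *.
set (n := dist2 m y m' y') in *.
replace (_ - _ - _)%C with
  (u * g m y + f m y * v + (f m' y' - f m y) * (g m' y' - g m y))%C
  by (unfold u, v; ring).
eapply Rle_trans. apply Cmod_triangle.
assert (T := Cmod_triangle (u * g m y) (f m y * v)).
rewrite !Cmod_mult in *.
assert (0 <= n) by apply dist2_ge0.
assert (Cmod u * Cmod (g m y) <= (M * n ^ 2) * M').
{ apply Rmult_le_compat; try easy; apply Cmod_ge_0. }
assert (Cmod (f m y) * Cmod v <= M * (M' * n ^ 2)).
{ apply Rmult_le_compat; try easy; apply Cmod_ge_0. }
assert (Cmod (f m' y' - f m y) * Cmod (g m' y' - g m y)
   <= (M * n) * (M' * n)).
{ apply Rmult_le_compat; try easy; apply Cmod_ge_0. }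
lra.
Qed.

Lemma hol_hol2 f f' p y0 :
  hol f f' p -> hol2 (fun m _ => f m) (fun m _ => f' m) (fun _ _ => RtoC 0) p y0.
Proof.
intros [d [M [Hd [HM H]]]]. exists d, M. split; [easy|split;[easy|]].
intros m y m' y' [Hm _] [Hm' _].
replace (_ - _ - _)%C with (f m' - f m - f' m * (m' - m))%C by ring.
eapply Rle_trans. now apply H.
apply Rmult_le_compat_l. easy.
apply pow_incr. split. apply Cmod_ge_0. unfold dist2.
generalize (Cmod_ge_0 (y' - y)). lra.
Qed.

Lemma hol2_hol f A B p y0 :
  hol2 f A B p y0 -> hol (fun m => f m y0) (fun m => A m y0) p.
Proof.
intros [d [M [Hd [HM H]]]]. exists d, M. split; [easy|split;[easy|]].
intros z w Hz Hw.
assert (E : (y0 - y0)%C = RtoC 0) by ring.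
generalize (H z y0 w y0). unfold near2, dist2. rewrite E, Cmod_0, Rplus_0_r.
intros H'.
replace (_ - _ - _)%C with
  (f w y0 - f z y0 - (A z y0 * (w - z) + B z y0 * 0))%C by ring.
apply H'; now split.
Qed.

Lemma hol_eq f f' f1 f1' p :
  (forall z, f z = f1 z) -> (forall z, f' z = f1' z) ->
  hol f f' p -> hol f1 f1' p.
Proof.
intros E E' [d [M [Hd [HM H]]]]. exists d, M. split; [easy|split;[easy|]].
intros. rewrite <- !E, <- E'. now apply H.
Qed.

Lemma hol_loc f f' f1 f1' p d :
  0 < d -> (forall z, Cmod (z - p)%C < d -> f z = f1 z /\ f' z = f1' z) ->
  hol f f' p -> hol f1 f1' p.
Proof.
intros Hd0 E [d' [M [Hd [HM H]]]]. exists (Rmin d d'), M.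
split; [now apply Rmin_pos|split;[easy|]].
intros z w Hz Hw.
generalize (Rmin_l d d') (Rmin_r d d'). intros.
destruct (E z) as [<- <-]; [lra|]. destruct (E w) as [<- _]; [lra|].
apply H; lra.
Qed.

Lemma hol_bounds f f' p :
  hol f f' p -> exists d M, 0 < d /\ 0 <= M /\
  (forall z, Cmod (z - p)%C < d -> Cmod (f z) <= M /\ Cmod (f' z) <= M) /\
  (forall z w, Cmod (z - p)%C < d -> Cmod (w - p)%C < d ->
   Cmod (f w - f z)%C <= M * Cmod (w - z)%C /\
   Cmod (f w - f z - f' z * (w - z))%C <= M * Cmod (w - z)%C ^ 2).
Proof.
intros H.
destruct (hol2_bounds _ _ _ _ _ (hol_hol2 _ _ _ 0 H))
  as [d [M [Hd [HM [H1 H2]]]]].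
assert (E : (0 - 0)%C = RtoC 0) by ring.
exists d, M. split; [easy|split;[easy|split]].
- intros z Hz. destruct (H1 z 0) as [Q1 [Q2 _]]; [|easy].
  split. easy. rewrite E, Cmod_0. easy.
- intros z w Hz Hw. generalize (H2 z 0 w 0). unfold near2, dist2.
  rewrite E, Cmod_0, Rplus_0_r. intros H'.
  destruct H' as [Q1 Q2]; [easy|easy|]. split. easy.
  replace (_ - _ - _)%C with (f w - f z - (f' z * (w - z) + 0 * 0))%C by ring.
  easy.
Qed.

Lemma hol_deriv_cont f f' p :
  hol f f' p -> exists d L, 0 < d /\ 0 <= L /\
  forall z, Cmod (z - p)%C < d -> Cmod (f' z - f' p)%C <= L * Cmod (z - p)%C.
Proof.
intros H.
destruct (hol2_partial_cont _ _ _ _ _ (hol_hol2 _ _ _ 0 H))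
  as [d [M [Hd [HM H1]]]].
exists d, M. split; [easy|split;[easy|]]. intros z Hz.
generalize (H1 z 0). unfold near2, dist2.
rewrite Cmod_diag, Rplus_0_r.
intros H'. apply H'. easy.
Qed.

Lemma hol_const c p : hol (fun _ => c) (fun _ => RtoC 0) p.
Proof. exact (hol2_hol _ _ _ _ _ (hol2_const c p 0)). Qed.

Lemma hol_id p : hol (fun z => z) (fun _ => RtoC 1) p.
Proof. exact (hol2_hol _ _ _ _ _ (hol2_fst p 0)). Qed.

Lemma hol_plus f f' g g' p : hol f f' p -> hol g g' p ->
  hol (fun z => f z + g z)%C (fun z => f' z + g' z)%C p.
Proof.
intros H1 H2. exact (hol2_hol _ _ _ _ _
  (hol2_plus _ _ _ _ _ _ _ _ (hol_hol2 _ _ _ 0 H1) (hol_hol2 _ _ _ 0 H2))).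
Qed.

Lemma hol_mult f f' g g' p : hol f f' p -> hol g g' p ->
  hol (fun z => f z * g z)%C (fun z => f' z * g z + f z * g' z)%C p.
Proof.
intros H1 H2. exact (hol2_hol _ _ _ _ _
  (hol2_mult _ _ _ _ _ _ _ _ (hol_hol2 _ _ _ 0 H1) (hol_hol2 _ _ _ 0 H2))).
Qed.

Lemma hol2_comp F F' f A B m0 y0 :
  hol F F' (f m0 y0) -> hol2 f A B m0 y0 ->
  hol2 (fun m y => F (f m y)) (fun m y => F' (f m y) * A m y)%C
    (fun m y => F' (f m y) * B m y)%C m0 y0.
Proof.
intros HF Hf.
destruct (hol_bounds _ _ _ HF) as [d [M [Hd [HM [H1 H2]]]]].
destruct (hol2_bounds _ _ _ _ _ Hf) as [d' [M' [Hd' [HM' [H1' H2']]]]].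
set (e := Rmin d' (d / (2 * M' + 1))).
assert (He : 0 < e).
{ apply Rmin_pos; [easy|]. apply Rdiv_lt_0_compat; lra. }
assert (Hin : forall m y, near2 e m0 y0 m y -> Cmod (f m y - f m0 y0)%C < d).
{ intros m y Hn. destruct (H2' m0 y0 m y) as [Q _].
  apply near2_center; lra. eapply near2_mono; [|exact Hn]. apply Rmin_l.
  eapply Rle_lt_trans. exact Q.
  assert (dist2 m0 y0 m y <= 2 * e) by (unfold dist2; destruct Hn; lra).
  assert (He2 : e * (2 * M' + 1) <= d).
  { apply Rle_trans with (d / (2 * M' + 1) * (2 * M' + 1)).
    apply Rmult_le_compat_r. lra. apply Rmin_r. right. field. lra. }
  generalize (dist2_ge0 m0 y0 m y). intros. nra. }
exists e, (M * M' ^ 2 + M * M'). split; [easy|split;[nra|]].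
intros m y m' y' Hn Hn'.
destruct (H2' m y m' y' (near2_mono _ _ _ _ _ _ (Rmin_l _ _) Hn)
     (near2_mono _ _ _ _ _ _ (Rmin_l _ _) Hn')) as [G1 G2].
destruct (H1 (f m y) (Hin _ _ Hn)) as [_ F1].
destruct (H2 (f m y) (f m' y') (Hin _ _ Hn) (Hin _ _ Hn')) as [_ F2].
set (n := dist2 m y m' y') in *.
set (u := (F (f m' y') - F (f m y) - _)%C) in *.
set (v := (f m' y' - f m y - _)%C) in *.
replace (_ - _ - _)%C with (u + F' (f m y) * v)%C by (unfold u, v; ring).
eapply Rle_trans. apply Cmod_triangle. rewrite Cmod_mult.
assert (0 <= n) by apply dist2_ge0.
assert (Cmod (f m' y' - f m y) ^ 2 <= (M' * n) ^ 2).
{ apply pow_incr. split; [apply Cmod_ge_0|easy]. }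
assert (Cmod (F' (f m y)) * Cmod v <= M * (M' * n ^ 2)).
{ apply Rmult_le_compat; try easy; apply Cmod_ge_0. }
nra.
Qed.

Lemma hol_comp F F' f f' p :
  hol F F' (f p) -> hol f f' p ->
  hol (fun z => F (f z)) (fun z => F' (f z) * f' z)%C p.
Proof.
intros H1 H2. exact (hol2_hol _ _ _ _ _
  (hol2_comp _ _ (fun m _ => f m) _ _ p 0 H1 (hol_hol2 _ _ _ 0 H2))).
Qed.

Lemma hol_inv (p : C) : p <> 0%C -> hol (fun z => / z)%C (fun z => - / (z * z))%C p.
Proof.
intros Hp. assert (H0 : 0 < Cmod p) by now apply Cmod_gt_0.
set (a := Cmod p) in *.
assert (Hz : forall z, Cmod (z - p)%C < a / 2 -> a / 2 <= Cmod z /\ z <> 0%C).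
{ intros z Hz. generalize (Cmod_le_sub p z). rewrite Cmod_minus_sym.
  fold a. intros. assert (a / 2 <= Cmod z) by lra. split. easy.
  apply Cmod_gt_0. lra. }
exists (a / 2), (8 / a ^ 3). split; [lra|split].
{ apply Rlt_le, Rdiv_lt_0_compat. lra. apply pow_lt. lra. }
intros z w H1 H2. destruct (Hz z H1) as [Z1 Z2], (Hz w H2) as [W1 W2].
replace (_ - _ - _)%C with ((w - z) * (w - z) * (/ z * / z * / w))%C
  by (field; easy).
rewrite !Cmod_mult, !Cmod_inv by easy.
replace (_ * _ * _) with
  (Cmod (w - z) ^ 2 * (/ Cmod z * / Cmod z * / Cmod w)) by ring.
rewrite Rmult_comm. apply Rmult_le_compat_r. apply pow2_ge_0.
replace (8 / a ^ 3) with (/ (a / 2) * / (a / 2) * / (a / 2)) by (field; lra).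
assert (Pi : 0 < / (a / 2)) by (apply Rinv_0_lt_compat; lra).
assert (I1 : / Cmod z <= / (a / 2)) by (apply Rinv_le_contravar; lra).
assert (I2 : / Cmod w <= / (a / 2)) by (apply Rinv_le_contravar; lra).
assert (0 < / Cmod z) by (apply Rinv_0_lt_compat; lra).
assert (0 < / Cmod w) by (apply Rinv_0_lt_compat; lra).
apply Rmult_le_compat; [nra|lra| |easy]. apply Rmult_le_compat; lra.
Qed.

(** * The principal square root *)

Definition csqrt (z : C) : C :=
  (sqrt ((Cmod z + Re z) / 2),
   (if Rle_dec 0 (Im z) then 1 else -1) * sqrt ((Cmod z - Re z) / 2)).

Lemma csqrt_sqr z : (csqrt z * csqrt z)%C = z.
Proof.
assert (H := re_le_Cmod z). apply Rabs_le_between in H.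
assert (P1 : 0 <= (Cmod z + Re z) / 2) by lra.
assert (P2 : 0 <= (Cmod z - Re z) / 2) by lra.
assert (E : sqrt ((Cmod z + Re z) / 2) * sqrt ((Cmod z - Re z) / 2)
  = Rabs (Im z) / 2).
{ rewrite <- sqrt_mult by easy.
  replace ((Cmod z + Re z) / 2 * ((Cmod z - Re z) / 2))
   with (Rsqr (Im z / 2)).
  rewrite sqrt_Rsqr_abs, Rabs_div, (Rabs_pos_eq 2) by lra. easy.
  unfold Rsqr. generalize (Cmod2_alt z). intros. nra. }
apply injective_projections; unfold csqrt; simpl.
- generalize (sqrt_sqrt _ P1) (sqrt_sqrt _ P2).
  destruct Rle_dec; intros; unfold Re in *; nra.
- destruct Rle_dec as [h|h].
  + rewrite Rabs_pos_eq in E by easy. unfold Im in *. nra.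
  + rewrite Rabs_left in E by lra. unfold Im in *. nra.
Qed.

Lemma csqrt_re_ge0 z : 0 <= Re (csqrt z).
Proof. apply sqrt_pos. Qed.

Lemma csqrt_re_pos z : (Im z = 0 -> 0 < Re z) -> 0 < Re (csqrt z).
Proof.
intros H. apply sqrt_lt_R0.
assert (P := re_le_Cmod z). apply Rabs_le_between in P.
destruct (Req_dec (Im z) 0) as [E|E].
- specialize (H E). lra.
- assert (K := Cmod2_alt z). assert (0 < (Im z) ^ 2) by nra.
  destruct (Req_dec (Cmod z + Re z) 0) as [E1|E1]; [|lra].
  replace (Cmod z) with (- Re z) in K by lra. nra.
Qed.

Arguments csqrt : simpl never.

Lemma csqrt_im z : 0 < Re (csqrt z) ->
  (0 <= Im z -> 0 <= Im (csqrt z)) /\ (Im z <= 0 -> Im (csqrt z) <= 0).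
Proof.
intros H. assert (E : Im z = 2 * (Re (csqrt z) * Im (csqrt z))).
{ rewrite <- (csqrt_sqr z) at 1. simpl. unfold Re, Im. ring. }
set (a := Re (csqrt z)) in *. set (b := Im (csqrt z)) in *.
split; intros.
- destruct (Rle_dec 0 b). easy. assert (a * b < 0) by nra. lra.
- destruct (Rle_dec b 0). easy. assert (0 < a * b) by nra. lra.
Qed.

(** Both roots have nonnegative real part, so their sum is bounded below; dividing
[w - z] by this sum needs no discussion of the cut. *)
Lemma csqrt_lip z w : 0 < Re (csqrt z) ->
  Cmod (csqrt w - csqrt z)%C <= Cmod (w - z)%C / Re (csqrt z).
Proof.
intros H.
assert (E : Cmod (w - z) =
  Cmod (csqrt w - csqrt z) * Cmod (csqrt w + csqrt z)).
{ rewrite <- Cmod_mult. f_equal.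
  rewrite <- (csqrt_sqr w) at 1. rewrite <- (csqrt_sqr z) at 1. ring. }
assert (L : Re (csqrt z) <= Cmod (csqrt w + csqrt z)).
{ eapply Rle_trans. 2: apply re_le_Cmod. eapply Rle_trans. 2: apply Rle_abs.
  change (Re (csqrt z) <= Re (csqrt w) + Re (csqrt z)).
  generalize (csqrt_re_ge0 w). lra. }
apply Rmult_le_reg_r with (1 := H).
replace (_ / _ * _) with (Cmod (w - z)).
2:{ field. apply Rgt_not_eq. exact H. }
rewrite E. apply Rmult_le_compat_l. apply Cmod_ge_0. easy.
Qed.

Lemma hol_csqrt p : 0 < Re (csqrt p) ->
  hol csqrt (fun z => / (2 * csqrt z))%C p.
Proof.
intros Hp. set (a := Re (csqrt p)) in *.
assert (Hz : forall z, Cmod (z - p)%C < a * a / 2 -> a / 2 <= Re (csqrt z)).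
{ intros z Hz. assert (L := csqrt_lip p z Hp). fold a in L.
  assert (Cmod (z - p) / a <= a / 2).
  { apply Rmult_le_reg_r with (1 := Hp).
    replace (_ / _ * _) with (Cmod (z - p)) by (field; lra). lra. }
  assert (K := re_le_Cmod (csqrt z - csqrt p)).
  rewrite Re_sub in K. fold a in K. apply Rabs_le_between in K. lra. }
exists (a * a / 2), (4 / a ^ 3). split; [nra|split].
{ apply Rlt_le, Rdiv_lt_0_compat. lra. apply pow_lt. lra. }
intros z w H1 H2.
assert (Z := Hz z H1). assert (W := Hz w H2).
assert (Zn : csqrt z <> 0%C).
{ intros E. rewrite E in Z. simpl in Z. lra. }
assert (Sl : a <= Cmod (csqrt w + csqrt z)).
{ eapply Rle_trans. 2: apply re_le_Cmod. eapply Rle_trans. 2: apply Rle_abs.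
  change (a <= Re (csqrt w) + Re (csqrt z)). lra. }
assert (Sn : (csqrt w + csqrt z)%C <> 0%C).
{ apply Cmod_gt_0. lra. }
assert (Zl : a / 2 <= Cmod (csqrt z)).
{ eapply Rle_trans. exact Z. eapply Rle_trans. apply Rle_abs.
  apply re_le_Cmod. }
assert (E : Cmod (w - z) =
  Cmod (csqrt w - csqrt z) * Cmod (csqrt w + csqrt z)).
{ rewrite <- Cmod_mult. f_equal.
  rewrite <- (csqrt_sqr w) at 1. rewrite <- (csqrt_sqr z) at 1. ring. }
assert (D : Cmod (csqrt w - csqrt z) <= Cmod (w - z) / a).
{ apply Rmult_le_reg_r with (1 := Hp).
  replace (_ / _ * _) with (Cmod (w - z)) by (field; lra).
  rewrite E. apply Rmult_le_compat_l. apply Cmod_ge_0. easy. }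
assert (X : Cmod (csqrt w - csqrt z - / (2 * csqrt z) * (w - z)) =
  Cmod (csqrt w - csqrt z) ^ 2 * / (2 * Cmod (csqrt z))).
{ replace (csqrt w - csqrt z - / (2 * csqrt z) * (w - z))%C with
   (- ((csqrt w - csqrt z) * (csqrt w - csqrt z)) * / (2 * csqrt z))%C.
  2:{ generalize (csqrt_sqr w) (csqrt_sqr z) Zn.
      generalize (csqrt w) (csqrt z). intros u v <- <- Hv.
      field. easy. }
  rewrite Cmod_mult, Cmod_opp, Cmod_mult, Cmod_inv, Cmod_mult, Cmod_R.
  rewrite (Rabs_pos_eq 2) by lra. ring.
  apply Cmult_neq_0; [|easy]. intros K. injection K. lra. }
rewrite X.
apply Rle_trans with ((Cmod (w - z) / a) ^ 2 * / a).
- apply Rmult_le_compat. apply pow2_ge_0.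
  apply Rlt_le, Rinv_0_lt_compat; lra.
  apply pow_incr. split; [apply Cmod_ge_0|easy].
  apply Rinv_le_contravar; lra.
- replace ((Cmod (w - z) / a) ^ 2 * / a) with (1 / a ^ 3 * Cmod (w - z) ^ 2)
    by (field; lra).
  apply Rmult_le_compat_r. apply pow2_ge_0.
  assert (0 < / a ^ 3) by (apply Rinv_0_lt_compat, pow_lt; lra).
  unfold Rdiv. lra.
Qed.

(** * Conjugation *)

Lemma Cconj_sub a b : Cconj (a - b)%C = (Cconj a - Cconj b)%C.
Proof. apply injective_projections; simpl; ring. Qed.
Lemma Cconj_add a b : Cconj (a + b)%C = (Cconj a + Cconj b)%C.
Proof. apply injective_projections; simpl; ring. Qed.
Lemma Cconj_mul a b : Cconj (a * b)%C = (Cconj a * Cconj b)%C.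
Proof. apply injective_projections; simpl; ring. Qed.

Lemma hol2_conj f A B m0 y0 :
  hol2 f A B (Cconj m0) (Cconj y0) ->
  hol2 (fun m y => Cconj (f (Cconj m) (Cconj y)))
    (fun m y => Cconj (A (Cconj m) (Cconj y)))
    (fun m y => Cconj (B (Cconj m) (Cconj y))) m0 y0.
Proof.
intros [d [M [Hd [HM H]]]]. exists d, M. split; [easy|split;[easy|]].
assert (Hn : forall m y, near2 d m0 y0 m y ->
  near2 d (Cconj m0) (Cconj y0) (Cconj m) (Cconj y)).
{ intros m y [H1 H2]. split; rewrite <- Cconj_sub, Cmod_conj; easy. }
intros m y m' y' H1 H2.
generalize (H _ _ _ _ (Hn _ _ H1) (Hn _ _ H2)).
unfold dist2. rewrite <- !Cconj_sub, !Cmod_conj.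
intros H'. eapply Rle_trans. 2: exact H'. right.
rewrite <- Cmod_conj. f_equal.
rewrite !Cconj_sub, !Cconj_add, !Cconj_mul, !Cconj_sub, !Cconj_conj. easy.
Qed.

Lemma hol_conj f f' p :
  hol f f' (Cconj p) ->
  hol (fun z => Cconj (f (Cconj z))) (fun z => Cconj (f' (Cconj z))) p.
Proof.
intros H.
exact (hol2_hol _ _ _ p (Cconj 0) (hol2_conj _ _ _ p _ (hol_hol2 f f' _ _ H))).
Qed.

(** * The holomorphic implicit function theorem *)

Lemma Cmod_small_eq (a b : C) :
  (forall eps, 0 < eps -> Cmod (a - b)%C <= eps) -> a = b.
Proof.
intros H. replace a with (b + (a - b))%C by ring.
rewrite (Cmod_eq_0 (a - b)%C). ring.
apply Rle_antisym. 2: apply Cmod_ge_0.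
apply Rnot_lt_le. intros h. specialize (H (Cmod (a - b) / 2)). lra.
Qed.

(** The iterates of the centre form a series dominated by a geometric one. *)
Lemma contraction_fixpoint (G : C -> C) (c : C) (r : R) :
  0 <= r ->
  (forall x, Cmod (x - c)%C <= r -> Cmod (G x - c)%C <= r) ->
  (forall x y, Cmod (x - c)%C <= r -> Cmod (y - c)%C <= r ->
     Cmod (G x - G y)%C <= / 2 * Cmod (x - y)%C) ->
  exists l, Cmod (l - c)%C <= r /\ G l = l.
Proof.
intros Hr Hin HG.
assert (Hex : exists x : nat -> C, x O = c /\ forall n, x (S n) = G (x n)).
{ now exists (fun n => Nat.iter n G c). }
destruct Hex as [x [x0 xS]].
assert (Hx : forall n, Cmod (x n - c)%C <= r).
{ induction n as [|n IH].
  - rewrite x0. rewrite Cmod_diag. easy.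
  - rewrite xS. now apply Hin. }
assert (Hd : forall n, Cmod (x (S n) - x n)%C <= r * (/ 2) ^ n).
{ induction n as [|n IH].
  - rewrite x0, pow_O, Rmult_1_r. apply Hx.
  - assert (K := HG _ _ (Hx (S n)) (Hx n)). rewrite <- !xS in K.
    simpl pow. lra. }
assert (Hs : ex_series (V := C_R_CompleteNormedModule)
   (fun n => (x (S n) - x n)%C)).
{ apply (ex_series_le (V := C_R_CompleteNormedModule) _
    (fun n => r * (/ 2) ^ n)).
  - intros n. rewrite <- Cmod_norm. apply Hd.
  - apply (ex_series_scal (V := R_NormedModule)). apply ex_series_geom.
    rewrite Rabs_pos_eq; lra. }
destruct Hs as [s Hs].
assert (Hsum : forall n, sum_n (G := C_R_CompleteNormedModule)
   (fun n => (x (S n) - x n)%C) n = (x (S n) - c)%C).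
{ induction n as [|n IH].
  - rewrite sum_O, x0. easy.
  - rewrite sum_Sn, IH.
    assert (E : ((x (S n) - c) + (x (S (S n)) - x (S n))
      = x (S (S n)) - c)%C) by ring.
    exact E. }
assert (Hl : forall eps, 0 < eps -> exists N, forall n, (N <= n)%nat ->
  Cmod (x (S n) - (c + s))%C < eps).
{ intros eps Heps.
  assert (T := proj1 (filterlim_locally_ball_norm (U := C_R_NormedModule) _ s)
     Hs (mkposreal eps Heps)).
  destruct T as [N HN]. exists N. intros n Hn.
  specialize (HN n Hn). unfold ball_norm in HN.
  rewrite Hsum, <- Cmod_norm in HN. simpl in HN.
  replace (x (S n) - (c + s))%C with (minus (x (S n) - c)%C s); [exact HN|].
  assert (E : (x (S n) - c + - s = x (S n) - (c + s))%C) by ring.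
  exact E. }
exists (c + s)%C. assert (Hlr : Cmod (c + s - c)%C <= r).
{ apply le_epsilon. intros eps Heps.
  destruct (Hl eps Heps) as [N HN]. specialize (HN N (le_n _)).
  generalize (Cmod_sub_trans (c + s) (x (S N)) c) (Hx (S N)).
  rewrite Cmod_minus_sym in HN. lra. }
split. easy.
apply Cmod_small_eq. intros eps Heps.
destruct (Hl (eps / 2)) as [N HN]. lra.
generalize (HN N (le_n _)) (HN (S N) (le_S _ _ (le_n _))).
generalize (Cmod_sub_trans (G (c + s)%C) (x (S (S N))) (c + s)%C).
generalize (HG _ _ Hlr (Hx (S N))). rewrite <- xS.
rewrite (Cmod_minus_sym (c + s)%C). lra.
Qed.

(** The solution is the fixed point of Newton's map with frozen derivative,
[m - H m y / A m0 y0]. The same Lipschitz estimate gives uniqueness and makes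
the solution Lipschitz in [y]; the expansion of [H] then yields its derivative. *)
Lemma hol2_implicit (H A B : C -> C -> C) (m0 y0 : C) :
  hol2 H A B m0 y0 -> H m0 y0 = 0%C -> A m0 y0 <> 0%C ->
  exists (mu mu' : C -> C) (d r : R), 0 < d /\ 0 < r /\ hol mu mu' y0 /\
  forall y, Cmod (y - y0)%C < d ->
    Cmod (mu y - m0)%C < r /\ H (mu y) y = 0%C /\
    forall m, Cmod (m - m0)%C < r -> H m y = 0%C -> m = mu y.
Proof.
intros HH H0 HA.
destruct (hol2_partial_cont _ _ _ _ _ HH) as [d1 [L [Hd1 [HL H1]]]].
destruct (hol2_bounds _ _ _ _ _ HH) as [d2 [M [Hd2 [HM [H2 H3]]]]].
set (a := Cmod (A m0 y0)).
assert (Ha : 0 < a) by now apply Cmod_gt_0.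
set (r := Rmin (Rmin d1 d2) (a / (8 * (L + M + 1)))).
assert (Hr : 0 < r).
{ repeat apply Rmin_pos; try easy. apply Rdiv_lt_0_compat; lra. }
assert (Hrd : r <= d1 /\ r <= d2).
{ unfold r. generalize (Rmin_l (Rmin d1 d2) (a / (8 * (L + M + 1))))
   (Rmin_l d1 d2) (Rmin_r d1 d2). lra. }
assert (Hra : (L + M + 1) * r <= a / 8).
{ apply Rle_trans with ((L + M + 1) * (a / (8 * (L + M + 1)))).
  apply Rmult_le_compat_l. lra. apply Rmin_r. right. field. lra. }
assert (HAm : forall m y, near2 r m0 y0 m y ->
  Cmod (A m y - A m0 y0)%C <= a / 4).
{ intros m y Hn. eapply Rle_trans. apply H1.
  eapply near2_mono; [|exact Hn]. easy.
  assert (dist2 m0 y0 m y <= 2 * r) by (unfold dist2; destruct Hn; lra).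
  generalize (dist2_ge0 m0 y0 m y). intros. nra. }
assert (Hdiff : forall m m' y, near2 r m0 y0 m y -> near2 r m0 y0 m' y ->
  Cmod (H m' y - H m y - A m0 y0 * (m' - m))%C <= a / 2 * Cmod (m' - m)%C).
{ intros m m' y Hn Hn'.
  destruct (H3 m y m' y) as [_ Q].
  eapply near2_mono; [|exact Hn]. easy. eapply near2_mono; [|exact Hn']. easy.
  unfold dist2 in Q. replace (y - y)%C with (RtoC 0) in Q by ring.
  rewrite Cmod_0, Rplus_0_r in Q.
  assert (K := HAm m y Hn).
  set (u := (H m' y - H m y - _)%C) in Q.
  replace (H m' y - H m y - A m0 y0 * (m' - m))%C with
    (u + (A m y - A m0 y0) * (m' - m))%C by (unfold u; ring).
  eapply Rle_trans. apply Cmod_triangle. rewrite Cmod_mult.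
  assert (Cmod (m' - m) <= 2 * r).
  { generalize (Cmod_sub_trans m' m0 m). rewrite (Cmod_minus_sym m0).
    destruct Hn, Hn'. lra. }
  set (D := Cmod (m' - m)) in *.
  assert (0 <= D) by apply Cmod_ge_0.
  assert (M * D ^ 2 <= M * (2 * r) * D).
  { replace (M * D ^ 2) with (M * D * D) by ring.
    apply Rmult_le_compat_r. easy. apply Rmult_le_compat_l; easy. }
  assert (M * (2 * r) <= a / 4) by nra.
  assert (M * (2 * r) * D <= a / 4 * D) by now apply Rmult_le_compat_r.
  assert (Cmod (A m y - A m0 y0) * D <= a / 4 * D)
    by now apply Rmult_le_compat_r.
  lra. }
set (d := Rmin r (a * r / (8 * (M + 1)))).
assert (Hd : 0 < d).
{ apply Rmin_pos. easy. apply Rdiv_lt_0_compat; nra. }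
assert (Hdr : d <= r) by apply Rmin_l.
assert (HdM : M * d <= a * r / 8).
{ apply Rle_trans with ((M + 1) * (a * r / (8 * (M + 1)))).
  2: right; field; lra.
  apply Rmult_le_compat; try lra. apply Rmin_r. }
assert (Ex : forall y, exists m, Cmod (y - y0)%C < d ->
  Cmod (m - m0)%C < r /\ H m y = 0%C).
{ intros y. destruct (Rlt_dec (Cmod (y - y0)) d) as [Hy|Hy].
  2: exists m0; intros; lra.
  set (G := fun m => (m - H m y / A m0 y0)%C).
  assert (HGG : forall m m', Cmod (m - m0)%C <= r / 2 ->
    Cmod (m' - m0)%C <= r / 2 ->
    Cmod (G m' - G m)%C <= / 2 * Cmod (m' - m)%C).
  { intros m m' Hm Hm'.
    apply Rmult_le_reg_l with (1 := Ha).
    unfold a at 1. rewrite <- Cmod_mult.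
    replace (A m0 y0 * (G m' - G m))%C with
      (- (H m' y - H m y - A m0 y0 * (m' - m)))%C by (unfold G; field; easy).
    rewrite Cmod_opp.
    generalize (Hdiff m m' y). unfold near2. intros Q.
    lapply Q; [clear Q; intros Q|lra]. lapply Q; [|lra]. lra. }
  destruct (contraction_fixpoint G m0 (r / 2)) as [l [Hl1 Hl2]].
  - lra.
  - intros m Hm.
    generalize (HGG m0 m). rewrite Cmod_diag. intros Q.
    lapply Q; [clear Q; intros Q|lra]. specialize (Q Hm).
    generalize (Cmod_sub_trans (G m) (G m0) m0).
    assert (Cmod (G m0 - m0) <= r / 4).
    { replace (G m0 - m0)%C with (- (H m0 y / A m0 y0))%C
        by (unfold G; ring).
      rewrite Cmod_opp, Cmod_div by easy. fold a.
      apply Rmult_le_reg_r with (1 := Ha).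
      unfold Rdiv at 1. rewrite Rmult_assoc, Rinv_l, Rmult_1_r by lra.
      destruct (H3 m0 y0 m0 y) as [Q1 _].
      apply near2_center; lra. split; [|lra].
      rewrite Cmod_diag. lra.
      unfold dist2 in Q1. replace (m0 - m0)%C with (RtoC 0) in Q1 by ring.
      rewrite Cmod_0, Rplus_0_l, H0 in Q1.
      replace (H m0 y - 0)%C with (H m0 y) in Q1 by ring.
      generalize (Cmod_ge_0 (y - y0)). intros. nra. }
    lra.
  - intros m m' Hm Hm'. now apply HGG.
  - exists l. intros _. split. lra.
    replace (H l y) with ((l - G l) * A m0 y0)%C by (unfold G; field; easy).
    rewrite Hl2. ring. }
destruct (functional_choice _ Ex) as [mu Hmu].
exists mu, (fun y => - (B (mu y) y / A (mu y) y))%C, d, r.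
split. easy. split. easy. split.
2:{ intros y Hy. destruct (Hmu y Hy) as [E1 E2]. split; [easy|split;[easy|]].
  intros m Hm Em.
  generalize (Hdiff (mu y) m y). unfold near2. intros Q.
  lapply Q; [clear Q; intros Q|lra]. lapply Q; [clear Q|lra].
  rewrite E2, Em.
  replace (0 - 0 - A m0 y0 * (m - mu y))%C with (- (A m0 y0 * (m - mu y)))%C
    by ring.
  rewrite Cmod_opp, Cmod_mult. fold a. intros Q.
  generalize (Cmod_ge_0 (m - mu y)). intros.
  replace m with (mu y + (m - mu y))%C by ring.
  rewrite (Cmod_eq_0 (m - mu y)). ring. nra. }
set (K := 2 * M / a).
assert (HK : 0 <= K) by (apply Rdiv_le_0_compat; lra).
exists d, (2 / a * (M * (K + 1) ^ 2)). split. easy. split.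
{ apply Rmult_le_pos. apply Rdiv_le_0_compat; lra. nra. }
intros z w Hz Hw.
destruct (Hmu z Hz) as [Z1 Z2], (Hmu w Hw) as [W1 W2].
assert (Nz : near2 r m0 y0 (mu z) z) by (split; lra).
assert (Nw : near2 r m0 y0 (mu w) w) by (split; lra).
assert (Nzw : near2 r m0 y0 (mu z) w) by (split; lra).
assert (Lip : Cmod (mu w - mu z) <= K * Cmod (w - z)).
{ assert (Q := Hdiff _ _ _ Nzw Nw). rewrite W2 in Q.
  destruct (H3 (mu z) z (mu z) w) as [Q1 _].
  eapply near2_mono; [|exact Nz]. easy. eapply near2_mono; [|exact Nzw]. easy.
  unfold dist2 in Q1. replace (mu z - mu z)%C with (RtoC 0) in Q1 by ring.
  rewrite Cmod_0, Rplus_0_l, Z2 in Q1.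
  replace (H (mu z) w - 0)%C with (H (mu z) w) in Q1 by ring.
  generalize (Cmod_le_sub (A m0 y0 * (mu w - mu z)) (- H (mu z) w)).
  rewrite Cmod_opp, Cmod_mult. fold a.
  replace (A m0 y0 * (mu w - mu z) - - H (mu z) w)%C with
   (- (0 - H (mu z) w - A m0 y0 * (mu w - mu z)))%C by ring.
  rewrite Cmod_opp. intros.
  apply Rmult_le_reg_l with (a / 2). lra.
  replace (a / 2 * (K * Cmod (w - z))) with (M * Cmod (w - z))
    by (unfold K; field; lra).
  lra. }
destruct (H3 (mu z) z (mu w) w) as [_ Q].
eapply near2_mono; [|exact Nz]. easy. eapply near2_mono; [|exact Nw]. easy.
rewrite Z2, W2 in Q.
replace (0 - 0 - (A (mu z) z * (mu w - mu z) + B (mu z) z * (w - z)))%C with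
 (- (A (mu z) z * (mu w - mu z) + B (mu z) z * (w - z)))%C in Q by ring.
rewrite Cmod_opp in Q.
assert (An : a / 2 <= Cmod (A (mu z) z)).
{ generalize (HAm _ _ Nz) (Cmod_le_sub (A m0 y0) (A (mu z) z)).
  rewrite Cmod_minus_sym. fold a. lra. }
assert (An0 : A (mu z) z <> 0%C) by (apply Cmod_gt_0; lra).
replace (mu w - mu z - - (B (mu z) z / A (mu z) z) * (w - z))%C with
 ((A (mu z) z * (mu w - mu z) + B (mu z) z * (w - z)) / A (mu z) z)%C
 by (field; easy).
rewrite Cmod_div by easy. unfold Rdiv at 1. rewrite Rmult_comm.
replace (2 / a * (M * (K + 1) ^ 2) * Cmod (w - z) ^ 2) with
 (/ (a / 2) * (M * ((K + 1) * Cmod (w - z)) ^ 2)) by (field; lra).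
apply Rmult_le_compat.
- apply Rlt_le, Rinv_0_lt_compat. lra.
- apply Cmod_ge_0.
- apply Rinv_le_contravar; lra.
- eapply Rle_trans. exact Q. apply Rmult_le_compat_l. easy.
  apply pow_incr. split. apply dist2_ge0. unfold dist2. lra.
Qed.

Lemma Cconj_R (x : R) : Cconj x = RtoC x.
Proof. apply injective_projections; simpl; ring. Qed.

Lemma C_ext (a b : C) : Re a = Re b -> Im a = Im b -> a = b.
Proof. apply injective_projections. Qed.

(** The real equation [Im N = 0] becomes holomorphic as [H m y = N m y - conj (N
(conj m) (conj y))]. For real [y] the conjugate of a solution is a solution, so
uniqueness makes the solution real. *)
Lemma real_implicit (N A B : C -> C -> C) (m0 y0 : R) :
  hol2 N A B m0 y0 -> Im (N m0 y0) = 0 -> Im (A m0 y0) <> 0 ->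
  exists (mu : R -> R) (F F' : C -> C) (d : R), 0 < d /\ hol F F' y0 /\
  mu y0 = m0 /\
  forall y : R, Rabs (y - y0) < d ->
    F y = RtoC (mu y) /\ Im (N (mu y) y) = 0.
Proof.
intros HN N0 A0.
assert (HNc : hol2 N A B (Cconj m0) (Cconj y0)) by now rewrite !Cconj_R.
set (H := fun m y => (N m y + (- (1)) * Cconj (N (Cconj m) (Cconj y)))%C).
assert (HH := hol2_plus _ _ _ _ _ _ _ _ HN
  (hol2_mult _ _ _ _ _ _ _ _ (hol2_const (- (1))%C m0 y0)
     (hol2_conj _ _ _ _ _ HNc))).
assert (HHr : forall m y : R, H m y = (2 * Ci * Im (N m y))%C).
{ intros m y. unfold H. rewrite !Cconj_R.
  apply injective_projections; simpl; unfold Im; ring. }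
destruct (hol2_implicit _ _ _ _ _ HH) as [F [F' [d [r [Hd [Hr [HF HF']]]]]]].
- change (H m0 y0 = 0%C). rewrite HHr, N0. ring.
- cbv beta. rewrite !Cconj_R.
  intros E. apply A0. apply (f_equal Im) in E. simpl in E. unfold Im. lra.
- assert (HFr : forall y : R, Rabs (y - y0) < d -> Cconj (F y) = F y).
  { intros y Hy. rewrite <- Cmod_R, RtoC_minus in Hy.
    destruct (HF' y Hy) as [E1 [E2 E3]]. apply E3.
    - rewrite <- (Cconj_R m0), <- Cconj_sub, Cmod_conj. easy.
    - change (H (F y) y = 0%C) in E2. change (H (Cconj (F y)) y = 0%C).
      unfold H in *. rewrite Cconj_R, Cconj_conj in *.
      replace (N (Cconj (F y)) y + - (1) * Cconj (N (F y) y))%C with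
        (- (Cconj (N (F y) y + - (1) * Cconj (N (Cconj (F y)) y))))%C.
      rewrite E2. apply injective_projections; simpl; ring.
      rewrite Cconj_add, Cconj_mul, Cconj_conj.
      replace (Cconj (- (1))) with (- (1))%C
        by (apply injective_projections; simpl; ring).
      ring. }
  assert (HFre : forall y : R, Rabs (y - y0) < d -> F y = RtoC (Re (F y))).
  { intros y Hy. apply C_ext. easy. specialize (HFr y Hy).
    apply (f_equal Im) in HFr. simpl in *. unfold Im in *. lra. }
  exists (fun y => Re (F y)), F, F', d. split. easy. split. easy. split.
  + assert (Hy : Rabs (y0 - y0) < d) by (rewrite Rminus_diag, Rabs_R0; lra).
    rewrite <- Cmod_R, RtoC_minus in Hy.
    destruct (HF' y0 Hy) as [_ [_ E]]. rewrite <- (E m0).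
    * easy.
    * rewrite Cmod_diag. easy.
    * change (H m0 y0 = 0%C). rewrite HHr, N0. ring.
  + intros y Hy. split. now apply HFre.
    rewrite <- (HFre y Hy).
    assert (Hy' := Hy). rewrite <- Cmod_R, RtoC_minus in Hy'.
    destruct (HF' y Hy') as [_ [E _]]. change (H (F y) y = 0%C) in E.
    rewrite (HFre y Hy) in E. rewrite HHr in E.
    rewrite <- (HFre y Hy) in E.
    apply (f_equal Im) in E. simpl in E. unfold Im in *. lra.
Qed.

(** * Derivatives along curves *)

Lemma is_derive_eps (f : R -> R) (t l : R) :
  is_derive f t l <->
  forall eps, 0 < eps -> exists d, 0 < d /\ forall s, Rabs (s - t) < d ->
    Rabs (f s - f t - l * (s - t)) <= eps * Rabs (s - t).
Proof.
rewrite is_derive_Reals. split.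
- intros H eps Heps. destruct (H eps Heps) as [d Hd].
  exists d. split. apply cond_pos.
  intros s Hs. destruct (Req_dec s t) as [->|Hst].
  + rewrite !Rminus_diag, Rmult_0_r, Rminus_0_r, Rabs_R0. lra.
  + specialize (Hd (s - t)). replace (t + (s - t)) with s in Hd by ring.
    assert (K : Rabs ((f s - f t) / (s - t) - l) < eps) by (apply Hd; lra).
    replace (f s - f t - l * (s - t)) with
      (((f s - f t) / (s - t) - l) * (s - t)) by (field; lra).
    rewrite Rabs_mult. apply Rmult_le_compat_r. apply Rabs_pos. lra.
- intros H eps Heps. destruct (H (eps / 2)) as [d [Hd0 Hd]]. lra.
  exists (mkposreal d Hd0). simpl. intros h Hh Hhd.
  specialize (Hd (t + h)). replace (t + h - t) with h in Hd by ring.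
  specialize (Hd Hhd).
  assert (0 < Rabs h) by now apply Rabs_pos_lt.
  apply Rmult_lt_reg_r with (Rabs h). easy.
  rewrite <- Rabs_mult.
  replace (((f (t + h) - f t) / h - l) * h) with (f (t + h) - f t - l * h)
    by (field; easy).
  nra.
Qed.

Definition Cderiv (g : R -> C) (t : R) (l : C) : Prop :=
  is_derive (fun s => Re (g s)) t (Re l) /\
  is_derive (fun s => Im (g s)) t (Im l).

Lemma Cderiv_eps (g : R -> C) (t : R) (l : C) :
  Cderiv g t l <->
  forall eps, 0 < eps -> exists d, 0 < d /\ forall s, Rabs (s - t) < d ->
    Cmod (g s - g t - l * RtoC (s - t))%C <= eps * Rabs (s - t).
Proof.
assert (ER : forall s, Re (g s - g t - l * RtoC (s - t))%C =
  Re (g s) - Re (g t) - Re l * (s - t)) by (intros; simpl; unfold Re; ring).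
assert (EI : forall s, Im (g s - g t - l * RtoC (s - t))%C =
  Im (g s) - Im (g t) - Im l * (s - t)) by (intros; simpl; unfold Im; ring).
unfold Cderiv. rewrite !is_derive_eps. split.
- intros [H1 H2] eps Heps.
  destruct (H1 (eps / 2)) as [d1 [Hd1 K1]]. lra.
  destruct (H2 (eps / 2)) as [d2 [Hd2 K2]]. lra.
  exists (Rmin d1 d2). split. now apply Rmin_pos.
  intros s Hs. generalize (Rmin_l d1 d2) (Rmin_r d1 d2). intros.
  specialize (K1 s). specialize (K2 s).
  eapply Rle_trans. apply Cmod_le_Rabs. rewrite ER, EI. lra.
- intros H. split; intros eps Heps; destruct (H eps Heps) as [d [Hd K]];
  exists d; (split; [easy|]); intros s Hs; specialize (K s Hs).
  + rewrite <- ER. eapply Rle_trans. apply re_le_Cmod. easy.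
  + rewrite <- EI. eapply Rle_trans. apply im_le_Cmod. easy.
Qed.

Lemma Cderiv_hol f f' g t l :
  hol f f' (g t) -> Cderiv g t l -> Cderiv (fun s => f (g s)) t (f' (g t) * l)%C.
Proof.
rewrite !Cderiv_eps. intros [d [M [Hd [HM H]]]] Hg eps Heps.
set (K := Cmod l + 1).
assert (HK : 0 < K) by (unfold K; generalize (Cmod_ge_0 l); lra).
set (F := Cmod (f' (g t)) + 1).
assert (HF : 0 < F) by (unfold F; generalize (Cmod_ge_0 (f' (g t))); lra).
destruct (Hg (Rmin 1 (eps / (2 * F)))) as [d1 [Hd1 H1]].
{ apply Rmin_pos. lra. apply Rdiv_lt_0_compat; lra. }
set (e := Rmin d1 (Rmin (d / K) (eps / (2 * (M + 1) * K ^ 2)))).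
assert (He : 0 < e).
{ repeat apply Rmin_pos; try easy; apply Rdiv_lt_0_compat; try lra.
  apply Rmult_lt_0_compat. lra. nra. }
exists e. split. easy.
intros s Hs.
assert (Hs1 : Rabs (s - t) < d1).
{ eapply Rlt_le_trans. exact Hs. apply Rmin_l. }
assert (Hs2 : Rabs (s - t) * K < d).
{ apply Rlt_le_trans with (d / K * K). 2: right; field; lra.
  apply Rmult_lt_compat_r. easy. eapply Rlt_le_trans. exact Hs.
  eapply Rle_trans. apply Rmin_r. apply Rmin_l. }
assert (Hs3 : Rabs (s - t) * (M * K ^ 2) <= eps / 2).
{ apply Rle_trans with (eps / (2 * (M + 1) * K ^ 2) * ((M + 1) * K ^ 2)).
  2: right; field; split; lra.
  apply Rmult_le_compat. apply Rabs_pos. nra.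
  eapply Rle_trans. apply Rlt_le, Hs.
  eapply Rle_trans. apply Rmin_r. apply Rmin_r. nra. }
specialize (H1 s Hs1).
set (h := Rabs (s - t)) in *. assert (0 <= h) by apply Rabs_pos.
assert (G : Cmod (g s - g t) <= K * h).
{ generalize (Cmod_le_sub (g s - g t) (l * RtoC (s - t))).
  rewrite Cmod_mult, Cmod_R. fold h.
  assert (Rmin 1 (eps / (2 * F)) * h <= 1 * h).
  { apply Rmult_le_compat_r. easy. apply Rmin_l. }
  unfold K. lra. }
assert (Hc : Cmod (g s - g t) < d) by lra.
assert (Hz : Cmod (g t - g t) < d).
{ now rewrite Cmod_diag. }
specialize (H (g t) (g s) Hz Hc).
set (u := (f (g s) - f (g t) - _)%C) in H.
set (v := (g s - g t - _)%C) in H1.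
replace (_ - _ - _)%C with (u + f' (g t) * v)%C by (unfold u, v; ring).
eapply Rle_trans. apply Cmod_triangle. rewrite Cmod_mult.
assert (Cmod (g s - g t) ^ 2 <= (K * h) ^ 2).
{ apply pow_incr. split. apply Cmod_ge_0. easy. }
assert (Cmod u <= eps / 2 * h).
{ eapply Rle_trans. exact H. apply Rle_trans with (M * (K * h) ^ 2).
  now apply Rmult_le_compat_l.
  replace (M * (K * h) ^ 2) with (h * (M * K ^ 2) * h) by ring.
  now apply Rmult_le_compat_r. }
assert (Cmod (f' (g t)) * Cmod v <= F * (eps / (2 * F) * h)).
{ apply Rmult_le_compat; try apply Cmod_ge_0. unfold F; lra.
  eapply Rle_trans. exact H1. apply Rmult_le_compat_r. easy. apply Rmin_r. }
replace (F * (eps / (2 * F) * h)) with (eps / 2 * h) in * by (field; lra).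
lra.
Qed.

Lemma Cderiv_ext g1 g2 t l : (forall s, g1 s = g2 s) ->
  Cderiv g1 t l -> Cderiv g2 t l.
Proof.
intros E. rewrite !Cderiv_eps. intros H eps Heps.
destruct (H eps Heps) as [d [Hd K]]. exists d. split. easy.
intros s. rewrite <- !E. apply K.
Qed.

Lemma Cderiv_ext_loc g1 g2 t l d : 0 < d ->
  (forall s, Rabs (s - t) < d -> g1 s = g2 s) ->
  Cderiv g1 t l -> Cderiv g2 t l.
Proof.
intros Hd E. rewrite !Cderiv_eps. intros H eps Heps.
destruct (H eps Heps) as [d' [Hd' K]]. exists (Rmin d d').
split. now apply Rmin_pos.
intros s Hs. generalize (Rmin_l d d') (Rmin_r d d'). intros.
rewrite <- (E s), <- (E t). apply K. lra.
rewrite Rminus_diag, Rabs_R0. lra. lra.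
Qed.

Lemma Cderiv_line (a b : C) t : Cderiv (fun s => a + RtoC s * b)%C t b.
Proof.
apply Cderiv_eps. intros eps Heps. exists 1. split. lra.
intros s _. rewrite RtoC_minus.
replace (_ - _ - _)%C with (RtoC 0) by ring. rewrite Cmod_0.
apply Rmult_le_pos. lra. apply Rabs_pos.
Qed.

Lemma Cderiv_cont g t l : Cderiv g t l -> forall eps, 0 < eps ->
  exists d, 0 < d /\ forall s, Rabs (s - t) < d -> Cmod (g s - g t)%C < eps.
Proof.
rewrite Cderiv_eps. intros H eps Heps.
destruct (H 1) as [d [Hd K]]. lra.
set (L := Cmod l + 1).
assert (HL : 0 < L) by (unfold L; generalize (Cmod_ge_0 l); lra).
exists (Rmin d (eps / L)). split.
{ apply Rmin_pos. easy. now apply Rdiv_lt_0_compat. }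
intros s Hs. generalize (Rmin_l d (eps / L)) (Rmin_r d (eps / L)). intros.
assert (Hs2 : Rabs (s - t) * L < eps).
{ apply Rlt_le_trans with (eps / L * L). 2: right; field; lra.
  apply Rmult_lt_compat_r; lra. }
generalize (Cmod_le_sub (g s - g t) (l * RtoC (s - t))).
rewrite Cmod_mult, Cmod_R.
generalize (K s ltac:(lra)). unfold L in Hs2. lra.
Qed.

Lemma derive_cont (f : R -> R) t l : is_derive f t l -> continuity_pt f t.
Proof.
intros H. apply derivable_continuous_pt. exists l. now apply is_derive_Reals.
Qed.

Lemma mean_value (f df : R -> R) (a b : R) :
  a < b -> (forall t, a <= t <= b -> is_derive f t (df t)) ->
  exists c, a <= c <= b /\ f b - f a = df c * (b - a).
Proof.
intros Hab H. destruct (MVT_gen f a b df) as [c Hc].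
- rewrite Rmin_left, Rmax_right by lra. intros x Hx. apply H. lra.
- rewrite Rmin_left, Rmax_right by lra. intros x Hx.
  apply derive_cont with (df x). now apply H.
- rewrite Rmin_left, Rmax_right in Hc by lra. now exists c.
Qed.

Lemma derive_zero_const (f : R -> R) (a b : R) :
  a <= b -> (forall t, a <= t <= b -> is_derive f t 0) -> f a = f b.
Proof.
intros [Hab| ->] H. 2: easy.
destruct (mean_value f (fun _ => 0) a b Hab H) as [c [_ Hc]]. lra.
Qed.

Lemma Cderiv_zero_const (g : R -> C) (a b : R) :
  a <= b -> (forall t, a <= t <= b -> Cderiv g t 0) -> g a = g b.
Proof.
intros Hab H. apply C_ext.
- apply (derive_zero_const (fun s => Re (g s)) a b Hab).
  intros t Ht. apply (H t Ht).
- apply (derive_zero_const (fun s => Im (g s)) a b Hab).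
  intros t Ht. apply (H t Ht).
Qed.

Definition convex (D : C -> Prop) : Prop :=
  forall z w (t : R), D z -> D w -> 0 <= t <= 1 -> D (z + t * (w - z))%C.

Lemma hol_zero_const (D : C -> Prop) f f' :
  convex D -> (forall z, D z -> hol f f' z) -> (forall z, D z -> f' z = 0%C) ->
  forall z w, D z -> D w -> f z = f w.
Proof.
intros HD Hf H0 z w Hz Hw.
assert (E := Cderiv_zero_const (fun s => f (z + s * (w - z))%C) 0 1).
cbv beta in E.
replace (z + 0 * (w - z))%C with z in E by ring.
replace (z + 1 * (w - z))%C with w in E by ring.
apply E. lra.
intros t Ht. assert (Dt := HD z w t Hz Hw Ht).
replace (RtoC 0) with (f' (z + t * (w - z)) * (w - z))%C.
2:{ rewrite H0 by easy. ring. }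
apply (Cderiv_hol f f' (fun s => z + s * (w - z))%C).
now apply Hf. apply Cderiv_line.
Qed.

(** * Holomorphic and analytic functions *)

Lemma hol_shift f f' p : hol f f' p ->
  exists d, 0 < d /\ forall z, Cmod (z - p)%C < d -> hol f f' z.
Proof.
intros [d [M [Hd [HM H]]]]. exists (d / 2). split. lra.
intros z Hz. exists (d / 2), M. split. lra. split. easy.
intros u v Hu Hv. apply H.
- generalize (Cmod_sub_trans u z p). lra.
- generalize (Cmod_sub_trans v z p). lra.
Qed.

Lemma locally_Cmod (p : C) (P : C -> Prop) d :
  0 < d -> (forall z, Cmod (z - p)%C < d -> P z) -> locally p P.
Proof.
intros Hd H. exists (mkposreal (d / 2) ltac:(lra)).
intros z Hz. apply H.
assert (T := C_NormedModule_mixin_compat2 p z _ Hz).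
change (Cmod (z - p)%C < sqrt 2 * (d / 2)) in T.
assert (sqrt 2 < 2).
{ rewrite <- (sqrt_square 2) at 2 by lra. apply sqrt_lt_1; lra. }
nra.
Qed.

Lemma locally_Cmod_inv (p : C) (P : C -> Prop) :
  locally p P -> exists d, 0 < d /\ forall z, Cmod (z - p)%C < d -> P z.
Proof.
intros [d Hd]. exists d. split. apply cond_pos.
intros z Hz. apply Hd. apply C_NormedModule_mixin_compat1. exact Hz.
Qed.

Lemma hol_is_derive f f' p : hol f f' p ->
  is_derive (K := C_AbsRing) (V := C_NormedModule) f p (f' p).
Proof.
intros [d [M [Hd [HM H]]]]. split.
- apply (is_linear_scal_l (K := C_AbsRing) (V := C_NormedModule)).
- intros x Hx.
  assert (Ex := is_filter_lim_locally_unique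
    (V := AbsRing_NormedModule C_AbsRing) p x Hx). subst x.
  intros eps.
  set (e := Rmin d (eps / (M + 1))).
  assert (He : 0 < e).
  { apply Rmin_pos. easy. apply Rdiv_lt_0_compat. apply cond_pos. lra. }
  apply (locally_C p). apply locally_Cmod with e. easy.
  intros z Hz.
  assert (Hz1 : Cmod (z - p) < d).
  { eapply Rlt_le_trans. exact Hz. apply Rmin_l. }
  assert (Hz2 : (M + 1) * Cmod (z - p) <= eps).
  { apply Rle_trans with ((M + 1) * (eps / (M + 1))).
    2: right; field; lra.
    apply Rmult_le_compat_l. lra. eapply Rle_trans. apply Rlt_le, Hz.
    apply Rmin_r. }
  change (Cmod (f z - f p - (z - p) * f' p)%C <= eps * Cmod (z - p)%C).
  assert (H0 : Cmod (p - p) < d).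
  { now rewrite Cmod_diag. }
  replace (f z - f p - (z - p) * f' p)%C with (f z - f p - f' p * (z - p))%C
    by ring.
  eapply Rle_trans. apply (H p z H0 Hz1).
  generalize (Cmod_ge_0 (z - p)). intros. simpl. nra.
Qed.

Lemma hol_analytic (g : R -> C) (t : R) F F' d :
  hol F F' t -> 0 < d -> (forall s, Rabs (s - t) < d -> g s = F s) ->
  analytic_at g t.
Proof.
intros HF Hd E. exists F. split.
- destruct (hol_shift _ _ _ HF) as [e [He H]].
  apply locally_Cmod with e. easy. intros z Hz.
  exists (F' z). apply hol_is_derive. now apply H.
- exists (mkposreal d Hd). intros s Hs. apply E. exact Hs.
Qed.

Lemma analytic_Cderiv g t : analytic_at g t -> exists l, Cderiv g t l.
Proof.
intros [F [HF HE]].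
apply locally_Cmod_inv in HF. destruct HF as [d [Hd HF]].
destruct (HF t) as [l Hl].
{ now rewrite Cmod_diag. }
destruct HE as [d' HE]. exists l. apply Cderiv_eps. intros eps Heps.
destruct Hl as [_ Hl].
specialize (Hl (RtoC t) (fun P H => H) (mkposreal eps Heps)).
apply (locally_C (RtoC t)) in Hl. apply locally_Cmod_inv in Hl.
destruct Hl as [e [He Hl]].
exists (Rmin d' e). split. apply Rmin_pos. apply cond_pos. easy.
intros s Hs. generalize (Rmin_l d' e) (Rmin_r d' e). intros.
rewrite (HE s) by (change (Rabs (s - t) < d'); lra).
rewrite (HE t) by apply ball_center.
assert (Es : Cmod (s - t)%C = Rabs (s - t)).
{ rewrite <- RtoC_minus. apply Cmod_R. }
specialize (Hl s). rewrite Es in Hl. specialize (Hl ltac:(lra)).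
change (Cmod (F s - F t - (s - t) * l)%C <= eps * Cmod (s - t)%C) in Hl.
rewrite Es in Hl.
replace (F s - F t - l * RtoC (s - t))%C with (F s - F t - (s - t) * l)%C.
easy. rewrite RtoC_minus. ring.
Qed.

Lemma Cderiv_path g t l : Cderiv g t l -> path_derive g t = l.
Proof.
intros [H1 H2]. apply C_ext; apply is_derive_unique; easy.
Qed.

(** * Branches of square roots *)

Definition Cdiff (g : R -> C) (t : R) : Prop := exists l, Cderiv g t l.

Lemma Cdiff_hol f f' g t : hol f f' (g t) -> Cdiff g t -> Cdiff (fun s => f (g s)) t.
Proof. intros H [l Hl]. exists (f' (g t) * l)%C. now apply Cderiv_hol. Qed.

Lemma sqr_eq_cases (a b : C) : (a * a = b * b)%C -> a = b \/ a = (- b)%C.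
Proof.
intros H. destruct (classic (a = b)) as [E|E]. now left. right.
assert (K : ((a - b) * (a + b) = 0)%C).
{ replace ((a - b) * (a + b))%C with (a * a - b * b)%C by ring.
  rewrite H. ring. }
destruct (classic ((a + b)%C = 0%C)) as [E2|E2].
- replace a with ((a + b) - b)%C by ring. rewrite E2. ring.
- exfalso. apply (Cmult_neq_0 (a - b) (a + b)); try easy.
  intros E3. apply E. replace a with ((a - b) + b)%C by ring.
  rewrite E3. ring.
Qed.

Lemma Copp_fixed_0 (a : C) : a = (- a)%C -> a = 0%C.
Proof.
intros H. apply C_ext.
- apply (f_equal Re) in H. simpl in *. unfold Re in *. lra.
- apply (f_equal Im) in H. simpl in *. unfold Im in *. lra.
Qed.

Lemma Cconj_mul_self (w : C) : w <> 0%C -> 0 < Re (w * Cconj w)%C.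
Proof.
intros Hw. apply Cmod_gt_0 in Hw.
replace (Re (w * Cconj w)%C) with (Cmod w ^ 2). nra.
rewrite Cmod2_alt. simpl. unfold Re, Im. ring.
Qed.

(** Otherwise the real part of [f * conj w], which is [|w|^2] at one end and
[- |w|^2] at the other, would vanish in between, where it is [|w|^2] up to sign. *)
Lemma branch_forward (f w : R -> C) (s t : R) :
  s <= t -> (forall x, s <= x <= t -> Cdiff f x) ->
  (forall x, s <= x <= t -> Cdiff w x) ->
  (forall x, s <= x <= t -> (f x * f x = w x * w x)%C) ->
  (forall x, s <= x <= t -> w x <> 0%C) ->
  f s = w s -> f t = w t.
Proof.
intros [Hst| ->] Hf Hw Hs H0 E. 2: easy.
destruct (sqr_eq_cases _ _ (Hs t ltac:(lra))) as [E'|E']. easy.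
exfalso.
set (r := fun x => - (Re (f x) * Re (w x) + Im (f x) * Im (w x))).
assert (Er : forall x, r x = - Re (f x * Cconj (w x))%C).
{ intros x. unfold r. simpl. unfold Re, Im. ring. }
destruct (IVT_interv r s t) as [x [Hx Rx]].
- intros x Hx. destruct (Hf x Hx) as [a [A1 A2]].
  destruct (Hw x Hx) as [b [B1 B2]].
  apply continuity_pt_opp, continuity_pt_plus; apply continuity_pt_mult;
  eapply derive_cont; eassumption.
- easy.
- rewrite Er, E. generalize (Cconj_mul_self (w s)). intros K.
  specialize (K (H0 s ltac:(lra))). lra.
- rewrite Er, E'. generalize (Cconj_mul_self (w t)). intros K.
  specialize (K (H0 t ltac:(lra))).
  replace (- w t * Cconj (w t))%C with (- (w t * Cconj (w t)))%C by ring.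
  change (Re (- (w t * Cconj (w t)))%C) with (- Re (w t * Cconj (w t))%C). lra.
- rewrite Er in Rx. generalize (Cconj_mul_self (w x) (H0 x Hx)). intros K.
  destruct (sqr_eq_cases _ _ (Hs x Hx)) as [Ex|Ex]; rewrite Ex in Rx.
  lra. replace (- w x * Cconj (w x))%C with (- (w x * Cconj (w x)))%C in Rx
    by ring.
  change (Re (- (w x * Cconj (w x)))%C) with (- Re (w x * Cconj (w x))%C) in Rx.
  lra.
Qed.

Lemma Cdiff_opp w t : Cdiff w t -> Cdiff (fun s => - w s)%C t.
Proof.
intros [l [H1 H2]]. exists (- l)%C. split.
- apply (is_derive_opp (V := R_NormedModule)) in H1. exact H1.
- apply (is_derive_opp (V := R_NormedModule)) in H2. exact H2.
Qed.

Lemma branch_interval (f w : R -> C) (s t : R) :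
  s <= t -> (forall x, s <= x <= t -> Cdiff f x) ->
  (forall x, s <= x <= t -> Cdiff w x) ->
  (forall x, s <= x <= t -> (f x * f x = w x * w x)%C) ->
  (forall x, s <= x <= t -> w x <> 0%C) ->
  (f s = w s /\ f t = w t) \/ (f s = (- w s)%C /\ f t = (- w t)%C).
Proof.
intros Hst Hf Hw Hs H0.
destruct (sqr_eq_cases _ _ (Hs s ltac:(lra))) as [E|E].
- left. split. easy. now apply (branch_forward f w s t).
- right. split. easy. apply (branch_forward f (fun x => - w x)%C s t); try easy.
  + intros x Hx. now apply Cdiff_opp, Hw.
  + intros x Hx. rewrite Hs by easy. ring.
  + intros x Hx K. apply (H0 x Hx).
    replace (w x) with (- (- w x))%C by ring. rewrite K. ring.
Qed.

Lemma branch_common_sign {X : Type} (D : X -> Prop) (f w : X -> C) (x0 : X) :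
  w x0 <> 0%C ->
  (forall x, D x -> (f x0 = w x0 /\ f x = w x) \/
     (f x0 = (- w x0)%C /\ f x = (- w x)%C)) ->
  exists e : R, (e = 1 \/ e = -1) /\ forall x, D x -> f x = (e * w x)%C.
Proof.
intros H0 K.
destruct (classic (f x0 = w x0)) as [E|E].
- exists 1. split. now left. intros x Hx.
  destruct (K x Hx) as [[_ Q]|[Q _]]. rewrite Q. ring.
  exfalso. apply H0. rewrite E in Q. now apply Copp_fixed_0.
- exists (-1). split. now right. intros x Hx.
  destruct (K x Hx) as [[Q _]|[_ Q]]. now elim E.
  rewrite Q. apply injective_projections; simpl; ring.
Qed.

Lemma sign_sqr (e : R) : e = 1 \/ e = -1 -> (e * e)%C = 1%C.
Proof. intros H. rewrite <- RtoC_mult. f_equal. destruct H as [->| ->]; ring. Qed.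

Lemma branch_sign (f w : R -> C) (a b : R) :
  (forall x, a < x < b -> Cdiff f x) ->
  (forall x, a < x < b -> Cdiff w x) ->
  (forall x, a < x < b -> (f x * f x = w x * w x)%C) ->
  (forall x, a < x < b -> w x <> 0%C) ->
  exists e : R, (e = 1 \/ e = -1) /\ forall x, a < x < b -> f x = (e * w x)%C.
Proof.
intros Hf Hw Hs H0.
destruct (Rlt_dec a b) as [Hab|Hab].
2:{ exists 1. split. now left. intros. lra. }
set (m := (a + b) / 2). assert (Hm : a < m < b) by (unfold m; lra).
assert (K : forall x, a < x < b ->
  (f m = w m /\ f x = w x) \/ (f m = (- w m)%C /\ f x = (- w x)%C)).
{ intros x Hx. destruct (Rle_dec m x) as [h|h].
  - apply (branch_interval f w m x); try easy; intros y Hy;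
    [apply Hf|apply Hw|apply Hs|apply H0]; lra.
  - destruct (branch_interval f w x m) as [Q|Q]; try lra;
    try (intros y Hy; [apply Hf|apply Hw|apply Hs|apply H0]; lra);
    try (intros y Hy; first [apply Hf; lra | apply Hw; lra | apply Hs; lra
      | apply H0; lra]).
    + left. tauto.
    + right. tauto. }
exact (branch_common_sign (fun x => a < x < b) f w m (H0 m Hm) K).
Qed.

Lemma branch_convex (D : C -> Prop) f f' w w' :
  convex D -> (forall z, D z -> hol f f' z) -> (forall z, D z -> hol w w' z) ->
  (forall z, D z -> (f z * f z = w z * w z)%C) ->
  (forall z, D z -> w z <> 0%C) ->
  exists e : R, (e = 1 \/ e = -1) /\ forall z, D z -> f z = (e * w z)%C.
Proof.
intros HD Hf Hw Hs H0.
destruct (classic (exists z0, D z0)) as [[z0 Hz0]|Hn].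
2:{ exists 1. split. now left. intros z Hz. exfalso. apply Hn. now exists z. }
assert (K : forall z, D z ->
  (f z0 = w z0 /\ f z = w z) \/ (f z0 = (- w z0)%C /\ f z = (- w z)%C)).
{ intros z Hz.
  set (g := fun s : R => (z0 + s * (z - z0))%C).
  assert (Dg : forall s, 0 <= s <= 1 -> D (g s)) by (intros; now apply HD).
  assert (Cg : forall s, Cdiff g s) by (intros s; eexists; apply Cderiv_line).
  assert (Q := branch_interval (fun s => f (g s)) (fun s => w (g s)) 0 1).
  cbv beta in Q.
  replace (g 0) with z0 in Q by (unfold g; ring).
  replace (g 1) with z in Q by (unfold g; ring).
  apply Q.
  - lra.
  - intros x Hx. eapply Cdiff_hol. apply Hf. now apply Dg. apply Cg.
  - intros x Hx. eapply Cdiff_hol. apply Hw. now apply Dg. apply Cg.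
  - intros x Hx. now apply Hs, Dg.
  - intros x Hx. now apply H0, Dg. }
exact (branch_common_sign D f w z0 (H0 z0 Hz0) K).
Qed.

Local Notation CR := C_R_NormedModule.

(** * Integrals of complex functions of a real variable *)

Lemma Ccont_eps (g : R -> C) (t : R) :
  (forall eps, 0 < eps -> exists d, 0 < d /\
     forall s, Rabs (s - t) < d -> Cmod (g s - g t)%C < eps) ->
  continuous (U := CR) g t.
Proof.
intros H P HP. apply (locally_Cmod_inv (g t)) in HP.
destruct HP as [e [He HP]].
destruct (H e He) as [d [Hd K]].
exists (mkposreal d Hd). intros s Hs. apply HP, K. exact Hs.
Qed.

Lemma Cdiff_continuous g t : Cdiff g t -> continuous (U := CR) g t.
Proof. intros [l Hl]. apply Ccont_eps. now apply (Cderiv_cont _ _ l). Qed.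

Lemma hol_deriv_continuous T T' g s :
  hol T T' (g s) -> Cdiff g s -> continuous (U := CR) (fun x => T' (g x)) s.
Proof.
intros HT [l Hl].
destruct (hol_deriv_cont _ _ _ HT) as [e [L [He [HL HTL]]]].
apply Ccont_eps. intros eps Heps.
destruct (Cderiv_cont _ _ _ Hl (Rmin e (eps / (L + 1)))) as [e' [He' K]].
{ apply Rmin_pos. easy. apply Rdiv_lt_0_compat; lra. }
exists e'. split. easy. intros x Hx. specialize (K x Hx).
generalize (Rmin_l e (eps / (L + 1))) (Rmin_r e (eps / (L + 1))). intros.
eapply Rle_lt_trans. apply HTL. lra.
set (D := Cmod (g x - g s)%C) in *.
assert (0 <= D) by apply Cmod_ge_0.
assert (D * (L + 1) < eps).
{ apply Rlt_le_trans with (eps / (L + 1) * (L + 1)).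
  apply Rmult_lt_compat_r; lra. right. field. lra. }
nra.
Qed.

Lemma scal_C (r : R) (z : C) : scal (V := CR) r z = (r * z)%C.
Proof.
apply injective_projections.
- change (r * fst z = r * fst z - 0 * snd z). ring.
- change (r * snd z = r * snd z + 0 * fst z). ring.
Qed.

Lemma continuous_Rmul (k : R -> R) (f : R -> C) t :
  continuous k t -> continuous (U := CR) f t ->
  continuous (U := CR) (fun s => (k s * f s)%C) t.
Proof.
intros Hk Hf. apply (continuous_ext (fun s => scal (V := CR) (k s) (f s))).
intros s. apply scal_C. now apply continuous_scal.
Qed.

Lemma continuous_Cmul (c : C) (f : R -> C) t :
  continuous (U := CR) f t -> continuous (U := CR) (fun s => (c * f s)%C) t.
Proof.
intros H.
apply (continuous_comp (U := R_UniformSpace) (V := CR) (W := CR) f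
  (fun z => (c * z)%C)).
easy.
intros P HP. apply (locally_Cmod_inv (c * f t)%C) in HP.
destruct HP as [e [He HP]].
set (K := Cmod c + 1).
assert (HK : 0 < K) by (unfold K; generalize (Cmod_ge_0 c); lra).
apply (locally_Cmod (f t) _ (e / K)). now apply Rdiv_lt_0_compat.
intros z Hz. apply HP.
replace (c * z - c * f t)%C with (c * (z - f t))%C by ring.
rewrite Cmod_mult.
assert (Cmod (z - f t) * K < e).
{ apply Rlt_le_trans with (e / K * K). now apply Rmult_lt_compat_r.
  right. field. lra. }
generalize (Cmod_ge_0 (z - f t)). unfold K in *. intros. lra.
Qed.

Lemma is_RInt_C_derive (M h : R -> C) (a b : R) :
  a <= b -> (forall x, a <= x <= b -> Cderiv M x (h x)) ->
  (forall x, a <= x <= b -> continuous (U := CR) h x) ->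
  is_RInt (V := CR) h a b (M b - M a)%C.
Proof.
intros Hab HM Hh.
apply (is_RInt_fct_extend_pair (U := R_NormedModule) (V := R_NormedModule)
  h a b (fst (M b) - fst (M a)) (snd (M b) - snd (M a))).
- apply (is_RInt_derive (V := R_CompleteNormedModule) (fun t => fst (M t))).
  + intros x Hx. rewrite Rmin_left, Rmax_right in Hx by easy. now apply HM.
  + intros x Hx. rewrite Rmin_left, Rmax_right in Hx by easy.
    apply (continuous_comp h fst). now apply Hh. apply continuous_fst.
- apply (is_RInt_derive (V := R_CompleteNormedModule) (fun t => snd (M t))).
  + intros x Hx. rewrite Rmin_left, Rmax_right in Hx by easy. now apply HM.
  + intros x Hx. rewrite Rmin_left, Rmax_right in Hx by easy.
    apply (continuous_comp h snd). now apply Hh. apply continuous_snd.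
Qed.

Lemma is_RInt_C_re (f : R -> C) a b l :
  is_RInt (V := CR) f a b l -> is_RInt (fun t => Re (f t)) a b (Re l).
Proof. exact (is_RInt_fct_extend_fst (U := R_NormedModule) (V := R_NormedModule) f a b l). Qed.

Lemma is_RInt_C_im (f : R -> C) a b l :
  is_RInt (V := CR) f a b l -> is_RInt (fun t => Im (f t)) a b (Im l).
Proof. exact (is_RInt_fct_extend_snd (U := R_NormedModule) (V := R_NormedModule) f a b l). Qed.

Lemma is_RInt_Cmult (c : C) (f : R -> C) a b l :
  is_RInt (V := CR) f a b l ->
  is_RInt (V := CR) (fun t => (c * f t)%C) a b (c * l)%C.
Proof.
intros H. assert (H1 := is_RInt_C_re _ _ _ _ H).
assert (H2 := is_RInt_C_im _ _ _ _ H).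
apply (is_RInt_fct_extend_pair (U := R_NormedModule) (V := R_NormedModule)
  (fun t => (c * f t)%C) a b (Re c * Re l - Im c * Im l)
   (Re c * Im l + Im c * Re l)).
- apply (is_RInt_minus (V := R_NormedModule) (fun t => Re c * Re (f t))
    (fun t => Im c * Im (f t))).
  now apply (is_RInt_scal (V := R_NormedModule)).
  now apply (is_RInt_scal (V := R_NormedModule)).
- apply (is_RInt_plus (V := R_NormedModule) (fun t => Re c * Im (f t))
    (fun t => Im c * Re (f t))).
  now apply (is_RInt_scal (V := R_NormedModule)).
  now apply (is_RInt_scal (V := R_NormedModule)).
Qed.

(** * Weighted integrals along spokes *)

(** Compactness of [[0, 1]] makes the radius and the constant of the expansions
uniform along the curve. *)
Lemma hol_along (c : R -> C) T T' :
  (forall s, 0 <= s <= 1 -> Cdiff c s) ->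
  (forall s, 0 <= s <= 1 -> hol T T' (c s)) ->
  exists d M, 0 < d /\ 0 <= M /\ forall s z w, 0 <= s <= 1 ->
  Cmod (z - c s)%C < d -> Cmod (w - c s)%C < d ->
  Cmod (T w - T z - T' z * (w - z))%C <= M * Cmod (w - z)%C ^ 2.
Proof.
intros Hc HT.
assert (Hch : forall t, exists dt : posreal, 0 <= t <= 1 ->
  forall s z w, Rabs (s - t) < dt ->
  Cmod (z - c s)%C < dt -> Cmod (w - c s)%C < dt ->
  Cmod (T w - T z - T' z * (w - z))%C <= / dt * Cmod (w - z)%C ^ 2).
{ intros t. destruct (classic (0 <= t <= 1)) as [Ht|Ht].
  2:{ exists (mkposreal 1 Rlt_0_1). tauto. }
  destruct (HT t Ht) as [d [M [Hd [HM H]]]].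
  destruct (Hc t Ht) as [l Hl].
  destruct (Cderiv_cont _ _ _ Hl (d / 2)) as [e [He Ke]]. lra.
  set (a := Rmin e (Rmin (d / 2) (/ (M + 1)))).
  assert (Ha : 0 < a).
  { repeat apply Rmin_pos; try lra. apply Rinv_0_lt_compat. lra. }
  assert (Ha1 : a <= e) by apply Rmin_l.
  assert (Ha2 : a <= d / 2).
  { eapply Rle_trans. apply Rmin_r. apply Rmin_l. }
  assert (Ha3 : a <= / (M + 1)).
  { eapply Rle_trans. apply Rmin_r. apply Rmin_r. }
  exists (mkposreal a Ha). simpl. intros _ s z w Hs Hz Hw.
  assert (K := Ke s ltac:(lra)).
  eapply Rle_trans. apply H.
  - generalize (Cmod_sub_trans z (c s) (c t)). lra.
  - generalize (Cmod_sub_trans w (c s) (c t)). lra.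
  - apply Rmult_le_compat_r. apply pow2_ge_0.
    apply Rle_trans with (M + 1). lra.
    rewrite <- (Rinv_inv (M + 1)). apply Rinv_le_contravar; lra. }
destruct (functional_choice _ Hch) as [delta Hdelta].
destruct (compactness_value_1d 0 1 delta) as [d Hd].
exists d, (/ d). split. apply cond_pos. split.
apply Rlt_le, Rinv_0_lt_compat, cond_pos.
intros s z w Hs Hz Hw.
apply Rnot_lt_le. intros Hlt.
apply (Hd s Hs). intros [t [Ht [Hst Hdt]]].
apply (Rlt_irrefl (Cmod (T w - T z - T' z * (w - z))%C)).
eapply Rle_lt_trans; [|exact Hlt].
eapply Rle_trans. apply (Hdelta t Ht s); lra.
apply Rmult_le_compat_r. apply pow2_ge_0.
apply Rinv_le_contravar. apply cond_pos. easy.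
Qed.

Lemma hol_pow (n : nat) p :
  hol (fun z => z ^ S n)%C (fun z => INR (S n) * z ^ n)%C p.
Proof.
induction n as [|n IH].
- eapply hol_eq; [| |apply hol_id]; intros z; simpl; ring.
- eapply hol_eq; [| |apply (hol_mult _ _ _ _ p (hol_id p) IH)].
  + intros z. simpl. ring.
  + intros z. cbv beta. rewrite (S_INR (S n)), RtoC_plus.
    simpl Cpow. ring.
Qed.

Lemma hol_affine (a b : C) p : hol (fun z => a + z * b)%C (fun _ => b) p.
Proof.
eapply hol_eq; [| |apply (hol_plus _ _ _ _ p (hol_const a p)
  (hol_mult _ _ _ _ p (hol_id p) (hol_const b p)))]; intros z; simpl; ring.
Qed.

Lemma hol_RtoC F F' (t : R) : hol F F' t -> Cderiv (fun s => F (RtoC s)) t (F' t).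
Proof.
intros H. replace (F' t) with (F' t * 1)%C by ring.
apply (Cderiv_hol F F' RtoC). easy.
eapply Cderiv_ext. 2: apply (Cderiv_line 0 1). intros s. simpl. ring.
Qed.

(** The quadratic speed makes [s] a uniformizing parameter at [p]: it turns the
integral of a [k/2 - 1] power of [z - p] into one with the smooth weight
[s ^ (k - 1)]. *)
Definition spoke (p z : C) (s : R) : C := (p + (RtoC s * RtoC s) * (z - p))%C.

Lemma hol_spoke p z t : hol (fun s => p + (s * s) * (z - p))%C
  (fun s => 2 * s * (z - p))%C t.
Proof.
eapply hol_eq; [| |apply (hol_comp _ _ (fun s => s * s)%C _ t
  (hol_affine p (z - p) (t * t)) (hol_mult _ _ _ _ t (hol_id t) (hol_id t)))];
 intros s; simpl; ring.
Qed.

Lemma Cdiff_spoke p z t : Cdiff (spoke p z) t.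
Proof. eexists. apply (hol_RtoC _ _ t (hol_spoke p z t)). Qed.

(** [(z - p) ^ ((j + 1) / 2)] times this function is a primitive of
[(z - p) ^ ((j + 1) / 2 - 1) * T z] that vanishes at [p]. *)
Definition spoke_int (j : nat) (p : C) (T : C -> C) (z : C) : C :=
  RInt (V := C_R_CompleteNormedModule)
    (fun s => (RtoC (2 * s ^ j) * T (spoke p z s))%C) 0 1.

Lemma spoke_int_correct j p T z :
  (forall s, 0 <= s <= 1 -> continuous (U := CR) (fun s => T (spoke p z s)) s) ->
  is_RInt (V := CR) (fun s => (RtoC (2 * s ^ j) * T (spoke p z s))%C) 0 1
    (spoke_int j p T z).
Proof.
intros H. apply (RInt_correct (V := C_R_CompleteNormedModule)).
apply (ex_RInt_continuous (V := C_R_CompleteNormedModule)).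
intros s Hs. rewrite Rmin_left, Rmax_right in Hs by lra.
apply continuous_Rmul. 2: now apply H.
apply (ex_derive_continuous (V := R_NormedModule)). auto_derive. easy.
Qed.

Lemma spoke_dist p z w s : 0 <= s <= 1 ->
  Cmod (spoke p w s - spoke p z s)%C = s ^ 2 * Cmod (w - z)%C.
Proof.
intros Hs. unfold spoke.
replace (_ - _)%C with (RtoC (s ^ 2) * (w - z))%C.
2:{ simpl pow. rewrite !RtoC_mult. ring. }
rewrite Cmod_mult, Cmod_R, Rabs_pos_eq by nra. easy.
Qed.

(** Differentiation under the integral sign; the derivative of [spoke p z s] in [z]
is [s^2], which raises the weight by two. *)
Lemma hol_spoke_int j p T T' z1 :
  (forall s, 0 <= s <= 1 -> hol T T' (spoke p z1 s)) ->
  hol (spoke_int j p T) (spoke_int (S (S j)) p T') z1.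
Proof.
intros HT.
destruct (hol_along (spoke p z1) T T') as [d [M [Hd [HM H]]]].
{ intros s _. apply Cdiff_spoke. }
{ easy. }
assert (Hnear : forall z s, Cmod (z - z1)%C < d -> 0 <= s <= 1 ->
  Cmod (spoke p z s - spoke p z1 s)%C < d).
{ intros z s Hz Hs. rewrite spoke_dist by easy.
  generalize (Cmod_ge_0 (z - z1)). intros.
  assert (s ^ 2 <= 1) by nra. nra. }
assert (Hh : forall z s, Cmod (z - z1)%C < d -> 0 <= s <= 1 ->
  hol T T' (spoke p z s)).
{ intros z s Hz Hs. assert (N := Hnear z s Hz Hs).
  exists (d - Cmod (spoke p z s - spoke p z1 s)%C), M.
  split. lra. split. easy. intros u v Hu Hv. apply (H s); try easy.
  - generalize (Cmod_sub_trans u (spoke p z s) (spoke p z1 s)). lra.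
  - generalize (Cmod_sub_trans v (spoke p z s) (spoke p z1 s)). lra. }
assert (I1 : forall z, Cmod (z - z1)%C < d -> is_RInt (V := CR)
  (fun s => (RtoC (2 * s ^ j) * T (spoke p z s))%C) 0 1 (spoke_int j p T z)).
{ intros z Hz. apply spoke_int_correct. intros s Hs.
  apply Cdiff_continuous. eapply Cdiff_hol. now apply Hh. apply Cdiff_spoke. }
assert (I2 : forall z, Cmod (z - z1)%C < d -> is_RInt (V := CR)
  (fun s => (RtoC (2 * s ^ (S (S j))) * T' (spoke p z s))%C) 0 1
  (spoke_int (S (S j)) p T' z)).
{ intros z Hz. apply spoke_int_correct. intros s Hs.
  apply (hol_deriv_continuous T T'). now apply Hh. apply Cdiff_spoke. }
exists d, (2 * M). split. easy. split. lra.
intros z w Hz Hw.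
assert (I3 := is_RInt_minus (V := CR) _ _ _ _ _ _
  (is_RInt_minus (V := CR) _ _ _ _ _ _ (I1 w Hw) (I1 z Hz))
  (is_RInt_Cmult (w - z)%C _ _ _ _ (I2 z Hz))).
replace (spoke_int j p T w - spoke_int j p T z -
  spoke_int (S (S j)) p T' z * (w - z))%C with
 (spoke_int j p T w + - spoke_int j p T z +
   - ((w - z) * spoke_int (S (S j)) p T' z))%C by ring.
replace (2 * M * Cmod (w - z)%C ^ 2) with
  (scal (V := R_NormedModule) (1 - 0) (2 * M * Cmod (w - z)%C ^ 2)).
2:{ assert (E : forall x, (1 - 0) * x = x) by (intros; ring). apply E. }
rewrite (Cmod_norm (_ + _ + _)%C).
eapply (norm_RInt_le (V := CR) _ (fun _ => 2 * M * Cmod (w - z)%C ^ 2) 0 1).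
lra. 2: exact I3. 2: apply (is_RInt_const (V := R_NormedModule)).
intros s Hs. rewrite <- Cmod_norm.
assert (E : (RtoC (2 * s ^ j) * T (spoke p w s) +
   - (RtoC (2 * s ^ j) * T (spoke p z s)) +
   - ((w - z) * (RtoC (2 * s ^ S (S j)) * T' (spoke p z s))) =
   RtoC (2 * s ^ j) * (T (spoke p w s) - T (spoke p z s) -
     T' (spoke p z s) * (spoke p w s - spoke p z s)))%C).
{ unfold spoke at 7 8. simpl pow. rewrite !RtoC_mult. ring. }
change (Cmod (RtoC (2 * s ^ j) * T (spoke p w s) +
   - (RtoC (2 * s ^ j) * T (spoke p z s)) +
   - ((w - z) * (RtoC (2 * s ^ S (S j)) * T' (spoke p z s))))%C
  <= 2 * M * Cmod (w - z) ^ 2).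
rewrite E, Cmod_mult, Cmod_R.
assert (0 <= s ^ j <= 1).
{ split. now apply pow_le. rewrite <- (pow1 j). now apply pow_incr. }
rewrite Rabs_pos_eq by lra.
assert (K := H s _ _ Hs (Hnear z s Hz Hs) (Hnear w s Hw Hs)).
rewrite spoke_dist in K by easy.
assert (P := Cmod_ge_0 (w - z)).
set (D := Cmod (w - z)) in *.
assert ((s ^ 2 * D) ^ 2 <= D ^ 2).
{ assert (0 <= s ^ 2 <= 1) by nra. apply pow_incr. split; nra. }
assert (M * (s ^ 2 * D) ^ 2 <= M * D ^ 2) by now apply Rmult_le_compat_l.
set (X := Cmod (T (spoke p w s) - _ - _)) in *.
assert (0 <= X) by apply Cmod_ge_0.
assert (s ^ j * X <= 1 * X) by now apply Rmult_le_compat_r.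
lra.
Qed.

(** Integrate the derivative of [s ^ (j + 1) * T (spoke p z s)] over [[0, 1]]. *)
Lemma spoke_int_ode j p T T' z :
  (forall s, 0 <= s <= 1 -> hol T T' (spoke p z s)) ->
  (RtoC (INR (S j)) / 2 * spoke_int j p T z +
    (z - p) * spoke_int (S (S j)) p T' z)%C = T z.
Proof.
intros HT.
set (h := fun s : R => (INR (S j) / 2 * (RtoC (2 * s ^ j) * T (spoke p z s)) +
  (z - p) * (RtoC (2 * s ^ (S (S j))) * T' (spoke p z s)))%C).
assert (CT : forall s, 0 <= s <= 1 ->
   continuous (U := CR) (fun s => T (spoke p z s)) s).
{ intros s Hs. apply Cdiff_continuous. eapply Cdiff_hol. now apply HT.
  apply Cdiff_spoke. }
assert (CT' : forall s, 0 <= s <= 1 ->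
   continuous (U := CR) (fun s => T' (spoke p z s)) s).
{ intros s Hs.
  apply (hol_deriv_continuous T T'). now apply HT. apply Cdiff_spoke. }
assert (I := is_RInt_plus (V := CR) _ _ _ _ _ _
  (is_RInt_Cmult (INR (S j) / 2)%C _ _ _ _ (spoke_int_correct j p T z CT))
  (is_RInt_Cmult (z - p)%C _ _ _ _ (spoke_int_correct (S (S j)) p T' z CT'))).
set (F := fun s => (s ^ S j * T (p + s * s * (z - p)))%C).
assert (HF : forall s : R, 0 <= s <= 1 -> Cderiv (fun s => F (RtoC s)) s (h s)).
{ intros s Hs.
  assert (K := hol_RtoC _ _ s (hol_mult _ _ _ _ s (hol_pow j s)
   (hol_comp T T' (fun s => p + s * s * (z - p))%C _ s (HT s Hs)
     (hol_spoke p z s)))).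
  cbv beta in K. unfold h, spoke.
  replace (_ + _)%C with (INR (S j) * s ^ j * T (p + s * s * (z - p)) +
     s ^ S j * (T' (p + s * s * (z - p)) * (2 * s * (z - p))))%C.
  exact K.
  rewrite !RtoC_mult, !RtoC_pow. simpl Cpow. field. }
assert (I' : is_RInt (V := CR) h 0 1 (F 1 - F 0)%C).
{ apply (is_RInt_C_derive (fun s => F (RtoC s))). lra. easy.
  intros s Hs. unfold h.
  apply (continuous_plus (V := CR)).
  - apply continuous_Cmul, (continuous_Rmul (fun s => 2 * s ^ j)).
    apply (ex_derive_continuous (V := R_NormedModule)). auto_derive. easy.
    now apply CT.
  - apply continuous_Cmul, (continuous_Rmul (fun s => 2 * s ^ (S (S j)))).
    apply (ex_derive_continuous (V := R_NormedModule)). auto_derive. easy.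
    now apply CT'. }
change (is_RInt (V := CR) h 0 1 (RtoC (INR (S j)) / 2 * spoke_int j p T z +
    (z - p) * spoke_int (S (S j)) p T' z)%C) in I.
assert (E := is_RInt_unique (V := C_R_CompleteNormedModule) _ _ _ _ I).
rewrite (is_RInt_unique (V := C_R_CompleteNormedModule) _ _ _ _ I') in E.
rewrite <- E. unfold F.
replace (p + 1 * 1 * (z - p))%C with z by ring.
replace (1 ^ S j)%C with (RtoC 1) by (symmetry; apply Cpow_1_l).
replace (0 ^ S j)%C with (RtoC 0) by (simpl; ring). ring.
Qed.

(** * The fundamental theorem for integrable derivatives *)

(** Choosing the tags by the mean value theorem makes the Riemann sum telescope. *)
Lemma mean_value_subdivision (f h : R -> R) (d : R) (n : nat) : 0 <= d ->
  forall a, (forall t, a <= t <= a + INR n * d -> is_derive f t (h t)) ->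
  exists ptd : @SF_seq R, pointed_subdiv ptd /\ SF_h ptd = a /\
    seq.last (SF_h ptd) (SF_lx ptd) = a + INR n * d /\
    seq_step (SF_lx ptd) <= d /\
    Riemann_sum h ptd = f (a + INR n * d) - f a.
Proof.
intros Hd. induction n as [|n IH]; intros a Ha.
- exists (SF_nil a). split; [|split; [|split; [|split]]].
  + intros i Hi. inversion Hi.
  + easy.
  + simpl. ring.
  + easy.
  + simpl INR. rewrite Rmult_0_l, Rplus_0_r, Rminus_diag. easy.
- rewrite S_INR in Ha.
  destruct (IH (a + d)) as [ptd [H1 [H2 [H3 [H4 H5]]]]].
  { intros t Ht. apply Ha. lra. }
  assert (Hn : 0 <= INR n * d) by (apply Rmult_le_pos; [apply pos_INR|easy]).
  assert (Hx : exists x, a <= x <= a + d /\ f (a + d) - f a = h x * d).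
  { destruct Hd as [Hd|Hd].
    - destruct (mean_value f h a (a + d)) as [x [Hx1 Hx2]]. lra.
      intros t Ht. apply Ha. lra. exists x. split. easy.
      rewrite Hx2. ring.
    - subst d. exists a. split. lra. rewrite Rplus_0_r. ring. }
  destruct Hx as [x [Hx1 Hx2]].
  exists (SF_cons (a, x) ptd). split; [|split; [|split; [|split]]].
  + intros [|i] Hi.
    * simpl. rewrite H2. lra.
    * apply (H1 i). simpl in Hi. apply Nat.succ_lt_mono. exact Hi.
  + easy.
  + rewrite S_INR. transitivity (a + d + INR n * d). 2: ring.
    rewrite <- H3. easy.
  + change (Rmax (Rabs (SF_h ptd - a)) (seq_step (SF_lx ptd)) <= d).
    rewrite H2. replace (a + d - a) with d by ring. rewrite Rabs_pos_eq by easy.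
    apply Rmax_lub. lra. easy.
  + rewrite Riemann_sum_cons, H5, H2. simpl fst. simpl snd.
    rewrite S_INR.
    replace (a + (INR n + 1) * d) with (a + d + INR n * d) by ring.
    change ((a + d - a) * h x + (f (a + d + INR n * d) - f (a + d)) =
      f (a + d + INR n * d) - f a).
    nra.
Qed.

(** Darboux's form of the theorem. It serves for competing arcs, of which only
differentiability and the existence of the integrals are used. *)
Lemma RInt_derivative (f h : R -> R) (a b l : R) :
  a < b -> (forall t, a <= t <= b -> is_derive f t (h t)) ->
  is_RInt h a b l -> l = f b - f a.
Proof.
intros Hab Hf HI. apply Rminus_diag_uniq.
apply cond_eq. intros eps Heps. rewrite Rminus_0_r.
destruct (HI (fun y => Rabs (y - l) < eps)) as [d Hd].
{ exists (mkposreal eps Heps). intros y Hy. exact Hy. }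
destruct (INR_unbounded ((b - a) / d)) as [n Hn].
assert (Hd0 := cond_pos d).
assert (Hn0 : 0 < INR n).
{ eapply Rle_lt_trans. 2: exact Hn.
  apply Rdiv_le_0_compat; lra. }
assert (En : a + INR n * ((b - a) / INR n) = b) by (field; lra).
destruct (mean_value_subdivision f h ((b - a) / INR n) n) with (a := a)
  as [ptd [H1 [H2 [H3 [H4 H5]]]]].
- apply Rdiv_le_0_compat; lra.
- intros t Ht. apply Hf. lra.
- rewrite En in *.
  assert (K : Rabs (scal (sign (b - a)) (Riemann_sum h ptd) - l) < eps).
  { apply Hd.
    - eapply Rle_lt_trans. exact H4.
      apply Rmult_lt_reg_r with (INR n). easy.
      replace ((b - a) / INR n * INR n) with (b - a) by (field; lra).
      apply Rmult_lt_reg_r with (/ d). now apply Rinv_0_lt_compat.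
      replace (d * INR n * / d) with (INR n) by (field; lra). exact Hn.
    - rewrite Rmin_left, Rmax_right by lra. split. easy.
      split. easy. congruence. }
  rewrite sign_eq_1, H5 in K by lra.
  change (Rabs (1 * (f b - f a) - l) < eps) in K.
  rewrite Rabs_minus_sym. replace (f b - f a - l) with (1 * (f b - f a) - l)
    by ring. easy.
Qed.

(** * Improper integrals *)

Definition lim_right (M : R -> C) (a : R) (l : C) : Prop :=
  forall eps, 0 < eps -> exists d, 0 < d /\
  forall s, a < s < a + d -> Cmod (M s - l)%C < eps.

Definition lim_left (M : R -> C) (a : R) (l : C) : Prop :=
  forall eps, 0 < eps -> exists d, 0 < d /\
  forall s, a - d < s < a -> Cmod (M s - l)%C < eps.

Lemma Cderiv_lim_left M a l : Cderiv M a l -> lim_left M a (M a).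
Proof.
intros H eps Heps. destruct (Cderiv_cont _ _ _ H eps Heps) as [d [Hd K]].
exists d. split. easy. intros s Hs. apply K, Rabs_def1; lra.
Qed.

Lemma improper_intro (f M : R -> C) (t : R) (l0 l1 : C) : 0 < t ->
  (forall a b, 0 < a -> a < b -> b < t -> is_RInt (V := CR) f a b (M b - M a)%C) ->
  lim_right M 0 l0 -> lim_left M t l1 ->
  is_RInt_gen (V := CR) f (at_right 0) (at_left t) (l1 - l0)%C.
Proof.
intros Ht HI H0 H1 P HP.
apply (locally_Cmod_inv (l1 - l0)%C) in HP. destruct HP as [e [He HP]].
destruct (H0 (e / 2)) as [d0 [Hd0 K0]]. lra.
destruct (H1 (e / 2)) as [d1 [Hd1 K1]]. lra.
assert (D0 : 0 < Rmin d0 (t / 2)) by (apply Rmin_pos; lra).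
assert (D1 : 0 < Rmin d1 (t / 2)) by (apply Rmin_pos; lra).
apply (Filter_prod _ _ _ (fun a => 0 < a < Rmin d0 (t / 2))
   (fun b => t - Rmin d1 (t / 2) < b < t)).
- exists (mkposreal _ D0). intros y Hy Hy0.
  change (Rabs (y - 0) < Rmin d0 (t / 2)) in Hy.
  apply Rabs_def2 in Hy. lra.
- exists (mkposreal _ D1). intros y Hy Hy0.
  change (Rabs (y - t) < Rmin d1 (t / 2)) in Hy.
  apply Rabs_def2 in Hy. lra.
- intros a b Ha Hb.
  generalize (Rmin_l d0 (t / 2)) (Rmin_r d0 (t / 2))
    (Rmin_l d1 (t / 2)) (Rmin_r d1 (t / 2)). intros.
  exists (M b - M a)%C. split. apply HI; lra.
  apply HP.
  replace (M b - M a - (l1 - l0))%C with ((M b - l1) - (M a - l0))%C by ring.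
  eapply Rle_lt_trans. apply Cmod_sub_le.
  generalize (K0 a ltac:(lra)) (K1 b ltac:(lra)). lra.
Qed.

Lemma improper_elim (f : R -> C) (t : R) (l : C) :
  is_RInt_gen (V := CR) f (at_right 0) (at_left t) l ->
  forall eps, 0 < eps -> exists d, 0 < d /\
  forall a b, 0 < a < d -> t - d < b < t ->
  exists y, is_RInt (V := CR) f a b y /\ Cmod (y - l)%C < eps.
Proof.
intros H eps Heps.
destruct (H (fun y => Cmod (y - l)%C < eps)) as [Q1 Q2 [d1 HQ1] [d2 HQ2] K].
{ apply (locally_Cmod l _ eps). easy. easy. }
exists (Rmin d1 d2). split. apply Rmin_pos; apply cond_pos.
generalize (Rmin_l d1 d2) (Rmin_r d1 d2).
intros G1 G2 a b Ha Hb. apply (K a b).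
- apply HQ1. 2: easy. change (Rabs (a - 0) < d1). apply Rabs_def1; lra.
- apply HQ2. 2: easy. change (Rabs (b - t) < d2). apply Rabs_def1; lra.
Qed.

Lemma improper_value (f M : R -> C) (t : R) (l l0 l1 : C) : 0 < t ->
  (forall a b, 0 < a -> a < b -> b < t -> is_RInt (V := CR) f a b (M b - M a)%C) ->
  lim_right M 0 l0 -> lim_left M t l1 ->
  is_RInt_gen (V := CR) f (at_right 0) (at_left t) l -> l = (l1 - l0)%C.
Proof.
intros Ht HI H0 H1 Hl.
assert (K := improper_intro f M t l0 l1 Ht HI H0 H1).
rewrite <- (is_RInt_gen_unique (V := C_R_CompleteNormedModule) _ _ Hl).
now rewrite <- (is_RInt_gen_unique (V := C_R_CompleteNormedModule) _ _ K).
Qed.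

Lemma common_bound (a b c : R) : 0 < a -> 0 < b -> 0 < c ->
  exists e, 0 < e /\ e < a /\ e < b /\ e < c.
Proof.
intros Ha Hb Hc. exists (Rmin a (Rmin b c) / 2).
assert (0 < Rmin a (Rmin b c)) by (repeat apply Rmin_pos; lra).
generalize (Rmin_l a (Rmin b c)) (Rmin_r a (Rmin b c)) (Rmin_l b c) (Rmin_r b c).
lra.
Qed.

(** The integrals from [0] are improper, so two points are compared through
integrals with a common lower limit close to [0]. *)
Lemma imaginary_primitive_const (f : R -> C) (N : R -> R) (al be : R) :
  0 <= al -> be <= 1 ->
  (forall t, 0 < t <= 1 -> exists l,
     is_RInt_gen (V := CR) f (at_right 0) (at_left t) l /\ Re l = 0) ->
  (forall t, al < t < be -> is_derive N t (Re (f t))) ->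
  forall t1 t2, al < t1 < be -> al < t2 < be -> N t1 = N t2.
Proof.
intros Hal Hbe Hint HN.
assert (W : forall t1 t2, al < t1 -> t1 < t2 -> t2 < be -> N t1 = N t2).
{ intros t1 t2 Ht1 H12 Ht2.
  apply Rminus_diag_uniq. apply cond_eq. intros eps Heps. rewrite Rminus_0_r.
  assert (Hcont : forall t, al < t < be -> exists d, 0 < d /\
    forall s, Rabs (s - t) < d -> Rabs (N s - N t) < eps / 8).
  { intros t Ht. assert (Q := derive_cont _ _ _ (HN t Ht)).
    destruct (Q (eps / 8)) as [d [Hd K]]. lra.
    exists d. split. easy. intros s Hs.
    destruct (Req_dec s t) as [->|Hst].
    - rewrite Rminus_diag, Rabs_R0. lra.
    - apply K. split. split. easy. now apply not_eq_sym. exact Hs. }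
  destruct (Hcont t1) as [c1 [Hc1 C1]]. lra.
  destruct (Hcont t2) as [c2 [Hc2 C2]]. lra.
  destruct (Hint t1) as [l1 [I1 R1]]. lra.
  destruct (Hint t2) as [l2 [I2 R2]]. lra.
  destruct (improper_elim _ _ _ I1 (eps / 8)) as [d1 [Hd1 K1]]. lra.
  destruct (improper_elim _ _ _ I2 (eps / 8)) as [d2 [Hd2 K2]]. lra.
  destruct (common_bound c1 c2 d1 Hc1 Hc2 Hd1) as [e1 [He1 B1]].
  destruct (common_bound e1 d2 (t1 - al)) as [e2 [He2 B2]]; try lra.
  destruct (common_bound e2 (t2 - t1) 1) as [e [He B3]]; try lra.
  set (b1 := t1 - e / 2). set (b2 := t2 - e / 2).
  set (a := Rmin e b1 / 2).
  assert (Ha : 0 < a /\ a < e /\ a < b1).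
  { unfold a. generalize (Rmin_l e b1) (Rmin_r e b1).
    assert (0 < Rmin e b1) by (apply Rmin_pos; unfold b1; lra). lra. }
  destruct (K1 a b1) as [y1 [Y1 Z1]]; try (unfold b1 in *; lra).
  destruct (K2 a b2) as [y2 [Y2 Z2]]; try (unfold b1, b2 in *; lra).
  assert (I := is_RInt_Chasles (V := CR) _ _ _ _ _ _
    (is_RInt_swap (V := CR) _ _ _ _ Y1) Y2).
  apply is_RInt_C_re in I.
  assert (D := RInt_derivative N (fun t => Re (f t)) b1 b2 _
    ltac:(unfold b1, b2; lra)
    (fun t Ht => HN t ltac:(unfold b1, b2 in *; lra)) I).
  change (- Re y1 + Re y2 = N b2 - N b1) in D.
  assert (N1 : Rabs (N b1 - N t1) < eps / 8)
    by (apply C1, Rabs_def1; unfold b1; lra).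
  assert (N2 : Rabs (N b2 - N t2) < eps / 8)
    by (apply C2, Rabs_def1; unfold b2; lra).
  assert (X1 := re_le_Cmod (y1 - l1)). assert (X2 := re_le_Cmod (y2 - l2)).
  rewrite Re_sub in X1, X2.
  apply Rabs_le_between in X1, X2. apply Rabs_def2 in N1, N2.
  apply Rabs_def1; lra. }
intros t1 t2 H1 H2. destruct (Rtotal_order t1 t2) as [h|[->|h]].
- apply W; lra.
- easy.
- symmetry. apply W; lra.
Qed.

(** * Primitives of a square root near a zero or a pole *)

Lemma local_sqrt r r' p d0 : 0 < d0 -> (forall z, Cmod (z - p)%C < d0 -> hol r r' z) ->
  r p <> 0%C ->
  exists T T' d, 0 < d /\ d <= d0 /\ forall z, Cmod (z - p)%C < d ->
    hol T T' z /\ (T z * T z = r z)%C.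
Proof.
intros Hd0 HR H0.
assert (Hp : Cmod (p - p) < d0).
{ now rewrite Cmod_diag. }
destruct (hol_bounds _ _ _ (HR p Hp)) as [d1 [M [Hd1 [HM [_ HL]]]]].
assert (K0 : 0 < Cmod (r p)) by now apply Cmod_gt_0.
set (d := Rmin d0 (Rmin d1 (Cmod (r p) / (M + 1)))).
assert (Hd : 0 < d).
{ repeat apply Rmin_pos; try easy. apply Rdiv_lt_0_compat; lra. }
assert (D1 : d <= d1) by (eapply Rle_trans; [apply Rmin_r|apply Rmin_l]).
assert (D2 : d <= Cmod (r p) / (M + 1))
  by (eapply Rle_trans; [apply Rmin_r|apply Rmin_r]).
exists (fun z => csqrt (r z * / r p) * csqrt (r p))%C.
eexists. exists d. split. easy. split. apply Rmin_l.
intros z Hz. split.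
- assert (Hz0 : Cmod (z - p) < d0).
  { eapply Rlt_le_trans. exact Hz. apply Rmin_l. }
  assert (Hre : 0 < Re (csqrt (r z * / r p))).
  2: exact (hol_mult _ _ _ _ z
   (hol_comp csqrt _ (fun z => r z * / r p)%C _ z
     (hol_csqrt (r z * / r p)%C Hre)
     (hol_mult _ _ _ _ z (HR z Hz0) (hol_const (/ r p)%C z)))
   (hol_const (csqrt (r p)) z)).
  apply csqrt_re_pos. intros _.
  destruct (HL p z) as [L _].
  { now rewrite Cmod_diag. }
  { lra. }
  assert (Cmod (z - p) * (M + 1) < Cmod (r p)).
  { apply Rlt_le_trans with (Cmod (r p) / (M + 1) * (M + 1)).
    apply Rmult_lt_compat_r; lra. right. field. lra. }
  assert (Q : Cmod (r z * / r p - 1) < 1).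
  { replace (r z * / r p - 1)%C with ((r z - r p) / r p)%C by (field; easy).
    rewrite Cmod_div by easy. apply Rmult_lt_reg_r with (1 := K0).
    unfold Rdiv. rewrite Rmult_assoc, Rinv_l by lra.
    generalize (Cmod_ge_0 (z - p)). intros. lra. }
  assert (Q2 := re_le_Cmod (r z * / r p - 1)).
  rewrite Re_sub in Q2. change (Re 1) with 1 in Q2.
  apply Rabs_le_between in Q2. lra.
- replace (csqrt (r z * / r p) * csqrt (r p) *
   (csqrt (r z * / r p) * csqrt (r p)))%C with
   ((csqrt (r z * / r p) * csqrt (r z * / r p)) * (csqrt (r p) * csqrt (r p)))%C
   by ring.
  rewrite !csqrt_sqr. field. easy.
Qed.

(** On such a half plane [z - p] has a holomorphic square root. *)
Definition half_plane (p d z : C) : Prop := 0 < Re ((z - p) * Cconj d)%C.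

Lemma half_plane_open p d z : half_plane p d z ->
  exists e, 0 < e /\ forall w, Cmod (w - z)%C < e -> half_plane p d w.
Proof.
unfold half_plane. intros H.
set (r := Re ((z - p) * Cconj d)%C) in *.
set (K := Cmod d + 1).
assert (HK : 0 < K) by (unfold K; generalize (Cmod_ge_0 d); lra).
exists (r / K). split. now apply Rdiv_lt_0_compat.
intros w Hw.
replace ((w - p) * Cconj d)%C with ((z - p) * Cconj d - (z - w) * Cconj d)%C
  by ring.
rewrite Re_sub. fold r.
assert (Q := re_le_Cmod ((z - w) * Cconj d)).
rewrite Cmod_mult, Cmod_conj, Cmod_minus_sym in Q.
assert (Cmod (w - z) * K < r).
{ apply Rlt_le_trans with (r / K * K). now apply Rmult_lt_compat_r.
  right; field; lra. }
apply Rabs_le_between in Q. generalize (Cmod_ge_0 (w - z)).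
unfold K in *. intros. lra.
Qed.

Lemma half_plane_root (p d : C) : d <> 0%C -> exists sg : C -> C,
  forall z, half_plane p d z ->
  (sg z * sg z = z - p)%C /\ sg z <> 0%C /\ hol sg (fun z => / (2 * sg z))%C z.
Proof.
intros Hd. exists (fun z => csqrt (- p * / d + z * / d) * csqrt d)%C.
intros z Hz.
assert (Hp : 0 < Re (csqrt (- p * / d + z * / d))).
{ apply csqrt_re_pos. intros _.
  assert (0 < Cmod d) by now apply Cmod_gt_0.
  replace (- p * / d + z * / d)%C with
    (RtoC (/ Cmod d ^ 2) * ((z - p) * Cconj d))%C.
  2:{ rewrite RtoC_inv, Cmod2_conj by nra. field. split; [easy|].
      intros E. apply Hd.
      rewrite <- (Cconj_conj d), E. apply injective_projections; simpl; ring. }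
  assert (0 < / Cmod d ^ 2) by (apply Rinv_0_lt_compat; nra).
  unfold half_plane in Hz.
  replace (Re (RtoC (/ Cmod d ^ 2) * ((z - p) * Cconj d))%C) with
   (/ Cmod d ^ 2 * Re ((z - p) * Cconj d)%C) by (simpl; unfold Re; ring).
  nra. }
assert (Hs : csqrt (- p * / d + z * / d)%C <> 0%C).
{ intros E. rewrite E in Hp. simpl in Hp. lra. }
assert (Hsd : csqrt d <> 0%C).
{ intros E. apply Hd. rewrite <- (csqrt_sqr d), E. ring. }
split; [|split].
- replace (csqrt (- p * / d + z * / d) * csqrt d *
   (csqrt (- p * / d + z * / d) * csqrt d))%C with
   ((csqrt (- p * / d + z * / d) * csqrt (- p * / d + z * / d))
     * (csqrt d * csqrt d))%C by ring.
  rewrite !csqrt_sqr. field. easy.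
- now apply Cmult_neq_0.
- destruct (half_plane_open _ _ _ Hz) as [e [He Hw]].
  eapply (hol_loc _ _ _ _ z e He).
  2: exact (hol_mult _ _ _ _ z
   (hol_comp csqrt _ (fun z => - p * / d + z * / d)%C _ z
     (hol_csqrt _ Hp) (hol_affine (- p * / d)%C (/ d)%C z))
   (hol_const (csqrt d) z)).
  intros w Hwz. split. easy. cbv beta.
  assert (Hsw : csqrt (- p * / d + w * / d)%C <> 0%C).
  { intros E. specialize (Hw w Hwz). unfold half_plane in Hw.
    replace (w - p)%C with (d * (- p * / d + w * / d))%C in Hw by (field; easy).
    rewrite <- (csqrt_sqr (- p * / d + w * / d)), E in Hw.
    replace (d * (0 * 0) * Cconj d)%C with (RtoC 0) in Hw by ring.
    simpl in Hw. lra. }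
  set (u := csqrt (- p * / d + w * / d)) in *. clearbody u.
  assert (Ed : (/ d = / (csqrt d * csqrt d))%C) by now rewrite csqrt_sqr.
  rewrite Ed. field. easy.
Qed.

(** With [sg] a root of [z - p] on the half plane, take [Phi = sg ^ (j + 1) * E] and
[Psi = sg ^ (j + 1) * T / (z - p)], where [E] is the spoke integral of [T];
[spoke_int_ode] is exactly [Phi' = Psi]. *)
Lemma root_primitive (q : C -> C) (p d : C) j T T' delta :
  d <> 0%C -> 0 < delta ->
  (forall z, Cmod (z - p)%C < delta -> hol T T' z) ->
  exists Phi Psi Psi' : C -> C, forall z, Cmod (z - p)%C < delta ->
    half_plane p d z ->
    (q z * (z - p) ^ 2 = (z - p) ^ S j * (T z * T z))%C ->
    hol Phi Psi z /\ hol Psi Psi' z /\ (Psi z * Psi z = q z)%C /\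
    (Phi z * Phi z = (z - p) ^ S j * (spoke_int j p T z * spoke_int j p T z))%C.
Proof.
intros Hd Hdelta HT. destruct (half_plane_root p d Hd) as [sg Hsg].
assert (HTs : forall z s, Cmod (z - p)%C < delta -> 0 <= s <= 1 ->
   hol T T' (spoke p z s)).
{ intros z s Hz Hs. apply HT. unfold spoke.
  replace (p + s * s * (z - p) - p)%C with (RtoC (s * s) * (z - p))%C
    by (rewrite RtoC_mult; ring).
  rewrite Cmod_mult, Cmod_R, Rabs_pos_eq by nra.
  generalize (Cmod_ge_0 (z - p)). intros. assert (s * s <= 1) by nra. nra. }
exists (fun z => sg z ^ S j * spoke_int j p T z)%C,
  (fun z => sg z ^ S j * (T z * / (z - p)))%C. eexists.
intros z Hz Hhp Hq.
destruct (Hsg z Hhp) as [S1 [S2 S3]].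
assert (Hzp : (z - p)%C <> 0%C) by (rewrite <- S1; now apply Cmult_neq_0).
split; [|split; [|split]].
- destruct (half_plane_open _ _ _ Hhp) as [e [He Hw]].
  eapply (hol_loc _ _ _ _ z (Rmin e (delta - Cmod (z - p)))).
  { apply Rmin_pos; lra. }
  2: exact (hol_mult _ _ _ _ z
    (hol_comp _ _ sg _ z (hol_pow j (sg z)) S3)
    (hol_spoke_int j p T T' z (fun s Hs => HTs z s Hz Hs))).
  intros w Hwz. split. easy. cbv beta.
  generalize (Rmin_l e (delta - Cmod (z - p))) (Rmin_r e (delta - Cmod (z - p))).
  intros.
  destruct (Hsg w (Hw w ltac:(lra))) as [W1 [W2 W3]].
  assert (Hwp : Cmod (w - p) < delta).
  { generalize (Cmod_sub_trans w z p). lra. }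
  rewrite <- (spoke_int_ode j p T T' w) by (intros s Hs; now apply HTs).
  rewrite <- W1. simpl Cpow. field. easy.
- exact (hol_mult _ _ _ _ z
    (hol_comp _ _ sg _ z (hol_pow j (sg z)) S3)
    (hol_mult _ _ _ _ z (HT z Hz)
      (hol_comp Cinv _ (fun z => z - p)%C _ z (hol_inv _ Hzp)
        (hol_plus _ _ _ _ z (hol_id z) (hol_const (- p)%C z))))).
- replace (sg z ^ S j * (T z * / (z - p)) * (sg z ^ S j * (T z * / (z - p))))%C
    with ((sg z * sg z) ^ S j * (T z * T z) / (z - p) ^ 2)%C.
  2:{ rewrite Cpow_mult_l. field. easy. }
  rewrite S1, <- Hq. field. easy.
- replace (sg z ^ S j * spoke_int j p T z * (sg z ^ S j * spoke_int j p T z))%C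
    with ((sg z * sg z) ^ S j * (spoke_int j p T z * spoke_int j p T z))%C.
  2:{ rewrite Cpow_mult_l. ring. }
  now rewrite S1.
Qed.

(** Two roots of the same function agree up to a sign on a convex set, so their
primitives agree up to this sign and a constant. *)
Lemma primitive_up_to_sign (D : C -> Prop) phi f f' Phi Psi Psi' :
  convex D -> (forall z, D z -> hol phi f z) -> (forall z, D z -> hol f f' z) ->
  (forall z, D z -> hol Phi Psi z) -> (forall z, D z -> hol Psi Psi' z) ->
  (forall z, D z -> (Psi z * Psi z = f z * f z)%C) ->
  (forall z, D z -> f z <> 0%C) ->
  exists (e : R) (c : C), (e = 1 \/ e = -1) /\
    forall z, D z -> Phi z = (e * (phi z - c))%C.
Proof.
intros HD Hphi HS HPhi HPsi Hsq H0.
destruct (branch_convex D Psi Psi' f f') as [e [He Hb]]; try easy.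
destruct (classic (exists z0, D z0)) as [[z0 Hz0]|Hn].
2:{ exists 1, 0%C. split. now left. intros z Hz. exfalso. apply Hn. now exists z. }
assert (He2 := sign_sqr e He).
exists e, (phi z0 - e * Phi z0)%C. split. easy.
intros z Hz.
assert (E : (Phi z + (- e) * phi z = Phi z0 + (- e) * phi z0)%C).
{ apply (hol_zero_const D (fun z => Phi z + (- e) * phi z)%C
    (fun z => Psi z + (0 * phi z + (- e) * f z))%C); try easy.
  - intros w Hw. apply hol_plus. now apply HPhi.
    exact (hol_mult _ _ _ _ w (hol_const (- e)%C w) (Hphi w Hw)).
  - intros w Hw. rewrite Hb by easy. ring. }
replace (Phi z) with ((Phi z + - e * phi z) + e * phi z)%C by ring.
rewrite E.
replace (e * (phi z - (phi z0 - e * Phi z0)))%C with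
  (e * phi z - e * phi z0 + (e * e) * Phi z0)%C by ring.
rewrite He2. ring.
Qed.

Lemma convex_near (D : C -> Prop) (p : C) delta : convex D ->
  convex (fun z => D z /\ Cmod (z - p)%C < delta).
Proof.
intros HD z w t [Hz1 Hz2] [Hw1 Hw2] Ht. split. now apply HD.
replace (z + t * (w - z) - p)%C with ((1 - t) * (z - p) + t * (w - p))%C
  by ring.
eapply Rle_lt_trans. apply Cmod_triangle.
rewrite !Cmod_mult, <- RtoC_minus, !Cmod_R, !Rabs_pos_eq by lra.
destruct (Rlt_dec 0 t) as [h|h].
- assert (t * Cmod (w - p) < t * delta) by now apply Rmult_lt_compat_l.
  assert ((1 - t) * Cmod (z - p) <= (1 - t) * delta)
    by (apply Rmult_le_compat_l; lra). lra.
- replace t with 0 by lra. lra.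
Qed.

(** The square removes the sign and the half-integer power left by the choice of
roots. *)
Lemma endpoint_expansion (D : C -> Prop) (q phi f f' : C -> C) (p d : C) j T T' delta :
  convex D -> (forall z, D z -> hol phi f z) -> (forall z, D z -> hol f f' z) ->
  (forall z, D z -> (f z * f z = q z)%C) -> (forall z, D z -> f z <> 0%C) ->
  d <> 0%C -> 0 < delta ->
  (forall z, D z -> half_plane p d z) ->
  (forall z, Cmod (z - p)%C < delta -> hol T T' z) ->
  (forall z, D z -> Cmod (z - p)%C < delta ->
    (q z * (z - p) ^ 2 = (z - p) ^ S j * (T z * T z))%C) ->
  exists c, forall z, D z -> Cmod (z - p)%C < delta ->
   ((phi z - c) * (phi z - c) =
     (z - p) ^ S j * (spoke_int j p T z * spoke_int j p T z))%C.
Proof.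
intros HD Hphi HS Hsq H0 Hd Hdelta Hhp HT Hq.
destruct (root_primitive q p d j T T' delta Hd Hdelta HT)
  as [Phi [Psi [Psi' HP]]].
destruct (primitive_up_to_sign (fun z => D z /\ Cmod (z - p)%C < delta)
  phi f f' Phi Psi Psi') as [e [c [He Hc]]].
- now apply convex_near.
- intros z [Hz _]. now apply Hphi.
- intros z [Hz _]. now apply HS.
- intros z [Hz1 Hz2]. apply (HP z Hz2 (Hhp z Hz1) (Hq z Hz1 Hz2)).
- intros z [Hz1 Hz2]. apply (HP z Hz2 (Hhp z Hz1) (Hq z Hz1 Hz2)).
- intros z [Hz1 Hz2]. rewrite Hsq by easy.
  apply (HP z Hz2 (Hhp z Hz1) (Hq z Hz1 Hz2)).
- intros z [Hz _]. now apply H0.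
- exists c. intros z Hz1 Hz2.
  destruct (HP z Hz2 (Hhp z Hz1) (Hq z Hz1 Hz2)) as [_ [_ [_ P4]]].
  rewrite <- P4, (Hc z (conj Hz1 Hz2)).
  replace (e * (phi z - c) * (e * (phi z - c)))%C with
   ((e * e) * ((phi z - c) * (phi z - c)))%C by ring.
  rewrite (sign_sqr e He). ring.
Qed.

Lemma expansion_limit (D : C -> Prop) (phi E E' : C -> C) p c j delta :
  hol E E' p -> 0 < delta ->
  (forall z, D z -> Cmod (z - p)%C < delta ->
   ((phi z - c) * (phi z - c) = (z - p) ^ S j * (E z * E z))%C) ->
  forall eps, 0 < eps -> exists d, 0 < d /\ forall z, D z ->
    Cmod (z - p)%C < d -> Cmod (phi z - c)%C < eps.
Proof.
intros HE Hdelta H eps Heps.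
destruct (hol_bounds _ _ _ HE) as [d1 [M [Hd1 [HM [HB _]]]]].
set (d := Rmin (Rmin delta d1) (Rmin 1 (eps ^ 2 / (M ^ 2 + 1)))).
assert (P2 : 0 < M ^ 2 + 1) by nra.
assert (Pe : 0 < eps ^ 2) by nra.
assert (Hd : 0 < d).
{ repeat apply Rmin_pos; try lra. now apply Rdiv_lt_0_compat. }
exists d. split. easy. intros z Hz Hzd.
assert (D1 : d <= delta) by (eapply Rle_trans; [apply Rmin_l|apply Rmin_l]).
assert (D2 : d <= d1) by (eapply Rle_trans; [apply Rmin_l|apply Rmin_r]).
assert (D3 : d <= 1) by (eapply Rle_trans; [apply Rmin_r|apply Rmin_l]).
assert (D4 : d <= eps ^ 2 / (M ^ 2 + 1))
  by (eapply Rle_trans; [apply Rmin_r|apply Rmin_r]).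
specialize (H z Hz ltac:(lra)). apply (f_equal Cmod) in H.
rewrite !Cmod_mult, Cmod_pow in H.
destruct (HB z ltac:(lra)) as [B _].
set (a := Cmod (z - p)) in *. set (u := Cmod (phi z - c)) in *.
assert (0 <= a) by apply Cmod_ge_0. assert (0 <= u) by apply Cmod_ge_0.
assert (0 <= Cmod (E z)) by apply Cmod_ge_0.
assert (a ^ S j <= a).
{ simpl. assert (a ^ j <= 1) by (rewrite <- (pow1 j); apply pow_incr; lra).
  assert (0 <= a ^ j) by now apply pow_le. nra. }
assert (0 <= a ^ S j) by now apply pow_le.
assert (Cmod (E z) * Cmod (E z) <= M ^ 2) by nra.
assert (a * (M ^ 2 + 1) < eps ^ 2).
{ apply Rlt_le_trans with (eps ^ 2 / (M ^ 2 + 1) * (M ^ 2 + 1)).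
  apply Rmult_lt_compat_r; lra. right; field; lra. }
assert (u * u <= a * M ^ 2).
{ rewrite H. apply Rmult_le_compat; try easy. nra. }
apply Rnot_le_lt. intros h. assert (eps ^ 2 <= u * u) by nra. lra.
Qed.

(** * Analytic level curves through a point *)

Lemma Ci_plus_R_neq (m : R) : (Ci + m)%C <> 0%C.
Proof. intros E. apply (f_equal Im) in E. simpl in E. unfold Im in E. simpl in E. lra. Qed.

(** Blowing up [z = p + (y - Im p) (i + m)] removes the factor [(y - Im p) ^ (j + 1)]
from the equation of the level curve. What remains is solvable for [m]: at the
centre its derivative in [m] is [(j + 1) r0 / (i + m0)], which is not real. *)
Lemma analytic_graph (E E' : C -> C) (p : C) (j : nat) (m0 r0 : R) :
  hol E E' p -> r0 <> 0 -> ((Ci + m0) ^ S j * (E p * E p))%C = RtoC r0 ->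
  exists (G : R -> C) (F F' : C -> C) (d : R), 0 < d /\ hol F F' (Im p) /\
  G (Im p) = p /\
  forall y, Rabs (y - Im p) < d -> F y = G y /\ Im (G y) = y /\
  exists nu : R, 0 < nu * r0 /\
   ((G y - p) ^ S j * (E (G y) * E (G y)) = RtoC ((y - Im p) ^ S j * nu))%C.
Proof.
intros HE Hr0 Hm0. set (y0 := Im p).
assert (Hp0 : forall m : C, (p + (y0 - y0) * (Ci + m))%C = p) by (intros; ring).
set (zt := fun m y : C => (p + (y - y0) * (Ci + m))%C).
assert (HZ : hol2 zt (fun m y => y - y0)%C (fun m y => Ci + m)%C m0 y0).
{ eapply hol2_eq. 4: exact (hol2_plus _ _ _ _ _ _ _ _ (hol2_const p m0 y0)
   (hol2_mult _ _ _ _ _ _ _ _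
     (hol2_plus _ _ _ _ _ _ _ _ (hol2_snd m0 y0) (hol2_const (- y0)%C m0 y0))
     (hol2_plus _ _ _ _ _ _ _ _ (hol2_const Ci m0 y0) (hol2_fst m0 y0)))).
  all: intros; unfold zt; cbv beta; ring. }
assert (HEZ : hol E E' (zt m0 y0)) by (unfold zt; now rewrite Hp0).
assert (H2 := hol2_comp _ _ _ _ _ _ _ HEZ HZ).
assert (Hpow : hol (fun z => z ^ S j)%C (fun z => INR (S j) * z ^ j)%C (Ci + m0)%C)
  by apply hol_pow.
assert (H1 := hol2_comp _ _ (fun m y => Ci + m)%C _ _ m0 y0 Hpow
  (hol2_plus _ _ _ _ _ _ _ _ (hol2_const Ci m0 y0) (hol2_fst m0 y0))).
assert (HN := hol2_mult _ _ _ _ _ _ _ _ H1 (hol2_mult _ _ _ _ _ _ _ _ H2 H2)).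
cbv beta in HN.
destruct (real_implicit _ _ _ m0 y0 HN) as [mu [F [F' [d [Hd [HF [Hmu HFmu]]]]]]].
- cbv beta. unfold zt. rewrite Hp0, Hm0. easy.
- cbv beta. unfold zt. rewrite Hp0.
  match goal with |- Im ?t <> 0 => replace t with
    (RtoC (INR (S j) * r0) / (Ci + m0))%C end.
  2:{ rewrite RtoC_mult, <- Hm0. simpl Cpow. field. apply Ci_plus_R_neq. }
  replace (Im (RtoC (INR (S j) * r0) / (Ci + m0))%C) with
    (- (INR (S j) * r0) / (m0 ^ 2 + 1)).
  2:{ simpl. unfold Im. simpl. field. nra. }
  assert (0 < INR (S j)) by (apply lt_0_INR; lia).
  assert (INR (S j) * r0 <> 0) by (apply Rmult_integral_contrapositive; lra).
  intros K. apply H0. apply Rmult_eq_reg_r with (- / (m0 ^ 2 + 1)).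
  unfold Rdiv in K. lra.
  apply Ropp_neq_0_compat, Rinv_neq_0_compat. nra.
- set (Nf := fun m y : C => ((Ci + m) ^ S j * (E (zt m y) * E (zt m y)))%C) in *.
  assert (HG0 : hol (fun y => Nf (F y) y) (fun y =>
     (INR (S j) * (Ci + F y) ^ j * F' y) * (E (zt (F y) y) * E (zt (F y) y)) +
      (Ci + F y) ^ S j *
      (E' (zt (F y) y) * (1 * (Ci + F y) + (y - y0) * F' y) * E (zt (F y) y) +
       E (zt (F y) y) * (E' (zt (F y) y) * (1 * (Ci + F y) + (y - y0) * F' y))))%C y0).
  { assert (HF0 : F y0 = m0).
    { destruct (HFmu y0) as [Q _]. rewrite Rminus_diag, Rabs_R0. easy.
      now rewrite Q, Hmu. }
    assert (A1 : hol (fun y => Ci + F y)%C F' y0).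
    { eapply hol_eq. 3: exact (hol_plus _ _ _ _ _ (hol_const Ci y0) HF).
      easy. intros; cbv beta; ring. }
    assert (A2 : hol (fun y => zt (F y) y)
       (fun y => 1 * (Ci + F y) + (y - y0) * F' y)%C y0).
    { eapply hol_eq. 3: exact (hol_plus _ _ _ _ _ (hol_const p y0)
       (hol_mult _ _ _ _ _ (hol_plus _ _ _ _ _ (hol_id y0) (hol_const (- y0)%C y0))
         A1)).
      easy. intros; cbv beta; ring. }
    assert (A3 : hol (fun y => E (zt (F y) y)) (fun y => E' (zt (F y) y) *
       (1 * (Ci + F y) + (y - y0) * F' y))%C y0).
    { apply (hol_comp E E' (fun y => zt (F y) y)). 2: easy. now rewrite HF0. }
    exact (hol_mult _ _ _ _ _ (hol_comp _ _ (fun y => Ci + F y)%C _ _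
       (hol_pow j _) A1) (hol_mult _ _ _ _ _ A3 A3)). }
  assert (HF0 : F y0 = m0).
  { destruct (HFmu y0) as [Q _]. rewrite Rminus_diag, Rabs_R0. easy.
    now rewrite Q, Hmu. }
  assert (N0 : Nf (F y0) y0 = RtoC r0).
  { rewrite HF0. unfold Nf, zt. rewrite Hp0. exact Hm0. }
  destruct (Cderiv_cont _ _ _ (hol_RtoC _ _ _ HG0) (Rabs r0)) as [e [He Ke]].
  { now apply Rabs_pos_lt. }
  exists (fun y => p + RtoC (y - y0) * (Ci + mu y))%C,
   (fun y => p + (y - y0) * (Ci + F y))%C. eexists. exists (Rmin d e).
  split. now apply Rmin_pos. split; [|split].
  + exact (hol_plus _ _ _ _ _ (hol_const p y0) (hol_mult _ _ _ _ _
      (hol_plus _ _ _ _ _ (hol_id y0) (hol_const (- y0)%C y0))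
      (hol_plus _ _ _ _ _ (hol_const Ci y0) HF))).
  + rewrite Rminus_diag. ring.
  + intros y Hy. generalize (Rmin_l d e) (Rmin_r d e). intros G1 G2.
    destruct (HFmu y) as [Q1 Q2]. lra.
    split; [|split].
    * rewrite Q1, RtoC_minus. easy.
    * replace (Im (p + RtoC (y - y0) * (Ci + mu y))%C) with (Im p + (y - y0))
        by (simpl; unfold Im; simpl; ring).
      unfold y0. ring.
    * assert (Q3 : Nf (F y) y = RtoC (Re (Nf (F y) y))).
      { apply C_ext. easy. change (Im (Nf (F y) y) = 0).
        rewrite Q1. exact Q2. }
      exists (Re (Nf (F y) y)). split.
      -- specialize (Ke y ltac:(lra)). rewrite N0, Q3, <- RtoC_minus, Cmod_R in Ke.
         set (nu := Re _) in *.
         apply Rabs_def2 in Ke. unfold Rabs in Ke. destruct Rcase_abs; nra.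
      -- rewrite RtoC_mult, <- Q3. unfold Nf. rewrite RtoC_pow.
         replace (p + RtoC (y - y0) * (Ci + mu y) - p)%C with
           (RtoC (y - y0) * (Ci + mu y))%C by ring.
         rewrite Cpow_mult_l, Q1. unfold zt. rewrite RtoC_minus. ring.
Qed.

(** * Analytic parametrizations *)

Definition arc_chart (g : R -> C) (t : R) : Prop :=
  exists (F F' : C -> C) (d : R), 0 < d /\ hol F F' t /\
  forall s, Rabs (s - t) < d -> g s = F s.

Lemma chart_analytic g t : arc_chart g t -> analytic_at g t.
Proof. intros [F [F' [d [Hd [HF H]]]]]. exact (hol_analytic g t F F' d HF Hd H). Qed.

Lemma chart_Cdiff g t : arc_chart g t -> Cdiff g t.
Proof.
intros [F [F' [d [Hd [HF H]]]]]. exists (F' t).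
apply (Cderiv_ext_loc (fun s => F (RtoC s)) g t _ d Hd).
intros s Hs. symmetry. now apply H. now apply hol_RtoC.
Qed.

Lemma chart_value (g : R -> C) t (F : C -> C) d : 0 < d -> (forall s, Rabs (s - t) < d -> g s = F (RtoC s)) ->
  g t = F (RtoC t).
Proof. intros Hd H. apply H. rewrite Rminus_diag, Rabs_R0. easy. Qed.

Lemma chart_hol f f' g t : hol f f' (g t) -> arc_chart g t ->
  arc_chart (fun s => f (g s)) t.
Proof.
intros Hf [F [F' [d [Hd [HF H]]]]].
rewrite (chart_value g t F d Hd H) in Hf.
eexists (fun z => f (F z)), _, d. split. easy. split.
exact (hol_comp f f' F F' t Hf HF).
intros s Hs. now rewrite H.
Qed.

Lemma chart_affine g (a k t : R) : arc_chart g (a + k * t) ->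
  arc_chart (fun s => g (a + k * s)) t.
Proof.
intros [F [F' [d [Hd [HF H]]]]].
assert (Hk : 0 < Rabs k + 1) by (generalize (Rabs_pos k); lra).
eexists (fun z => F (a + z * k)%C), _, (d / (Rabs k + 1)).
split. now apply Rdiv_lt_0_compat. split.
- refine (hol_comp F F' (fun z => a + z * k)%C _ t _ (hol_affine a k t)).
  replace (a + t * k)%C with (RtoC (a + k * t)). easy.
  rewrite RtoC_plus, RtoC_mult. ring.
- intros s Hs. rewrite H. f_equal. rewrite RtoC_plus, RtoC_mult. ring.
  replace (a + k * s - (a + k * t)) with (k * (s - t)) by ring.
  rewrite Rabs_mult.
  assert (Rabs (s - t) * (Rabs k + 1) < d).
  { apply Rlt_le_trans with (d / (Rabs k + 1) * (Rabs k + 1)).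
    now apply Rmult_lt_compat_r. right. field. lra. }
  generalize (Rabs_pos (s - t)). lra.
Qed.

Lemma chart_conj g t : arc_chart g t -> arc_chart (fun s => Cconj (g s)) t.
Proof.
intros [F [F' [d [Hd [HF H]]]]].
eexists (fun z => Cconj (F (Cconj z))), _, d. split. easy. split.
- apply (hol_conj F F'). now rewrite Cconj_R.
- intros s Hs. now rewrite H, Cconj_R.
Qed.

Lemma chart_opp g t : arc_chart g t -> arc_chart (fun s => - g s)%C t.
Proof.
intros H. apply (chart_hol Copp (fun _ => - (1))%C g t). 2: easy.
eapply hol_eq. 3: apply (hol_affine 0 (- (1))).
all: intros; simpl; ring.
Qed.

(** The holomorphic extension of [M] has a continuous derivative, which must be [h]. *)
Lemma chart_deriv_continuous M h (t d : R) : 0 < d -> arc_chart M t ->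
  (forall s, Rabs (s - t) < d -> Cderiv M s (h s)) ->
  continuous (U := CR) h t.
Proof.
intros Hd [F [F' [e [He [HF H]]]]] Hh.
destruct (hol_shift _ _ _ HF) as [e' [He' HFs]].
assert (Hm : 0 < Rmin d (Rmin (e / 2) e')) by (repeat apply Rmin_pos; lra).
apply (continuous_ext_loc (T := R_UniformSpace) (U := CR) h
  (fun s => F' (RtoC s))).
- exists (mkposreal _ Hm). intros s Hs.
  change (Rabs (s - t) < Rmin d (Rmin (e / 2) e')) in Hs.
  generalize (Rmin_l d (Rmin (e / 2) e')) (Rmin_r d (Rmin (e / 2) e'))
    (Rmin_l (e / 2) e') (Rmin_r (e / 2) e'). intros.
  rewrite <- (Cderiv_path M s (h s)) by (apply Hh; lra).
  symmetry. apply Cderiv_path.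
  apply (Cderiv_ext_loc (fun s => F (RtoC s)) M s _ (e / 2)). lra.
  + intros s' Hs'. symmetry. apply H.
    replace (s' - t) with ((s' - s) + (s - t)) by ring.
    eapply Rle_lt_trans. apply Rabs_triang. lra.
  + apply hol_RtoC, HFs. rewrite <- RtoC_minus, Cmod_R. lra.
- apply (hol_deriv_continuous F F' RtoC). easy.
  exists 1%C. eapply Cderiv_ext. 2: apply (Cderiv_line 0 1). intros s. simpl. ring.
Qed.

Lemma imaginary_of_charts (q : C -> C) (g w M : R -> C) (l0 l1 : C) (r : R) :
  (forall t, 0 < t < 1 -> arc_chart w t /\ (w t * w t)%C = q (g t)) ->
  (forall t, 0 < t < 1 -> arc_chart M t) ->
  (forall t, 0 < t < 1 -> Cderiv M t (w t * path_derive g t)%C) ->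
  lim_right M 0 l0 -> lim_left M 1 l1 ->
  Re l0 = r -> Re l1 = r -> (forall t, 0 < t < 1 -> Re (M t) = r) ->
  imaginary_sqrt_integral q g.
Proof.
intros Hw HM HD L0 L1 R0 R1 RM.
assert (Hc : forall t, 0 < t < 1 ->
  continuous (U := CR) (fun s => (w s * path_derive g s)%C) t).
{ intros t Ht. apply (chart_deriv_continuous M _ t (Rmin t (1 - t))).
  apply Rmin_pos; lra. now apply HM.
  intros s Hs. apply HD. generalize (Rmin_l t (1 - t)) (Rmin_r t (1 - t)).
  apply Rabs_def2 in Hs. lra. }
exists w. split.
{ intros t Ht. destruct (Hw t Ht). split. now apply chart_analytic. easy. }
intros t Ht.
assert (HI : forall a b, 0 < a -> a < b -> b < t ->
  is_RInt (V := CR) (fun s => (w s * path_derive g s)%C) a b (M b - M a)%C).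
{ intros a b Ha Hab Hb. apply is_RInt_C_derive. lra.
  intros x Hx. apply HD. lra. intros x Hx. apply Hc. lra. }
assert (Hl : exists l, lim_left M t l /\ Re l = r).
{ destruct Ht as [Ht0 [Ht1|Ht1]].
  - exists (M t). split. eapply Cderiv_lim_left. apply HD. lra. apply RM. lra.
  - subst t. now exists l1. }
destruct Hl as [l [Hl1 Hl2]].
exists (l - l0)%C. split.
- apply (improper_intro _ M); easy.
- rewrite Re_sub. lra.
Qed.

(** * Reflection *)

Lemma Cderiv_flip g t l : Cderiv g (1 - t) l ->
  Cderiv (fun s => refl_im (g (1 - s))) t (Cconj l).
Proof.
rewrite !Cderiv_eps. intros H eps Heps. destruct (H eps Heps) as [d [Hd K]].
exists d. split. easy. intros s Hs.
assert (E : 1 - s - (1 - t) = - (s - t)) by ring.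
specialize (K (1 - s)). rewrite E, Rabs_Ropp in K. specialize (K Hs).
eapply Rle_trans. 2: exact K. right. rewrite <- Cmod_opp, <- Cmod_conj.
f_equal. unfold refl_im.
apply injective_projections; simpl; ring.
Qed.

Lemma chart_flip g t : arc_chart g (1 - t) ->
  arc_chart (fun s => refl_im (g (1 - s))) t.
Proof.
intros H. apply (chart_opp (fun s => Cconj (g (1 - s)))), chart_conj.
assert (E : forall s, 1 - s = 1 + (-1) * s) by (intros; ring).
rewrite E in H. apply chart_affine in H.
destruct H as [F [F' [d [Hd [HF K]]]]]. exists F, F', d.
split. easy. split. easy. intros s Hs. rewrite E. now apply K.
Qed.

Lemma refl_im_opp z : refl_im (- z)%C = Cconj z.
Proof. apply injective_projections; unfold refl_im; simpl; ring. Qed.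

Lemma refl_im_dist u v : Cmod (refl_im u - refl_im v)%C = Cmod (u - v)%C.
Proof.
rewrite <- (Cmod_conj (u - v)), <- Cmod_opp. f_equal. unfold refl_im.
apply injective_projections; simpl; ring.
Qed.

(** Under reflection the primitive [M t] becomes [- conj (M (1 - t))]. *)
Lemma imaginary_refl (q : C -> C) (g w M : R -> C) (l0 l1 : C) (r : R) :
  (forall z, q (refl_im z) = Cconj (q z)) ->
  (forall t, 0 < t < 1 -> arc_chart w t /\ (w t * w t)%C = q (g t)) ->
  (forall t, 0 < t < 1 -> Cdiff g t) ->
  (forall t, 0 < t < 1 -> arc_chart M t) ->
  (forall t, 0 < t < 1 -> Cderiv M t (w t * path_derive g t)%C) ->
  lim_right M 0 l0 -> lim_left M 1 l1 ->
  Re l0 = r -> Re l1 = r -> (forall t, 0 < t < 1 -> Re (M t) = r) ->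
  imaginary_sqrt_integral q (fun t => refl_im (g (1 - t))).
Proof.
intros Hq Hw Hg HM HD L0 L1 R0 R1 RM.
assert (Hre : forall z, Re (refl_im z) = - Re z) by easy.
apply (imaginary_of_charts q _ (fun t => Cconj (w (1 - t)))
  (fun t => refl_im (M (1 - t))) (refl_im l1) (refl_im l0) (- r)).
- intros t Ht. destruct (Hw (1 - t) ltac:(lra)) as [H1 H2]. split.
  + apply chart_opp in H1. apply (chart_flip (fun s => - w s)%C t) in H1.
    destruct H1 as [F [F' [d [Hd [HF K]]]]]. exists F, F', d.
    split. easy. split. easy. intros s Hs. rewrite <- K by easy.
    now rewrite refl_im_opp.
  + now rewrite Hq, <- H2, Cconj_mul.
- intros t Ht. apply chart_flip, HM. lra.
- intros t Ht. destruct (Hg (1 - t) ltac:(lra)) as [l Hl].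
  assert (K := HD (1 - t) ltac:(lra)). rewrite (Cderiv_path _ _ _ Hl) in K.
  rewrite (Cderiv_path _ _ _ (Cderiv_flip _ _ _ Hl)).
  rewrite <- Cconj_mul. now apply Cderiv_flip.
- intros eps Heps. destruct (L1 eps Heps) as [d [Hd K]].
  exists d. split. easy. intros s Hs.
  rewrite refl_im_dist. apply K. lra.
- intros eps Heps. destruct (L0 eps Heps) as [d [Hd K]].
  exists d. split. easy. intros s Hs.
  rewrite refl_im_dist. apply K. lra.
- rewrite Hre. lra.
- rewrite Hre. lra.
- intros t Ht. rewrite Hre, RM; lra.
Qed.

Lemma point_before_1 (al d : R) : al < 1 -> 0 < d ->
  exists s, al < s < 1 /\ Rabs (s - 1) < d.
Proof.
intros Hal Hd. exists (1 - Rmin d (1 - al) / 2).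
assert (0 < Rmin d (1 - al)) by (apply Rmin_pos; lra).
generalize (Rmin_l d (1 - al)) (Rmin_r d (1 - al)). intros.
split. lra. apply Rabs_def1; lra.
Qed.

(** * Purely imaginary integrals along an arc *)

Lemma derive_left_sign (f : R -> R) (al l : R) : al < 1 -> is_derive f 1 l ->
  f 1 = 0 -> (forall t, al < t < 1 -> f t <= 0) -> 0 <= l.
Proof.
intros Hal Hf H1 Hneg. apply Rnot_lt_le. intros Hl.
rewrite is_derive_eps in Hf. destruct (Hf (- l / 2)) as [d [Hd K]]. lra.
destruct (point_before_1 al d Hal Hd) as [s [Hs Hsd]].
specialize (K s Hsd). rewrite H1, (Rabs_left (s - 1)) in K by lra.
apply Rabs_le_between in K. specialize (Hneg s Hs). nra.
Qed.

(** The branch [w] is [Psi] along the arc up to a sign, so [Re Phi] is a primitive of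
the real part of the integrand up to this sign. *)
Lemma imaginary_along (q : C -> C) (g w : R -> C) (Phi Psi Psi' : C -> C) al be :
  0 <= al -> be <= 1 -> sqrt_branch q g w ->
  (forall t, 0 < t <= 1 -> exists l, is_path_integral g w t l /\ Re l = 0) ->
  (forall t, 0 < t < 1 -> Cdiff g t) ->
  (forall t, 0 < t < 1 -> w t <> 0%C) ->
  (forall t, al < t < be -> hol Phi Psi (g t) /\ hol Psi Psi' (g t) /\
     (Psi (g t) * Psi (g t))%C = q (g t)) ->
  forall t1 t2, al < t1 < be -> al < t2 < be ->
  Re (Phi (g t1)) = Re (Phi (g t2)).
Proof.
intros Hal Hbe Hw Hint Hg Hw0 HP.
destruct (branch_sign (fun t => Psi (g t)) w al be) as [e [He Hs]].
- intros t Ht. destruct (HP t Ht) as [_ [P2 _]].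
  eapply Cdiff_hol. exact P2. apply Hg. lra.
- intros t Ht. apply analytic_Cderiv, Hw. lra.
- intros t Ht. destruct (HP t Ht) as [_ [_ ->]]. symmetry. apply Hw. lra.
- intros t Ht. apply Hw0. lra.
- assert (K := imaginary_primitive_const (fun s => (w s * path_derive g s)%C)
    (fun t => e * Re (Phi (g t))) al be Hal Hbe Hint).
  assert (HN : forall t, al < t < be -> is_derive (fun t => e * Re (Phi (g t))) t
     (Re (w t * path_derive g t)%C)).
  { intros t Ht. destruct (Hg t ltac:(lra)) as [l Hl].
    destruct (HP t Ht) as [P1 _].
    assert (D := proj1 (Cderiv_hol _ _ _ _ _ P1 Hl)).
    rewrite (Hs t Ht) in D. rewrite (Cderiv_path _ _ _ Hl).
    apply (is_derive_scal _ t e) in D.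
    replace (Re (w t * l)%C) with (e * Re (e * w t * l)%C). exact D.
    simpl. unfold Re, Im. destruct He as [->| ->]; ring. }
  intros t1 t2 H1 H2. specialize (K HN t1 t2 H1 H2). cbv beta in K.
  destruct He as [->| ->]; lra.
Qed.

Lemma Cinv_neq_0 (z : C) : z <> 0%C -> (/ z)%C <> 0%C.
Proof.
intros Hz. apply Cmod_gt_0. rewrite Cmod_inv by easy.
apply Rinv_0_lt_compat. now apply Cmod_gt_0.
Qed.

(** * The quadratic differential on the half strip *)

Section Differential.

Variables b x : R.
Hypothesis Hb : 0 < b.
Hypothesis Hx0 : 0 < x.
Hypothesis Hx1 : x < 1.

Definition zs : C := (x, b).

(** The function [Q] for [lambda = 2 / b]. *)
Definition qd (z : C) : C :=
  (RtoC (- / (b * b)) * ((z - zs) * (z + Cconj zs) * / (z * z - 1)))%C.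

Definition strip (z : C) : Prop := 0 < Re z /\ 0 < Im z < b.

(** The equation of the circle through [1], [-1] and the two zeros of [qd], negative
inside. *)
Definition circle_form (a y : R) : R :=
  b * (a ^ 2 + y ^ 2 - 1) - y * (x ^ 2 + b ^ 2 - 1).

Lemma strip_convex : convex strip.
Proof.
intros z w t [Hz1 [Hz2 Hz3]] [Hw1 [Hw2 Hw3]] Ht. unfold strip.
replace (Re (z + t * (w - z))%C) with ((1 - t) * Re z + t * Re w)
  by (simpl; unfold Re; simpl; ring).
replace (Im (z + t * (w - z))%C) with ((1 - t) * Im z + t * Im w)
  by (simpl; unfold Im; simpl; ring).
destruct (Rlt_dec 0 t) as [h|h].
- assert (0 < t * Re w) by nra. assert (0 <= (1 - t) * Re z) by nra.
  assert (0 < t * Im w) by nra. assert (0 <= (1 - t) * Im z) by nra.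
  assert (t * Im w < t * b) by nra.
  assert ((1 - t) * Im z <= (1 - t) * b) by nra. lra.
- replace t with 0 by lra. lra.
Qed.

Lemma strip_open z : strip z -> exists e, 0 < e /\
  forall w, Cmod (w - z)%C < e -> strip w.
Proof.
intros [H1 [H2 H3]].
exists (Rmin (Re z) (Rmin (Im z) (b - Im z))). split.
{ repeat apply Rmin_pos; lra. }
intros w Hw.
generalize (Rmin_l (Re z) (Rmin (Im z) (b - Im z)))
  (Rmin_r (Re z) (Rmin (Im z) (b - Im z))) (Rmin_l (Im z) (b - Im z))
  (Rmin_r (Im z) (b - Im z)). intros.
assert (A := re_le_Cmod (w - z)). assert (B := im_le_Cmod (w - z)).
rewrite Re_sub in A. rewrite Im_sub in B.
apply Rabs_le_between in A, B. unfold strip. lra.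
Qed.

Lemma strip_pole z : strip z -> (z * z - 1)%C <> 0%C.
Proof.
intros [H1 [H2 H3]] E. apply (f_equal Im) in E. simpl in E.
unfold Re, Im in *. nra.
Qed.

Lemma qd_parts a y : ((a, y) * (a, y) - 1)%C <> 0%C ->
  exists D, 0 < D /\
  Im (qd (a, y)) = 2 * a * circle_form a y / D /\
  Re (qd (a, y)) = - ((a ^ 2 - (y - b) ^ 2 - x ^ 2) * (a ^ 2 - y ^ 2 - 1)
     + 4 * a ^ 2 * y * (y - b)) / D.
Proof.
intros H.
assert (HD : 0 < (a ^ 2 - y ^ 2 - 1) ^ 2 + (2 * a * y) ^ 2).
{ assert (K : Cmod ((a, y) * (a, y) - 1) ^ 2 =
    (a ^ 2 - y ^ 2 - 1) ^ 2 + (2 * a * y) ^ 2).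
  { rewrite Cmod2_alt. simpl. ring. }
  apply Cmod_gt_0 in H. rewrite <- K. nra. }
exists (b ^ 2 * ((a ^ 2 - y ^ 2 - 1) ^ 2 + (2 * a * y) ^ 2)).
assert (0 < b ^ 2) by nra.
split; [nra|].
assert (N : (a * a - y * y + - (1)) * ((a * a - y * y + - (1)) * 1) +
   (a * y + y * a + - 0) * ((a * y + y * a + - 0) * 1) <> 0).
{ apply Rgt_not_eq. nra. }
split; unfold qd, zs, circle_form; simpl.
- field. repeat split; try lra; nra.
- field. repeat split; try lra; nra.
Qed.

(** On the circle, with centre [i c], the numerator of [Re (qd z)] becomes
[4 y (b - y) (a^2 + (y - c)^2)]. *)
Lemma circle_sign z : strip z ->
  (0 <= circle_form (Re z) (Im z) -> 0 <= Im (qd z)) /\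
  (circle_form (Re z) (Im z) <= 0 -> Im (qd z) <= 0) /\
  (Im (qd z) = 0 -> 0 < Re (qd z)).
Proof.
intros Hz. assert (Hp := strip_pole z Hz). destruct z as [a y].
destruct Hz as [H1 [H2 H3]]. simpl in H1, H2, H3.
change (Re (a, y)) with a. change (Im (a, y)) with y.
destruct (qd_parts a y Hp) as [D [HD [EI ER]]].
rewrite EI, ER. split; [|split]; intros H.
- apply Rdiv_le_0_compat; nra.
- assert (0 <= 2 * a * - circle_form a y / D) by (apply Rdiv_le_0_compat; nra).
  unfold Rdiv in *. lra.
- assert (E : circle_form a y = 0).
  { assert (K : 2 * a * circle_form a y / D * D = 0) by (rewrite H; ring).
    unfold Rdiv in K. rewrite Rmult_assoc, Rinv_l in K by lra. nra. }
  apply Rdiv_lt_0_compat. 2: easy.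
  unfold circle_form in E.
  set (c := (x ^ 2 + b ^ 2 - 1) / (2 * b)).
  assert (Ec : x ^ 2 = 1 - b ^ 2 + 2 * b * c) by (unfold c; field; lra).
  assert (Ea : a ^ 2 = 1 - y ^ 2 + 2 * c * y).
  { apply Rmult_eq_reg_l with b. 2: lra. rewrite Ec in E. lra. }
  replace (- ((a ^ 2 - (y - b) ^ 2 - x ^ 2) * (a ^ 2 - y ^ 2 - 1) +
    4 * a ^ 2 * y * (y - b))) with (4 * (y * (b - y)) * (a ^ 2 + (y - c) ^ 2)).
  2:{ rewrite Ec, Ea. ring. }
  assert (0 < a ^ 2) by nra. assert (0 <= (y - c) ^ 2) by apply pow2_ge_0.
  assert (0 < y * (b - y)) by nra. nra.
Qed.

(** The principal root is the right branch on the half strip by [circle_sign]. *)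
Definition sq (z : C) : C := csqrt (qd z).

Lemma sq_sqr z : (sq z * sq z)%C = qd z.
Proof. apply csqrt_sqr. Qed.

Lemma sq_re z : strip z -> 0 < Re (sq z).
Proof. intros Hz. apply csqrt_re_pos. apply (circle_sign z Hz). Qed.

Lemma sq_neq z : strip z -> sq z <> 0%C.
Proof. intros Hz E. assert (K := sq_re z Hz). rewrite E in K. simpl in K. lra. Qed.

Lemma sq_im z : strip z ->
  (0 <= circle_form (Re z) (Im z) -> 0 <= Im (sq z)) /\
  (circle_form (Re z) (Im z) <= 0 -> Im (sq z) <= 0).
Proof.
intros Hz. destruct (csqrt_im (qd z) (sq_re z Hz)).
destruct (circle_sign z Hz) as [? [? _]]. split; auto.
Qed.

Lemma hol_qd : exists q', forall z, (z * z - 1)%C <> 0%C -> hol qd q' z.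
Proof.
eexists. intros z Hz.
exact (hol_mult _ _ _ _ z (hol_const (RtoC (- / (b * b))) z)
  (hol_mult _ _ _ _ z
    (hol_mult _ _ _ _ z (hol_plus _ _ _ _ z (hol_id z) (hol_const (- zs)%C z))
      (hol_plus _ _ _ _ z (hol_id z) (hol_const (Cconj zs) z)))
    (hol_comp Cinv _ (fun z => z * z - 1)%C _ z (hol_inv _ Hz)
      (hol_plus _ _ _ _ z (hol_mult _ _ _ _ z (hol_id z) (hol_id z))
         (hol_const (- (1))%C z))))).
Qed.

Lemma hol_sq : exists s', forall z, strip z -> hol sq s' z.
Proof.
destruct hol_qd as [q' Hq]. eexists. intros z Hz.
exact (hol_comp csqrt _ qd _ z (hol_csqrt _ (sq_re z Hz)) (Hq z (strip_pole z Hz))).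
Qed.

Lemma spoke_strip p z s : strip p -> strip z -> 0 <= s <= 1 -> strip (spoke p z s).
Proof.
intros Hp Hz Hs. unfold spoke. rewrite <- RtoC_mult. apply strip_convex; try easy.
nra.
Qed.

Definition sq_primitive (p z : C) : C := ((z - p) * spoke_int 1 p sq z)%C.

Lemma hol_sq_primitive p z : strip p -> strip z -> hol (sq_primitive p) sq z.
Proof.
intros Hp Hz. destruct hol_sq as [s' Hs].
destruct (strip_open z Hz) as [e [He Hw]].
eapply (hol_loc _ _ _ _ z e He).
2: exact (hol_mult _ _ _ _ z
  (hol_plus _ _ _ _ z (hol_id z) (hol_const (- p)%C z))
  (hol_spoke_int 1 p sq s' z (fun s Hs01 => Hs _ (spoke_strip p z s Hp Hz Hs01)))).
intros w Hwz. split. easy. cbv beta.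
rewrite <- (spoke_int_ode 1 p sq s' w).
2:{ intros s Hs01. apply Hs. apply spoke_strip; auto. }
replace (RtoC (INR 2) / 2)%C with (RtoC 1) by (simpl; rewrite RtoC_plus; field).
ring.
Qed.

Definition base : C := (x, b / 2).

Lemma strip_base : strip base.
Proof. unfold strip, base; simpl; lra. Qed.

Definition phi : C -> C := sq_primitive base.

Lemma hol_phi z : strip z -> hol phi sq z.
Proof. apply hol_sq_primitive, strip_base. Qed.

Lemma spoke_center p s : spoke p p s = p.
Proof. unfold spoke. ring. Qed.

Lemma spoke_int_center j p T T' : hol T T' p ->
  (spoke_int j p T p * spoke_int j p T p =
   (RtoC (2 / INR (S j)) * T p) * (RtoC (2 / INR (S j)) * T p))%C.
Proof.
intros HT. assert (0 < INR (S j)) by (apply lt_0_INR; lia).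
assert (E : spoke_int j p T p = (RtoC (2 / INR (S j)) * T p)%C).
{ rewrite <- (spoke_int_ode j p T T' p).
  - rewrite RtoC_div by lra. field. intros K. apply RtoC_inj in K. lra.
  - intros s Hs. now rewrite spoke_center. }
now rewrite E.
Qed.

Lemma imaginary_of_sqr (u : C) (r : R) : (u * u)%C = RtoC r -> r <= 0 -> Re u = 0.
Proof.
intros E Hr. assert (E1 := f_equal Re E). assert (E2 := f_equal Im E).
simpl in E1, E2. unfold Re, Im in *. simpl in *.
assert (E3 : fst u * snd u = 0) by lra.
apply Rmult_integral in E3. destruct E3 as [E3|E3]. easy.
rewrite E3 in E1. nra.
Qed.

(** * Local form of the level curves *)

(** [k = j + 1] is one, two or three at a pole, a regular point or a zero of [qd]. *)
Definition expansion (p c : C) (j : nat) (T : C -> C) (delta : R) : Prop :=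
  0 < delta /\ exists T' : C -> C,
  (forall z, Cmod (z - p)%C < delta -> hol T T' z) /\
  forall z, strip z -> Cmod (z - p)%C < delta ->
   ((phi z - c) * (phi z - c) =
     (z - p) ^ S j * (spoke_int j p T z * spoke_int j p T z))%C.

(** Along the curve of [analytic_graph], [(phi - c)^2] is real with the sign of
[(y - Im p) ^ (j + 1) * r0]; where this is negative, [phi - c] is imaginary. *)
Lemma level_arc (p c : C) j T delta (m0 r0 : R) :
  expansion p c j T delta -> 0 < Re p -> r0 <> 0 ->
  ((Ci + m0) ^ S j * ((RtoC (2 / INR (S j)) * T p) *
    (RtoC (2 / INR (S j)) * T p)))%C = RtoC r0 ->
  exists (G : R -> C) (F F' : C -> C) (d : R), 0 < d /\ hol F F' (Im p) /\
  G (Im p) = p /\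
  forall y, Rabs (y - Im p) < d -> F y = G y /\ Im (G y) = y /\
    (0 < y < b -> (y - Im p) ^ S j * r0 < 0 ->
     strip (G y) /\ Re (phi (G y)) = Re c).
Proof.
intros [Hdelta [T' [HT Hexp]]] Hp Hr0 Hm0.
assert (HTp : forall s, 0 <= s <= 1 -> hol T T' (spoke p p s)).
{ intros s _. apply HT. now rewrite spoke_center, Cmod_diag. }
assert (HE := hol_spoke_int j p T T' p HTp).
rewrite <- (spoke_int_center j p T T') in Hm0.
2:{ apply HT. now rewrite Cmod_diag. }
destruct (analytic_graph _ _ p j m0 r0 HE Hr0 Hm0)
  as [G [F [F' [d [Hd [HF [HG0 HG]]]]]]].
destruct (Cderiv_cont _ _ _ (hol_RtoC _ _ _ HF) (Rmin delta (Re p)))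
  as [e [He Ke]].
{ now apply Rmin_pos. }
exists G, F, F', (Rmin d e). split. now apply Rmin_pos. split. easy. split. easy.
intros y Hy. generalize (Rmin_l d e) (Rmin_r d e). intros M1 M2.
destruct (HG y) as [Q1 [Q2 [nu [Q3 Q4]]]]. lra.
split. easy. split. easy. intros Hy0 Hneg.
assert (F0 : F (RtoC (Im p)) = p).
{ destruct (HG (Im p)) as [Q _]. rewrite Rminus_diag, Rabs_R0. easy.
  now rewrite Q. }
specialize (Ke y ltac:(lra)). rewrite F0, Q1 in Ke.
generalize (Rmin_l delta (Re p)) (Rmin_r delta (Re p)). intros M3 M4.
assert (Hs : strip (G y)).
{ split. 2: now rewrite Q2.
  assert (A := re_le_Cmod (G y - p)). rewrite Re_sub in A.
  apply Rabs_le_between in A. lra. }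
split. easy.
assert (Ex := Hexp (G y) Hs ltac:(lra)). rewrite Q4 in Ex.
assert (K := imaginary_of_sqr _ _ Ex). rewrite Re_sub in K.
enough ((y - Im p) ^ S j * nu <= 0) by (specialize (K H); lra).
set (u := (y - Im p) ^ S j) in *.
apply Rnot_lt_le. intros h. clear - Hneg Q3 h.
destruct (Rtotal_order r0 0) as [h1|[h1|h1]]; nra.
Qed.

(** This is [(z - 1) * qd z]. *)
Definition pole_factor (z : C) : C :=
  (RtoC (- / (b * b)) * ((z - zs) * (z + Cconj zs) * / (z + 1)))%C.

(** This is [qd z / (z - zs)]. *)
Definition zero_factor (z : C) : C :=
  (RtoC (- / (b * b)) * ((z + Cconj zs) * / (z * z - 1)))%C.

Lemma one_expansion : exists c T delta, expansion 1 c 0 T delta /\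
  (T 1 * T 1 = pole_factor 1)%C /\
  forall z, Cmod (z - 1)%C < delta ->
    (qd z * (z - 1) ^ 2 = (z - 1) ^ 1 * (T z * T z))%C.
Proof.
assert (Hr : exists r', forall z, (z + 1)%C <> 0%C -> hol pole_factor r' z).
{ eexists. intros z Hz.
  exact (hol_mult _ _ _ _ z (hol_const (RtoC (- / (b * b))) z)
  (hol_mult _ _ _ _ z
    (hol_mult _ _ _ _ z (hol_plus _ _ _ _ z (hol_id z) (hol_const (- zs)%C z))
      (hol_plus _ _ _ _ z (hol_id z) (hol_const (Cconj zs) z)))
    (hol_comp Cinv _ (fun z => z + 1)%C _ z (hol_inv _ Hz)
      (hol_plus _ _ _ _ z (hol_id z) (hol_const 1%C z))))). }
destruct Hr as [r' Hr].
assert (N1 : forall z, Cmod (z - 1)%C < 1 -> (z + 1)%C <> 0%C).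
{ intros z Hz E. assert (A := re_le_Cmod (z - 1)). rewrite Re_sub in A.
  apply Rabs_le_between in A. apply (f_equal Re) in E.
  change (Re z + 1 = 0) in E. change (Re 1) with 1 in A. lra. }
destruct (local_sqrt pole_factor r' 1 1 Rlt_0_1 (fun z Hz => Hr z (N1 z Hz)))
  as [T [T' [d [Hd [Hd1 HT]]]]].
{ unfold pole_factor. assert (b * b <> 0) by nra.
  repeat apply Cmult_neq_0.
  - intros E. apply RtoC_inj in E. assert (0 < / (b * b)).
    apply Rinv_0_lt_compat. nra. lra.
  - intros E. apply (f_equal Im) in E. simpl in E. lra.
  - intros E. apply (f_equal Re) in E. simpl in E. lra.
  - apply Cinv_neq_0. apply N1.
    rewrite Cmod_diag. lra. }
assert (Hq : forall z, Cmod (z - 1)%C < d ->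
    (qd z * (z - 1) ^ 2 = (z - 1) ^ 1 * (T z * T z))%C).
{ intros z Hz. destruct (HT z Hz) as [_ ->].
  assert (z + 1 <> 0)%C by (apply N1; lra).
  destruct (classic ((z - 1)%C = 0%C)) as [E|E].
  - rewrite E. simpl. ring.
  - unfold qd, pole_factor. replace (z * z - 1)%C with ((z - 1) * (z + 1))%C by ring.
    field. easy. }
destruct hol_sq as [s' Hs].
destruct (endpoint_expansion strip qd phi sq s' 1 Ci 0 T T' d) as [c Hc].
- apply strip_convex.
- apply hol_phi.
- apply Hs.
- intros z _. apply sq_sqr.
- apply sq_neq.
- intros E. apply (f_equal Im) in E. simpl in E. lra.
- easy.
- intros z [_ [H _]]. unfold half_plane.
  replace (Re ((z - 1) * Cconj Ci)%C) with (Im z).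
  easy. simpl. unfold Im. simpl. ring.
- intros z Hz. now apply HT.
- intros z _ Hz. now apply Hq.
- exists c, T, d. split; [|split].
  + split. easy. exists T'. split. intros z Hz. now apply HT. easy.
  + apply HT. now rewrite Cmod_diag.
  + easy.
Qed.

Lemma zs_pole : (zs * zs - 1)%C <> 0%C.
Proof.
intros E. apply (f_equal Im) in E. simpl in E. nra.
Qed.

Lemma zs_expansion : exists c T delta, expansion zs c 2 T delta /\
  (T zs * T zs = zero_factor zs)%C.
Proof.
assert (Hr : exists r', forall z, (z * z - 1)%C <> 0%C -> hol zero_factor r' z).
{ eexists. intros z Hz.
  exact (hol_mult _ _ _ _ z (hol_const (RtoC (- / (b * b))) z)
  (hol_mult _ _ _ _ z
      (hol_plus _ _ _ _ z (hol_id z) (hol_const (Cconj zs) z))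
    (hol_comp Cinv _ (fun z => z * z - 1)%C _ z (hol_inv _ Hz)
      (hol_plus _ _ _ _ z (hol_mult _ _ _ _ z (hol_id z) (hol_id z))
         (hol_const (- (1))%C z))))). }
destruct Hr as [r' Hr].
assert (N1 : forall z, Cmod (z - zs)%C < Rmin x b -> (z * z - 1)%C <> 0%C).
{ intros z Hz E. generalize (Rmin_l x b) (Rmin_r x b). intros.
  assert (A := re_le_Cmod (z - zs)). rewrite Re_sub in A.
  assert (B := im_le_Cmod (z - zs)). rewrite Im_sub in B.
  apply Rabs_le_between in A, B.
  change (Re zs) with x in A. change (Im zs) with b in B.
  apply (f_equal Im) in E. simpl in E. unfold Re, Im in *. nra. }
destruct (local_sqrt zero_factor r' zs (Rmin x b) (Rmin_pos _ _ Hx0 Hb)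
   (fun z Hz => Hr z (N1 z Hz)))
  as [T [T' [d [Hd [Hd1 HT]]]]].
{ unfold zero_factor. assert (b * b <> 0) by nra.
  repeat apply Cmult_neq_0.
  - intros E. apply RtoC_inj in E. assert (0 < / (b * b)).
    apply Rinv_0_lt_compat. nra. lra.
  - intros E. apply (f_equal Re) in E. simpl in E. lra.
  - apply Cinv_neq_0. apply zs_pole. }
destruct hol_sq as [s' Hs].
destruct (endpoint_expansion strip qd phi sq s' zs (- Ci)%C 2 T T' d) as [c Hc].
- apply strip_convex.
- apply hol_phi.
- apply Hs.
- intros z _. apply sq_sqr.
- apply sq_neq.
- intros E. apply (f_equal Im) in E. simpl in E. lra.
- easy.
- intros z [_ [_ H]]. unfold half_plane.
  replace (Re ((z - zs) * Cconj (- Ci))%C) with (b - Im z).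
  lra. simpl. unfold Im. simpl. ring.
- intros z Hz. now apply HT.
- intros z Hz1 Hz2. destruct (HT z Hz2) as [_ ->].
  assert (Hp := strip_pole z Hz1).
  unfold qd, zero_factor. simpl Cpow. field. easy.
- exists c, T, d. split.
  + split. easy. exists T'. split. intros z Hz. now apply HT. easy.
  + apply HT. now rewrite Cmod_diag.
Qed.

Lemma inner_expansion p : strip p -> exists delta, expansion p (phi p) 1 sq delta.
Proof.
intros Hp. destruct (strip_open p Hp) as [e [He Hw]].
destruct hol_sq as [s' Hs].
exists e. split. easy. exists s'. split. intros z Hz. now apply Hs, Hw.
intros z Hz _.
assert (E : (phi z + (- (1)) * sq_primitive p z = phi p + (- (1)) * sq_primitive p p)%C).
{ apply (hol_zero_const strip (fun z => phi z + (- (1)) * sq_primitive p z)%C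
    (fun z => sq z + (0 * sq_primitive p z + (- (1)) * sq z))%C); try easy.
  - apply strip_convex.
  - intros w Hw'. apply hol_plus. now apply hol_phi.
    exact (hol_mult _ _ _ _ w (hol_const (- (1))%C w) (hol_sq_primitive p w Hp Hw')).
  - intros w Hw'. ring. }
assert (E2 : sq_primitive p p = 0%C) by (unfold sq_primitive; ring).
rewrite E2 in E.
replace (phi z - phi p)%C with (sq_primitive p z).
unfold sq_primitive. simpl Cpow. ring.
replace (phi z) with (phi z + (- (1)) * sq_primitive p z + sq_primitive p z)%C by ring.
rewrite E. ring.
Qed.

(** * The level set as a graph *)

Lemma Cderiv_horizontal y t : Cderiv (fun s => (s, y)) t 1.
Proof. split; simpl; auto_derive; easy. Qed.

Lemma Cderiv_vertical a t : Cderiv (fun s => (a, s)) t Ci.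
Proof. split; simpl; auto_derive; easy. Qed.

Lemma derive_re_phi g t l : Cderiv g t l -> strip (g t) ->
  is_derive (fun s => Re (phi (g s))) t (Re (sq (g t) * l)%C).
Proof. intros Hg Hs. apply (Cderiv_hol phi sq g t l (hol_phi _ Hs) Hg). Qed.

Lemma re_phi_horizontal y a1 a2 : 0 < y < b -> 0 < a1 -> a1 < a2 ->
  Re (phi (a1, y)) < Re (phi (a2, y)).
Proof.
intros Hy Ha Ha12.
assert (Hs : forall t, a1 <= t <= a2 -> strip (t, y)).
{ intros t Ht. split; simpl; lra. }
destruct (mean_value (fun s => Re (phi (s, y)))
  (fun s => Re (sq (s, y) * 1)%C) a1 a2 Ha12) as [c [Hc E]].
- intros t Ht. apply (derive_re_phi (fun s => (s, y)) t 1).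
  apply Cderiv_horizontal. now apply Hs.
- assert (K := sq_re _ (Hs c Hc)).
  replace (sq (c, y) * 1)%C with (sq (c, y)) in E by ring. nra.
Qed.

Lemma re_phi_vertical a y1 y2 : 0 < a -> 0 < y1 -> y1 < y2 -> y2 < b ->
  ((forall y, 0 < y < b -> 0 <= circle_form a y) ->
     Re (phi (a, y2)) <= Re (phi (a, y1))) /\
  ((forall y, 0 < y < b -> circle_form a y <= 0) ->
     Re (phi (a, y1)) <= Re (phi (a, y2))).
Proof.
intros Ha Hy1 Hy12 Hy2.
assert (Hs : forall t, y1 <= t <= y2 -> strip (a, t)).
{ intros t Ht. split; simpl; lra. }
destruct (mean_value (fun s => Re (phi (a, s)))
  (fun s => Re (sq (a, s) * Ci)%C) y1 y2 Hy12) as [c [Hc E]].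
- intros t Ht. apply (derive_re_phi (fun s => (a, s)) t Ci).
  apply Cderiv_vertical. now apply Hs.
- destruct (sq_im _ (Hs c Hc)) as [K1 K2].
  replace (Re (sq (a, c) * Ci)%C) with (- Im (sq (a, c))) in E
    by (simpl; unfold Im; ring).
  change (Re (a, c)) with a in K1, K2. change (Im (a, c)) with c in K1, K2.
  split; intros H; specialize (H c ltac:(lra)).
  + specialize (K1 H). nra.
  + specialize (K2 H). nra.
Qed.

Lemma expansion_lim p c j T delta : expansion p c j T delta ->
  forall eps, 0 < eps -> exists d, 0 < d /\ forall z, strip z ->
    Cmod (z - p)%C < d -> Cmod (phi z - c)%C < eps.
Proof.
intros [Hdelta [T' [HT Hexp]]].
eapply expansion_limit. 2: exact Hdelta. 2: exact Hexp.
apply (hol_spoke_int j p T T'). intros s _. apply HT. now rewrite spoke_center, Cmod_diag.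
Qed.

(** The vertical lines [Re z = 1 + x + b] and [Re z = x / 2] lie outside and inside
the circle. On them [re_phi_vertical] compares the height [y] with heights
close to [b], where [re_phi_horizontal] compares with the vertical line through
[zs], on which [Re phi] tends to [Re c]. *)
Lemma level_exists c T delta y : expansion zs c 2 T delta -> 0 < y < b ->
  exists a, 0 < a /\ Re (phi (a, y)) = Re c.
Proof.
intros Hexp Hy.
assert (Hlim : forall eps, 0 < eps -> exists y', y < y' < b /\
  Rabs (Re (phi (x, y')) - Re c) < eps).
{ intros eps Heps. destruct (expansion_lim _ _ _ _ _ Hexp eps Heps)
    as [d [Hd K]].
  set (m := Rmin d (b - y)).
  assert (0 < m /\ m <= d /\ m <= b - y) as [Hm [Hm1 Hm2]].
  { unfold m. split. apply Rmin_pos; lra. split. apply Rmin_l. apply Rmin_r. }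
  exists (b - m / 2). split. lra.
  eapply Rle_lt_trans. rewrite <- Re_sub. apply re_le_Cmod.
  apply K. split; simpl; lra.
  replace ((x, (b - m / 2)%R) - zs)%C with (- (Ci * RtoC (m / 2)))%C.
  rewrite Cmod_opp, Cmod_mult, Cmod_Ci, Cmod_R, Rabs_pos_eq by lra.
  lra.
  apply injective_projections; simpl; field. }
set (A := 1 + x + b).
assert (HA : forall t, 0 < t < b -> 0 <= circle_form A t).
{ intros t Ht. unfold circle_form, A.
  assert (0 <= x * b) by nra. assert (0 <= b * t ^ 2) by nra.
  assert (t * (x ^ 2 + b ^ 2) <= b * (x ^ 2 + b ^ 2))
    by (apply Rmult_le_compat_r; nra).
  assert (0 <= b * (2 * x + 2 * b + 2 * (x * b)))
    by (apply Rmult_le_pos; lra).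
  lra. }
assert (Hx2 : forall t, 0 < t < b -> circle_form (x / 2) t <= 0).
{ intros t Ht. unfold circle_form.
  assert (0 <= b * t * (b - t)) by (apply Rmult_le_pos; nra).
  assert (t * (1 - x ^ 2) <= b * (1 - x ^ 2)) by (apply Rmult_le_compat_r; nra).
  nra. }
(* a smaller value at height [y] would persist up to heights close to [b] *)
assert (Hup : Re c <= Re (phi (A, y))).
{ apply Rnot_lt_le. intros h.
  destruct (Hlim (Re c - Re (phi (A, y)))) as [y' [Hy' K]]. lra.
  apply Rabs_def2 in K.
  assert (Q := proj1 (re_phi_vertical A y y' ltac:(unfold A; lra) ltac:(lra)
    ltac:(lra) ltac:(lra)) HA).
  assert (Q2 := re_phi_horizontal y' x A ltac:(lra) Hx0 ltac:(unfold A; lra)).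
  lra. }
assert (Hlo : Re (phi (x / 2, y)) <= Re c).
{ apply Rnot_lt_le. intros h.
  destruct (Hlim (Re (phi (x / 2, y)) - Re c)) as [y' [Hy' K]]. lra.
  apply Rabs_def2 in K.
  assert (Q := proj2 (re_phi_vertical (x / 2) y y' ltac:(lra) ltac:(lra)
    ltac:(lra) ltac:(lra)) Hx2).
  assert (Q2 := re_phi_horizontal y' (x / 2) x ltac:(lra) ltac:(lra) ltac:(lra)).
  lra. }
destruct (IVT_interv (fun a => Re (phi (a, y)) - Re c) (x / 4) (A + 1))
  as [a [Ha1 Ha2]].
- intros a Ha. apply continuity_pt_minus.
  eapply derive_cont. apply (derive_re_phi (fun s => (s, y)) a 1).
  apply Cderiv_horizontal. split; simpl; lra.
  apply continuity_pt_const. intros u v. easy.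
- unfold A. lra.
- assert (K := re_phi_horizontal y (x / 4) (x / 2) Hy ltac:(lra) ltac:(lra)). lra.
- assert (K := re_phi_horizontal y A (A + 1) Hy ltac:(unfold A; lra) ltac:(lra)).
  lra.
- exists a. split; lra.
Qed.

(** Here [(i + m0)] must be a negative multiple of the conjugate of
[pole_factor 1]; its real part is minus the height of the centre of the circle. *)
Lemma arc_at_one c T delta : expansion 1 c 0 T delta -> (T 1 * T 1 = pole_factor 1)%C ->
  exists (G : R -> C) (F F' : C -> C) (d : R), 0 < d /\ hol F F' 0 /\
  G 0 = RtoC 1 /\
  forall y, Rabs (y - 0) < d -> F y = G y /\ Im (G y) = y /\
    (0 < y < b -> strip (G y) /\ Re (phi (G y)) = Re c).
Proof.
intros Hexp HT.
set (u := 1 - x ^ 2 - b ^ 2).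
assert (Hr0 : - (u ^ 2 + 4 * b ^ 2) / b ^ 3 < 0).
{ assert (0 < (u ^ 2 + 4 * b ^ 2) / b ^ 3).
  apply Rdiv_lt_0_compat. nra. apply pow_lt. lra.
  unfold Rdiv in *. lra. }
destruct (level_arc 1 c 0 T delta (u / (2 * b)) _ Hexp Rlt_0_1
  (Rlt_not_eq _ _ Hr0)) as [G [F [F' [d [Hd [HF [HG0 HG]]]]]]].
- replace ((Ci + RtoC (u / (2 * b))) ^ 1 * (RtoC (2 / INR 1) * T 1 *
    (RtoC (2 / INR 1) * T 1)))%C with
    (RtoC 4 * (Ci + RtoC (u / (2 * b))) * (T 1 * T 1))%C.
  2:{ simpl INR. replace (2 / 1) with 2 by field.
      replace 4 with (2 * 2) by ring. rewrite RtoC_mult. simpl Cpow. ring. }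
  rewrite HT. unfold pole_factor, zs, u.
  apply injective_projections; simpl; field; lra.
- exists G, F, F', d. split. easy. split. exact HF. split. exact HG0.
  intros y Hy. destruct (HG y Hy) as [Q1 [Q2 Q3]]. split. easy. split. easy.
  intros Hyb. apply Q3. easy. change (Im 1) with 0.
  set (r0 := - (u ^ 2 + 4 * b ^ 2) / b ^ 3) in *. simpl. nra.
Qed.

(** Three trajectories leave a simple zero, at equal angles; this is the one that
leaves downwards. Comparing real and imaginary parts of [(i + m)^3] leads to a
cubic in [m] that changes sign on the interval [3 m^2 < 1]. *)
Lemma cubic_direction : exists m rho, 0 < rho /\
  ((Ci + RtoC m) ^ 3 = - (RtoC rho * (zs * zs - 1)))%C.
Proof.
set (s := / sqrt 3).
assert (S3 : 0 < sqrt 3) by (apply sqrt_lt_R0; lra).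
assert (Hs : 0 < s) by now apply Rinv_0_lt_compat.
assert (Hs2 : s * s = / 3).
{ unfold s. rewrite <- Rinv_mult, sqrt_sqrt by lra. easy. }
set (k := x ^ 2 - b ^ 2 - 1).
(* [P m = 0] makes [(i + m)^3] a real multiple of [zs^2 - 1] *)
set (P := fun m => (3 * m - m ^ 3) * (2 * x * b) + (3 * (m * m) - 1) * k).
assert (Hxb : 0 < 2 * x * b) by nra.
assert (P1 : P s = s * (8 / 3) * (2 * x * b)).
{ unfold P. replace (s ^ 3) with (s * (s * s)) by ring. rewrite Hs2. field. }
assert (P2 : P (- s) = - (s * (8 / 3) * (2 * x * b))).
{ unfold P. replace (- s * - s) with (s * s) by ring.
  replace ((- s) ^ 3) with (- (s * (s * s))) by ring. rewrite Hs2. field. }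
destruct (IVT_interv P (- s) s) as [m [Hm Pm]].
- intros a _. unfold P. reg.
- lra.
- rewrite P2. nra.
- rewrite P1. nra.
- assert (Hm2 : 3 * (m * m) < 1).
  { assert (m <> s). { intros ->. rewrite P1 in Pm. nra. }
    assert (m <> - s). { intros ->. rewrite P2 in Pm. nra. }
    nra. }
  exists m, ((1 - 3 * (m * m)) / (2 * x * b)). split.
  apply Rdiv_lt_0_compat; lra.
  unfold zs. unfold P, k in Pm.
  apply injective_projections; simpl.
  + apply Rmult_eq_reg_r with (2 * x * b). 2: lra.
    field_simplify. nra. nra.
  + field. split; lra.
Qed.

(** The trajectory is approached with [y < b], so the odd power of [y - b] is negative
and [r0] has to be positive. *)
Lemma arc_at_zs c T delta : expansion zs c 2 T delta -> (T zs * T zs = zero_factor zs)%C ->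
  exists (G : R -> C) (F F' : C -> C) (d : R), 0 < d /\ hol F F' b /\
  G b = zs /\
  forall y, Rabs (y - b) < d -> F y = G y /\ Im (G y) = y /\
    (0 < y < b -> strip (G y) /\ Re (phi (G y)) = Re c).
Proof.
intros Hexp HT.
destruct cubic_direction as [m [rho [Hrho Hm]]].
assert (Hr0 : 0 < 8 * x * rho / (9 * (b * b))).
{ apply Rdiv_lt_0_compat. repeat apply Rmult_lt_0_compat; lra. nra. }
destruct (level_arc zs c 2 T delta m _ Hexp Hx0
  (Rgt_not_eq _ _ Hr0)) as [G [F [F' [d [Hd [HF [HG0 HG]]]]]]].
- rewrite Hm.
  replace (INR 3) with 3 by (simpl; ring).
  replace (RtoC (2 / 3) * T zs * (RtoC (2 / 3) * T zs))%C with
    (RtoC (4 / 9) * (T zs * T zs))%C.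
  2:{ replace (4 / 9) with (2 / 3 * (2 / 3)) by field. rewrite RtoC_mult. ring. }
  rewrite HT. unfold zero_factor.
  replace (zs + Cconj zs)%C with (RtoC (2 * x))
    by (apply injective_projections; simpl; ring).
  replace (- (RtoC rho * (zs * zs - 1)) * (RtoC (4 / 9) * (RtoC (- / (b * b)) *
    (RtoC (2 * x) * / (zs * zs - 1)))))%C with
    (- (RtoC rho * (RtoC (4 / 9) * (RtoC (- / (b * b)) * RtoC (2 * x)))))%C
    by (field; apply zs_pole).
  rewrite <- !RtoC_mult, <- RtoC_opp. f_equal. field. lra.
- exists G, F, F', d. split. easy. split. exact HF. split. exact HG0.
  intros y Hy. destruct (HG y Hy) as [Q1 [Q2 Q3]]. split. easy. split. easy.
  intros Hyb. apply Q3. easy. change (Im zs) with b.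
  set (r0 := 8 * x * rho / (9 * (b * b))) in *. simpl.
  assert (0 < (b - y) * (b - y)) by nra.
  assert (0 < (b - y) * ((b - y) * (b - y))) by nra. nra.
Qed.

(** The tangent slope [m0] makes [(i + m0) * sq p] imaginary. *)
Lemma arc_inside p : strip p ->
  exists (G : R -> C) (F F' : C -> C) (d : R), 0 < d /\ hol F F' (Im p) /\
  G (Im p) = p /\
  forall y, Rabs (y - Im p) < d -> F y = G y /\ Im (G y) = y /\
    (0 < y < b -> strip (G y) /\ Re (phi (G y)) = Re (phi p)).
Proof.
intros Hp. destruct (inner_expansion p Hp) as [delta Hexp].
assert (Hre := sq_re p Hp).
set (u := Re (sq p)) in *. set (v := Im (sq p)).
assert (Ep : sq p = (u, v)) by now apply C_ext.
assert (Hr0 : - (u + v ^ 2 / u) ^ 2 < 0).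
{ assert (0 <= v ^ 2 / u) by (apply Rdiv_le_0_compat; nra). nra. }
destruct (level_arc p (phi p) 1 sq delta (v / u) _ Hexp (proj1 Hp)
  (Rlt_not_eq _ _ Hr0)) as [G [F [F' [d [Hd [HF [HG0 HG]]]]]]].
- rewrite Ep. simpl INR. replace (2 / (1 + 1)) with 1 by field.
  apply injective_projections; simpl; field; lra.
- exists G, F, F', d. split. easy. split. exact HF. split. exact HG0.
  intros y Hy. destruct (HG y Hy) as [Q1 [Q2 Q3]]. split. easy. split. easy.
  intros Hyb.
  destruct (Req_dec y (Im p)) as [->|Hne].
  + rewrite HG0. easy.
  + apply Q3. easy. set (r0 := - (u + v ^ 2 / u) ^ 2) in *. simpl.
    assert (0 < (y - Im p) * (y - Im p)) by nra. nra.
Qed.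

(** The local arcs consist of points of the level set, which meets each horizontal
line once; hence they are pieces of the graph. *)
Lemma level_graph c1 T1 d1 c3 T3 d3 :
  expansion 1 c1 0 T1 d1 -> (T1 1 * T1 1 = pole_factor 1)%C ->
  expansion zs c3 2 T3 d3 -> (T3 zs * T3 zs = zero_factor zs)%C -> Re c1 = Re c3 ->
  exists Gam : R -> C, Gam 0 = RtoC 1 /\ Gam b = zs /\
  (forall y, 0 < y < b -> strip (Gam y) /\ Re (phi (Gam y)) = Re c1) /\
  (forall y, 0 <= y <= b -> exists (F F' : C -> C) d, 0 < d /\ hol F F' y /\
     forall s, Rabs (s - y) < d -> Gam s = F s /\ Im (Gam s) = s).
Proof.
intros He1 HT1 He3 HT3 Hc.
destruct (arc_at_one _ _ _ He1 HT1) as [G1 [F1 [F1' [e1 [Hp1 [HF1 [HG1 H1]]]]]]].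
destruct (arc_at_zs _ _ _ He3 HT3) as [G3 [F3 [F3' [e3 [Hp3 [HF3 [HG3 H3]]]]]]].
assert (Hch : forall y, exists a, 0 < y < b -> 0 < a /\ Re (phi (a, y)) = Re c3).
{ intros y. destruct (classic (0 < y < b)) as [Hy|Hy].
  - destruct (level_exists _ _ _ y He3 Hy) as [a Ha]. now exists a.
  - exists 0. tauto. }
destruct (functional_choice _ Hch) as [X HX].
assert (Huniq : forall y z, 0 < y < b -> strip z -> Im z = y ->
  Re (phi z) = Re c3 -> z = (X y, y)).
{ intros y [a y'] Hy Hz Ey Ez. simpl in Ey. subst y'. f_equal.
  destruct (HX y Hy) as [Xp Xe].
  destruct Hz as [Ha _]. simpl in Ha.
  destruct (Rtotal_order a (X y)) as [h|[h|h]]. 2: easy.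
  - assert (K := re_phi_horizontal y _ _ Hy Ha h). lra.
  - assert (K := re_phi_horizontal y _ _ Hy Xp h). lra. }
set (Gam := fun y => if Rle_dec y 0 then G1 y else if Rle_dec b y then G3 y
   else (X y, y)).
assert (Gin : forall y, 0 < y < b -> Gam y = (X y, y)).
{ intros y Hy. unfold Gam. destruct Rle_dec; [lra|]. destruct Rle_dec; [lra|easy]. }
assert (Glo : forall y, y <= 0 -> Gam y = G1 y).
{ intros y Hy. unfold Gam. destruct Rle_dec; [easy|lra]. }
assert (Ghi : forall y, b <= y -> Gam y = G3 y).
{ intros y Hy. unfold Gam. destruct Rle_dec; [lra|].
  destruct Rle_dec; [easy|lra]. }
exists Gam. split. rewrite Glo; [easy|lra]. split. rewrite Ghi; [easy|lra].
assert (HGam : forall y, 0 < y < b ->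
   strip (Gam y) /\ Re (phi (Gam y)) = Re c1).
{ intros y Hy. rewrite Gin by easy. destruct (HX y Hy). rewrite Hc.
  split. split; simpl; lra. easy. }
split. easy.
intros y Hy.
destruct (Req_dec y 0) as [->|Hy0]; [|destruct (Req_dec y b) as [->|Hyb]].
- exists F1, F1', (Rmin e1 b). split. now apply Rmin_pos. split. easy.
  intros s Hs. generalize (Rmin_l e1 b) (Rmin_r e1 b). intros.
  destruct (H1 s) as [Q1 [Q2 Q3]]. lra.
  assert (E : Gam s = G1 s).
  { destruct (Rle_dec s 0) as [h|h]. now apply Glo.
    apply Rabs_def2 in Hs. assert (Hsb : 0 < s < b) by lra.
    rewrite Gin by easy. symmetry. destruct (Q3 Hsb).
    apply Huniq; try easy. lra. }
  rewrite E. now split.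
- exists F3, F3', (Rmin e3 b). split. now apply Rmin_pos. split. easy.
  intros s Hs. generalize (Rmin_l e3 b) (Rmin_r e3 b). intros.
  destruct (H3 s) as [Q1 [Q2 Q3]]. lra.
  assert (E : Gam s = G3 s).
  { destruct (Rle_dec b s) as [h|h]. now apply Ghi.
    apply Rabs_def2 in Hs. assert (Hsb : 0 < s < b) by lra.
    rewrite Gin by easy. symmetry. destruct (Q3 Hsb). now apply Huniq. }
  rewrite E. now split.
- assert (Hy' : 0 < y < b) by lra.
  destruct (HGam y Hy') as [Hs1 Hs2].
  destruct (arc_inside (Gam y) Hs1) as [G [F [F' [e [He [HF [HG0 HG]]]]]]].
  assert (Ei : Im (Gam y) = y) by now rewrite Gin.
  rewrite Ei in *.
  exists F, F', (Rmin e (Rmin y (b - y))).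
  split. repeat apply Rmin_pos; lra. split. easy.
  intros s Hs. generalize (Rmin_l e (Rmin y (b - y))) (Rmin_r e (Rmin y (b - y)))
   (Rmin_l y (b - y)) (Rmin_r y (b - y)). intros.
  destruct (HG s) as [Q1 [Q2 Q3]]. lra.
  apply Rabs_def2 in Hs. assert (Hsb : 0 < s < b) by lra.
  destruct (Q3 Hsb) as [Q4 Q5].
  rewrite Gin by easy. rewrite <- (Huniq s (G s)); try easy. lra.
Qed.

(** * The level of the endpoints *)

Lemma limit_along g a p c j T delta : expansion p c j T delta ->
  Cdiff g a -> g a = p ->
  forall eps, 0 < eps -> exists d, 0 < d /\
  forall s, Rabs (s - a) < d -> strip (g s) -> Cmod (phi (g s) - c)%C < eps.
Proof.
intros He [l Hl] Hga eps Heps.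
destruct (expansion_lim _ _ _ _ _ He eps Heps) as [d [Hd K]].
destruct (Cderiv_cont _ _ _ Hl d Hd) as [e [Hepos Ke]].
exists e. split. easy. intros s Hs Hst. apply K. easy.
rewrite <- Hga. now apply Ke.
Qed.

Lemma limits_along g c1 T1 d1 c3 T3 d3 :
  expansion 1 c1 0 T1 d1 -> expansion zs c3 2 T3 d3 ->
  (forall t, 0 <= t <= 1 -> Cdiff g t) ->
  (forall t, 0 < t < 1 -> strip (g t)) -> g 0 = zs -> g 1 = RtoC 1 ->
  lim_right (fun t => phi (g t)) 0 c3 /\ lim_left (fun t => phi (g t)) 1 c1.
Proof.
intros He1 He3 Hg Hs H0 H1. split; intros eps Heps.
- destruct (limit_along g 0 _ _ _ _ _ He3 (Hg 0 ltac:(lra)) H0 eps Heps)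
    as [d [Hd K]].
  exists (Rmin d 1). split. apply Rmin_pos; lra. intros s Hs'.
  generalize (Rmin_l d 1) (Rmin_r d 1). intros.
  apply K. apply Rabs_def1; lra. apply Hs. lra.
- destruct (limit_along g 1 _ _ _ _ _ He1 (Hg 1 ltac:(lra)) H1 eps Heps)
    as [d [Hd K]].
  exists (Rmin d 1). split. apply Rmin_pos; lra. intros s Hs'.
  generalize (Rmin_l d 1) (Rmin_r d 1). intros.
  apply K. apply Rabs_def1; lra. apply Hs. lra.
Qed.

(** The open segment from [zs] to [1] lies in the strip, so the integral that
defines [x_star] is the difference of the limits of [phi], up to sign. *)
Lemma equal_levels c1 T1 d1 c3 T3 d3 w l :
  expansion 1 c1 0 T1 d1 -> expansion zs c3 2 T3 d3 ->
  sqrt_branch qd (segment_path zs 1) w ->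
  is_path_integral (segment_path zs 1) w 1 l -> Re l = 0 -> Re c1 = Re c3.
Proof.
intros He1 He3 Hw Hl Rl. set (g := segment_path zs 1) in *.
assert (Hg : forall t, Cderiv g t (1 - zs)%C).
{ intros t. eapply Cderiv_ext. 2: apply (Cderiv_line zs (1 - zs)%C).
  intros s. unfold g, segment_path. ring. }
assert (Hs : forall t, 0 < t < 1 -> strip (g t)).
{ intros t Ht. unfold g, segment_path, zs. split; simpl; nra. }
assert (Hpd : forall s, path_derive g s = (1 - zs)%C)
  by (intros s; now apply Cderiv_path).
destruct (hol_sq ) as [s' Hs'].
destruct (branch_sign (fun t => sq (g t)) w 0 1) as [e [He Hse]].
- intros t Ht. eapply Cdiff_hol. apply Hs', Hs, Ht. now exists (1 - zs)%C.
- intros t Ht. apply analytic_Cderiv, Hw, Ht.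
- intros t Ht. rewrite sq_sqr. symmetry. apply Hw, Ht.
- intros t Ht E. apply (sq_neq (g t) (Hs t Ht)).
  apply Cmod_eq_0. assert (K := sq_sqr (g t)).
  rewrite <- (proj2 (Hw t Ht)), E in K. apply (f_equal Cmod) in K.
  replace (0 * 0)%C with (RtoC 0) in K by ring. rewrite Cmod_mult, Cmod_0 in K.
  nra.
- assert (He2 := sign_sqr e He).
  assert (Hws : forall t, 0 < t < 1 -> w t = (e * sq (g t))%C).
  { intros t Ht. rewrite Hse by easy.
    replace (e * (e * w t))%C with ((e * e) * w t)%C by ring. rewrite He2. ring. }
  destruct (limits_along g c1 T1 d1 c3 T3 d3 He1 He3) as [L0 L1].
  { intros t _. now exists (1 - zs)%C. }
  { easy. }
  { unfold g, segment_path. ring. }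
  { unfold g, segment_path. ring. }
  assert (Hmul : forall u v : C, Cmod (e * u - e * v)%C = Cmod (u - v)%C).
  { intros u v. replace (e * u - e * v)%C with (e * (u - v))%C by ring.
    rewrite Cmod_mult, Cmod_R.
    replace (Rabs e) with 1. ring.
    destruct He as [->| ->]; [rewrite Rabs_R1|rewrite Rabs_left]; lra. }
  assert (E : l = (e * c1 - e * c3)%C).
  { apply (improper_value (fun s => (w s * path_derive g s)%C)
      (fun t => (e * phi (g t))%C) 1); try easy. lra.
    - intros a a' Ha Haa' Ha'.
      apply (is_RInt_C_derive (fun t => (e * phi (g t))%C)). lra.
      + intros t Ht. rewrite Hpd, Hws by lra.
        replace (e * sq (g t) * (1 - zs))%C with
         ((0 * phi (g t) + e * sq (g t)) * (1 - zs))%C by ring.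
        apply (Cderiv_hol (fun z => e * phi z)%C
          (fun z => 0 * phi z + e * sq z)%C). 2: apply Hg.
        apply (hol_mult _ _ _ _ _ (hol_const (RtoC e) _)).
        apply (hol_phi ). apply Hs. lra.
      + intros t Ht.
        apply (continuous_ext (fun s => ((1 - zs) * w s)%C)).
        { intros s. rewrite Hpd. apply (Cmult_comm (1 - zs)%C (w s)). }
        apply continuous_Cmul, Cdiff_continuous, analytic_Cderiv, Hw. lra.
    - intros eps Heps. destruct (L0 eps Heps) as [d [Hd K]].
      exists d. split. easy. intros s Hs0. rewrite Hmul. now apply K.
    - intros eps Heps. destruct (L1 eps Heps) as [d [Hd K]].
      exists d. split. easy. intros s Hs0. rewrite Hmul. now apply K. }
  rewrite E in Rl.
  replace (Re (e * c1 - e * c3)%C) with (e * (Re c1 - Re c3)) in Rl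
    by (simpl; unfold Re; simpl; ring).
  destruct He as [->| ->]; lra.
Qed.

(** * The trajectory *)

Section Trajectory.

Variables (c1 c3 : C) (T1 T3 : C -> C) (d1 d3 : R).
Hypothesis He1 : expansion 1 c1 0 T1 d1.
Hypothesis HT1 : (T1 1 * T1 1 = pole_factor 1)%C.
Hypothesis Hq1 : forall z, Cmod (z - 1)%C < d1 ->
  (qd z * (z - 1) ^ 2 = (z - 1) ^ 1 * (T1 z * T1 z))%C.
Hypothesis He3 : expansion zs c3 2 T3 d3.
Variable Gam : R -> C.
Hypothesis HG0 : Gam 0 = RtoC 1.
Hypothesis HGb : Gam b = zs.
Hypothesis HGs : forall y, 0 < y < b ->
  strip (Gam y) /\ Re (phi (Gam y)) = Re c1.
Hypothesis HGF : forall y, 0 <= y <= b ->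
  exists (F F' : C -> C) d, 0 < d /\ hol F F' y /\
     forall s, Rabs (s - y) < d -> Gam s = F s /\ Im (Gam s) = s.

Definition traj (t : R) : C := Gam (b + (- b) * t).

Lemma Gam_im y : 0 <= y <= b -> Im (Gam y) = y.
Proof.
intros Hy. destruct (HGF y Hy) as [F [F' [d [Hd [HF H]]]]]. apply H.
rewrite Rminus_diag, Rabs_R0. easy.
Qed.

Lemma Gam_chart y : 0 <= y <= b -> arc_chart Gam y.
Proof.
intros Hy. destruct (HGF y Hy) as [F [F' [d [Hd [HF H]]]]].
exists F, F', d. split. easy. split. easy. apply H.
Qed.

Lemma traj_chart t : 0 <= t <= 1 -> arc_chart traj t.
Proof. intros Ht. apply chart_affine, Gam_chart. nra. Qed.

Lemma traj_strip t : 0 < t < 1 -> strip (traj t) /\ Re (phi (traj t)) = Re c1.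
Proof. intros Ht. apply HGs. nra. Qed.

Lemma traj_im_derive t : 0 <= t <= 1 -> exists l, Cderiv traj t l /\ Im l = - b.
Proof.
intros Ht. destruct (chart_Cdiff _ _ (traj_chart t Ht)) as [l Hl].
exists l. split. easy.
destruct (HGF (b + - b * t)) as [F [F' [d [Hd [_ H]]]]]. nra.
rewrite <- (is_derive_unique (fun s => Im (traj s)) t (Im l) (proj2 Hl)).
apply is_derive_unique.
apply (is_derive_ext_loc (fun s => b + - b * s)).
- assert (Hp : 0 < d / b) by now apply Rdiv_lt_0_compat.
  exists (mkposreal _ Hp). intros s Hs. change (Rabs (s - t) < d / b) in Hs.
  symmetry. apply H.
  replace (b + - b * s - (b + - b * t)) with (- (b * (s - t))) by ring.
  rewrite Rabs_Ropp, Rabs_mult, (Rabs_pos_eq b) by lra.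
  apply Rmult_lt_reg_r with (/ b). now apply Rinv_0_lt_compat.
  replace (b * Rabs (s - t) * / b) with (Rabs (s - t)) by (field; lra). exact Hs.
- auto_derive. easy. ring.
Qed.

Lemma traj_0 : traj 0 = zs.
Proof. unfold traj. now replace (b + - b * 0) with b by ring. Qed.

Lemma traj_1 : traj 1 = RtoC 1.
Proof. unfold traj. now replace (b + - b * 1) with 0 by ring. Qed.

Lemma traj_arc_param : is_analytic_arc_param traj.
Proof.
split; [|split].
- intros t Ht. now apply chart_analytic, traj_chart.
- intros t Ht E. destruct (traj_im_derive t Ht) as [l [Hl Il]].
  rewrite (Cderiv_path _ _ _ Hl) in E. rewrite E in Il. simpl in Il. lra.
- intros s t Hs Ht E. apply (f_equal Im) in E. unfold traj in E.
  rewrite !Gam_im in E by nra. nra.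
Qed.

Lemma traj_data :
  (forall t, 0 < t < 1 -> arc_chart (fun t => sq (traj t)) t /\
     (sq (traj t) * sq (traj t))%C = qd (traj t)) /\
  (forall t, 0 < t < 1 -> Cdiff traj t) /\
  (forall t, 0 < t < 1 -> arc_chart (fun t => phi (traj t)) t) /\
  (forall t, 0 < t < 1 -> Cderiv (fun t => phi (traj t)) t
     (sq (traj t) * path_derive traj t)%C) /\
  lim_right (fun t => phi (traj t)) 0 c3 /\ lim_left (fun t => phi (traj t)) 1 c1.
Proof.
destruct (hol_sq ) as [s' Hs'].
split; [|split; [|split; [|split]]].
- intros t Ht. split. 2: apply sq_sqr.
  eapply chart_hol. apply Hs', traj_strip, Ht. apply traj_chart. lra.
- intros t Ht. apply chart_Cdiff, traj_chart. lra.
- intros t Ht. eapply chart_hol. apply (hol_phi ), traj_strip, Ht.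
  apply traj_chart. lra.
- intros t Ht. destruct (traj_im_derive t ltac:(lra)) as [l [Hl _]].
  rewrite (Cderiv_path _ _ _ Hl). apply Cderiv_hol. 2: easy.
  apply (hol_phi ), traj_strip, Ht.
- apply (limits_along traj c1 T1 d1 c3 T3 d3 He1 He3).
  + intros t Ht. now apply chart_Cdiff, traj_chart.
  + intros t Ht. now apply traj_strip.
  + apply traj_0.
  + apply traj_1.
Qed.

Lemma level_unique z : strip z -> Re (phi z) = Re c1 -> z = Gam (Im z).
Proof.
intros Hz Ez. destruct (HGs (Im z) (proj2 Hz)) as [Hs Es].
assert (Ei : Im (Gam (Im z)) = Im z) by (apply Gam_im; destruct Hz; lra).
destruct z as [a y]. destruct (Gam (Im (a, y))) as [a' y'] eqn:E.
simpl in Ei. subst y'. f_equal.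
destruct Hz as [Ha Hy]. destruct Hs as [Ha' _]. simpl in Ha, Hy, Ha'.
destruct (Rtotal_order a a') as [h|[h|h]]. 2: easy.
- assert (K := re_phi_horizontal y _ _ Hy Ha h). lra.
- assert (K := re_phi_horizontal y _ _ Hy Ha' h). lra.
Qed.

(** * Uniqueness *)

Variables (A : C -> Prop) (g w : R -> C).
Hypothesis HA : forall z, A z -> 0 < Re z.
Hypothesis Hg : analytic_arc A zs 1 g.
Hypothesis Hw : sqrt_branch qd g w.
Hypothesis Hint : forall t, 0 < t <= 1 ->
  exists l, is_path_integral g w t l /\ Re l = 0.

Lemma arc_Cdiff t : 0 <= t <= 1 -> Cdiff g t.
Proof. intros Ht. apply analytic_Cderiv. now apply Hg. Qed.

Lemma arc_re t : 0 <= t <= 1 -> 0 < Re (g t).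
Proof. intros Ht. apply HA. apply Hg. now exists t. Qed.

Lemma arc_ends : g 0 = zs /\ g 1 = RtoC 1.
Proof. destruct Hg as [_ [H0 [H1 _]]]. now split. Qed.

Lemma arc_inj s t : 0 <= s <= 1 -> 0 <= t <= 1 -> g s = g t -> s = t.
Proof. apply Hg. Qed.

Lemma branch_neq t : 0 < t < 1 -> w t <> 0%C.
Proof.
intros Ht E. destruct (Hw t Ht) as [_ K]. rewrite E in K.
replace (0 * 0)%C with (RtoC 0) in K by ring. symmetry in K. revert K.
destruct arc_ends as [E0 E1].
assert (Hre := arc_re t ltac:(lra)).
unfold qd. repeat apply Cmult_neq_0.
- intros K. apply RtoC_inj in K. assert (0 < / (b * b)).
  apply Rinv_0_lt_compat. nra. lra.
- intros K. assert (t = 0); [|lra]. apply arc_inj; try lra.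
  rewrite E0. replace (g t) with ((g t - zs) + zs)%C by ring. rewrite K. ring.
- intros K. apply (f_equal Re) in K.
  change (Re (g t) + x = 0) in K. lra.
- apply Cinv_neq_0. replace (g t * g t - 1)%C with ((g t - 1) * (g t + 1))%C by ring.
  apply Cmult_neq_0.
  + intros K. assert (t = 1); [|lra]. apply arc_inj; try lra.
    rewrite E1. replace (g t) with ((g t - 1) + 1)%C by ring. rewrite K. ring.
  + intros K. apply (f_equal Re) in K. change (Re (g t) + 1 = 0) in K. lra.
Qed.

Lemma arc_near t eps : 0 <= t <= 1 -> 0 < eps -> exists d, 0 < d /\
  forall s, Rabs (s - t) < d -> Cmod (g s - g t)%C < eps.
Proof.
intros Ht Heps. destruct (arc_Cdiff t Ht) as [l Hl].
exact (Cderiv_cont _ _ _ Hl eps Heps).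
Qed.

(** On the half plane around the direction [- l] from which the arc arrives,
[root_primitive] gives a primitive whose real part vanishes along the arc. Its
square [(z - 1) * E z ^ 2] is then real and nonpositive along the arc, and its
derivative at the end shows that [l * pole_factor 1] is real and nonnegative. *)
Lemma arrival_direction l : Cderiv g 1 l -> Im l < 0.
Proof.
intros Hl. destruct arc_ends as [_ E1].
set (E := spoke_int 0 1 T1).
destruct He1 as [Hd1 [T1' [HT1' _]]].
assert (Hl0 : l <> 0%C).
{ rewrite <- (Cderiv_path _ _ _ Hl). apply Hg. lra. }
assert (HE : hol E (spoke_int 2 1 T1') 1).
{ apply hol_spoke_int. intros s _. apply HT1'. now rewrite spoke_center, Cmod_diag. }
assert (Hml : (- l)%C <> 0%C).
{ intros K. apply Hl0. replace l with (- (- l))%C by ring. rewrite K. ring. }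
destruct (root_primitive qd 1 (- l)%C 0 T1 T1' d1 Hml Hd1 HT1')
  as [Phi [Psi [Psi' HP]]].
(* as the arc has derivative [l] at [1], it ends inside this half plane *)
assert (Hal : exists al, 0 <= al < 1 /\ forall t, al < t < 1 ->
   Cmod (g t - 1)%C < d1 /\ half_plane 1 (- l) (g t)).
{ assert (Hcl : 0 < Cmod l) by now apply Cmod_gt_0.
  assert (Hl' := Hl). rewrite Cderiv_eps in Hl'.
  destruct (Hl' (Cmod l / 2)) as [e1 [Hp1 K1]]. lra.
  destruct (arc_near 1 d1 ltac:(lra) Hd1) as [e2 [Hp2 K2]].
  exists (Rmax 0 (1 - Rmin e1 e2)).
  assert (0 < Rmin e1 e2) by now apply Rmin_pos.
  split. split. apply Rmax_l. apply Rmax_lub_lt; lra.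
  intros t Ht. generalize (Rmin_l e1 e2) (Rmin_r e1 e2)
    (Rmax_r 0 (1 - Rmin e1 e2)). intros.
  assert (Hs : Rabs (t - 1) = 1 - t) by (rewrite Rabs_left; lra).
  specialize (K1 t ltac:(lra)). specialize (K2 t ltac:(lra)).
  rewrite E1 in K1, K2. rewrite Hs in K1. split. easy.
  unfold half_plane. set (v := (g t - 1 - l * RtoC (t - 1))%C) in *.
  replace ((g t - 1) * Cconj (- l))%C with
    (RtoC (1 - t) * (l * Cconj l) - v * Cconj l)%C.
  2:{ unfold v. replace (Cconj (- l)) with (- Cconj l)%C
        by (apply injective_projections; simpl; ring).
      rewrite !RtoC_minus. ring. }
  rewrite Re_sub, <- Cmod2_conj, <- RtoC_mult.
  change (0 < (1 - t) * Cmod l ^ 2 - Re (v * Cconj l)%C).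
  assert (B := re_le_Cmod (v * Cconj l)). rewrite Cmod_mult, Cmod_conj in B.
  apply Rabs_le_between in B.
  assert (Cmod v * Cmod l <= Cmod l / 2 * (1 - t) * Cmod l)
    by (apply Rmult_le_compat_r; lra).
  assert (0 < (1 - t) * (Cmod l * Cmod l)) by (apply Rmult_lt_0_compat; nra).
  replace (Cmod l ^ 2) with (Cmod l * Cmod l) by ring. lra. }
destruct Hal as [al [Hal Hnear]].
assert (Hf : forall t, al < t < 1 -> hol Phi Psi (g t) /\ hol Psi Psi' (g t) /\
     (Psi (g t) * Psi (g t))%C = qd (g t) /\
     (Phi (g t) * Phi (g t) = (g t - 1) ^ 1 * (E (g t) * E (g t)))%C).
{ intros t Ht. destruct (Hnear t Ht) as [N1 N2]. apply HP; try easy.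
  now apply Hq1. }
assert (Hconst : forall t1 t2, al < t1 < 1 -> al < t2 < 1 ->
  Re (Phi (g t1)) = Re (Phi (g t2))).
{ apply (imaginary_along qd g w Phi Psi Psi' al 1); try easy; try lra.
  - intros t Ht. apply arc_Cdiff. lra.
  - apply branch_neq.
  - intros t Ht. destruct (Hf t Ht) as [P1 [P2 [P3 _]]]. easy. }
assert (Hzero : forall t, al < t < 1 -> Re (Phi (g t)) = 0).
{ intros t Ht. apply cond_eq. intros eps Heps. rewrite Rminus_0_r.
  destruct (expansion_limit (fun z => exists s, al < s < 1 /\ g s = z)
    Phi E _ 1 0 0 1 HE Rlt_0_1) with (eps := eps) as [d [Hd K]]; try easy.
  { intros z [s [Hs <-]] _. destruct (Hf s Hs) as [_ [_ [_ P4]]].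
    rewrite <- P4. ring. }
  destruct (arc_near 1 d ltac:(lra) Hd) as [e [He Ke]].
  rewrite E1 in Ke.
  destruct (point_before_1 al e) as [s [Hs Hse]]; try lra.
  rewrite (Hconst t s Ht Hs).
  eapply Rle_lt_trans. apply re_le_Cmod.
  replace (Phi (g s)) with (Phi (g s) - 0)%C by ring.
  apply K. now exists s. now apply Ke. }
set (h := fun z : C => ((z - 1) * (E z * E z))%C).
assert (Hh : hol h (fun z => (1 + 0) * (E z * E z) + (z - 1) *
  (spoke_int 2 1 T1' z * E z + E z * spoke_int 2 1 T1' z))%C 1).
{ exact (hol_mult _ _ _ _ _ (hol_plus _ _ _ _ _ (hol_id 1) (hol_const (- (1))%C 1))
   (hol_mult _ _ _ _ _ HE HE)). }
rewrite <- E1 in Hh.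
assert (D := Cderiv_hol _ _ _ _ _ Hh Hl). cbv beta in D. rewrite E1 in D.
replace (((1 + 0) * (E 1 * E 1) + (1 - 1) * (spoke_int 2 1 T1' 1 * E 1 +
   E 1 * spoke_int 2 1 T1' 1)) * l)%C with (E 1 * E 1 * l)%C in D by ring.
assert (EE : (E 1 * E 1 = RtoC 4 * pole_factor 1)%C).
{ unfold E. rewrite (spoke_int_center 0 1 T1 T1').
  2:{ apply HT1'. now rewrite Cmod_diag. }
  rewrite <- HT1. simpl INR. replace (2 / 1) with 2 by field.
  replace 4 with (2 * 2) by ring. rewrite RtoC_mult. ring. }
rewrite EE in D.
assert (Hsq : forall t, al < t < 1 ->
  Re (h (g t)) <= 0 /\ Im (h (g t)) = 0).
{ intros t Ht. destruct (Hf t Ht) as [_ [_ [_ P4]]].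
  assert (R0 := Hzero t Ht).
  replace (h (g t)) with (Phi (g t) * Phi (g t))%C.
  2:{ rewrite P4. unfold h. simpl Cpow. ring. }
  simpl. unfold Re in R0. rewrite R0. split; nra. }
assert (h1 : h (g 1) = 0%C) by (rewrite E1; unfold h; ring).
destruct D as [DR DI].
assert (S1 := derive_left_sign _ al _ (proj2 Hal) DR).
assert (S2 := derive_left_sign _ al _ (proj2 Hal) DI).
assert (DI' := is_derive_opp (V := R_NormedModule) _ _ _ DI).
assert (S3 := derive_left_sign _ al _ (proj2 Hal) DI').
cbv beta in S1, S2, S3. rewrite h1 in S1, S2, S3.
assert (S1' := S1 eq_refl (fun t Ht => proj1 (Hsq t Ht))).
assert (S2' := S2 eq_refl (fun t Ht => Req_le _ _ (proj2 (Hsq t Ht)))).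
assert (S3' : 0 <= - Im (4 * pole_factor 1 * l)%C).
{ apply S3. change (- 0 = 0). ring. intros t Ht.
  change (- Im (h (g t)) <= 0). rewrite (proj2 (Hsq t Ht)). lra. }
clear S1 S2 S3.
set (u := 1 - x ^ 2 - b ^ 2).
assert (ER : pole_factor 1 = ((- u / (2 * (b * b)), / b) : C)).
{ unfold pole_factor, zs, u. apply injective_projections; simpl; field; lra. }
rewrite ER in S1', S2', S3'. destruct l as [l1 l2]. simpl in S1', S2', S3' |- *.
assert (Bp : 0 < / b) by now apply Rinv_0_lt_compat.
set (v := u / (2 * b)).
assert (Ev : - u / (2 * (b * b)) = - v * / b) by (unfold v; field; lra).
rewrite Ev in *.
assert (Q1 : 0 <= - (v * l1) - l2).
{ apply Rmult_le_reg_r with (4 * / b). lra. lra. }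
assert (Q2 : l1 = v * l2).
{ apply Rmult_eq_reg_r with (4 * / b). lra. lra. }
destruct (Rlt_dec l2 0) as [hh|hh]. easy.
exfalso. apply Hl0. rewrite Q2 in Q1.
assert (0 <= v * v) by nra.
assert (l2 = 0) by nra. subst l2. rewrite Q2.
apply injective_projections; simpl; ring.
Qed.

Lemma arc_start : exists al, 0 <= al < 1 /\ forall t, al < t < 1 ->
  strip (g t) /\ Re (phi (g t)) = Re c1.
Proof.
destruct arc_ends as [_ E1].
destruct (arc_Cdiff 1 ltac:(lra)) as [l Hl].
assert (Hneg := arrival_direction l Hl).
assert (DI := proj2 Hl). rewrite is_derive_eps in DI.
destruct (DI (- Im l / 2)) as [e1 [Hp1 K1]]. lra.
destruct (arc_near 1 b ltac:(lra) Hb) as [e2 [Hp2 K2]].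
set (al := Rmax 0 (1 - Rmin e1 e2)).
assert (0 < Rmin e1 e2) by now apply Rmin_pos.
assert (Hal : 0 <= al < 1).
{ split. apply Rmax_l. apply Rmax_lub_lt; lra. }
assert (Hst : forall t, al < t < 1 -> strip (g t)).
{ intros t Ht. generalize (Rmin_l e1 e2) (Rmin_r e1 e2)
    (Rmax_r 0 (1 - Rmin e1 e2)). fold al. intros.
  assert (Hs : Rabs (t - 1) = 1 - t) by (rewrite Rabs_left; lra).
  specialize (K1 t ltac:(lra)). specialize (K2 t ltac:(lra)).
  rewrite E1 in K1, K2. rewrite Hs in K1. change (Im 1) with 0 in K1.
  assert (B := im_le_Cmod (g t - 1)). rewrite Im_sub in B.
  change (Im 1) with 0 in B.
  apply Rabs_le_between in K1, B.
  split. apply arc_re. lra. split; nra. }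
exists al. split. easy. intros t Ht. split. now apply Hst.
destruct (hol_sq ) as [s' Hs'].
assert (Hconst : forall t1 t2, al < t1 < 1 -> al < t2 < 1 ->
  Re (phi (g t1)) = Re (phi (g t2))).
{ apply (imaginary_along qd g w phi sq s' al 1); try easy; try lra.
  - intros s Hs. apply arc_Cdiff. lra.
  - apply branch_neq.
  - intros s Hs. split. apply (hol_phi ). now apply Hst.
    split. now apply Hs', Hst. apply sq_sqr. }
apply Rminus_diag_uniq. apply cond_eq. intros eps Heps. rewrite Rminus_0_r.
destruct (limit_along g 1 _ _ _ _ _ He1 (arc_Cdiff 1 ltac:(lra)) E1 eps Heps)
  as [d [Hd K]].
destruct (point_before_1 al d) as [s [Hs Hsd]]; try lra.
rewrite (Hconst t s Ht Hs), <- Re_sub.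
eapply Rle_lt_trans. apply re_le_Cmod.
apply K. easy. now apply Hst.
Qed.

Definition on_traj (t : R) : Prop := strip (g t) /\ Re (phi (g t)) = Re c1.

(** The limit point lies on the closed graph and, as the arc is simple, at neither
end of it; so it is inside the strip, where the level is locally constant along
the arc. *)
Lemma continuation t0 : 0 < t0 < 1 -> (forall t, t0 < t < 1 -> on_traj t) ->
  exists t1, 0 < t1 < t0 /\ forall t, t1 < t < 1 -> on_traj t.
Proof.
intros Ht0 H.
destruct arc_ends as [E0 E1].
set (y := Im (g t0)).
assert (Hseq : forall d, 0 < d -> exists s, t0 < s < t0 + d /\ s < 1).
{ intros d Hd. exists (t0 + Rmin d (1 - t0) / 2).
  assert (0 < Rmin d (1 - t0)) by (apply Rmin_pos; lra).
  generalize (Rmin_l d (1 - t0)) (Rmin_r d (1 - t0)). lra. }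
assert (Him : forall eps, 0 < eps -> exists d, 0 < d /\ forall s,
   Rabs (s - t0) < d -> Rabs (Im (g s) - y) < eps).
{ intros eps Heps. destruct (arc_near t0 eps ltac:(lra) Heps) as [d [Hd K]].
  exists d. split. easy. intros s Hs. unfold y. rewrite <- Im_sub.
  eapply Rle_lt_trans. apply im_le_Cmod. now apply K. }
assert (Hy : 0 <= y <= b).
{ split; apply le_epsilon; intros eps Heps;
  destruct (Him eps Heps) as [d [Hd K]]; destruct (Hseq d Hd) as [s [Hs1 Hs2]];
  specialize (K s ltac:(apply Rabs_def1; lra)); apply Rabs_def2 in K;
  destruct (H s ltac:(lra)) as [[_ Q] _]; lra. }
assert (Eg : g t0 = Gam y).
{ apply Cmod_small_eq. intros eps Heps.
  destruct (chart_Cdiff _ _ (Gam_chart y Hy)) as [l Hl].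
  destruct (Cderiv_cont _ _ _ Hl (eps / 2)) as [d [Hd K]]. lra.
  destruct (Him d Hd) as [d' [Hd' K']].
  destruct (arc_near t0 (eps / 2) ltac:(lra) ltac:(lra)) as [e [He Ke]].
  destruct (Hseq (Rmin d' e)) as [s [Hs1 Hs2]]. now apply Rmin_pos.
  generalize (Rmin_l d' e) (Rmin_r d' e). intros.
  assert (Hss : Rabs (s - t0) < d' /\ Rabs (s - t0) < e)
    by (split; apply Rabs_def1; lra).
  destruct (H s ltac:(lra)) as [Q1 Q2].
  assert (Q := level_unique _ Q1 Q2).
  assert (X1 := Ke s (proj2 Hss)). assert (X2 := K _ (K' s (proj1 Hss))).
  rewrite <- Q in X2.
  generalize (Cmod_sub_trans (g t0) (g s) (Gam y)). rewrite (Cmod_minus_sym (g t0) (g s)).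
  lra. }
assert (Hy0 : y <> 0).
{ intros E. rewrite E, HG0, <- E1 in Eg. apply arc_inj in Eg; lra. }
assert (Hyb : y <> b).
{ intros E. rewrite E, HGb, <- E0 in Eg. apply arc_inj in Eg; lra. }
destruct (HGs y) as [Hst Hre]. lra.
rewrite <- Eg in Hst, Hre.
destruct (strip_open _ Hst) as [e [He Hw']].
destruct (arc_near t0 e ltac:(lra) He) as [d [Hd K]].
destruct (common_bound d t0 (1 - t0)) as [m [Hm0 Hm]]; try lra.
assert (Hsm : forall s, t0 - m < s < t0 + m -> strip (g s)).
{ intros s Hs. apply Hw', K. apply Rabs_def1; lra. }
destruct (hol_sq ) as [s' Hs'].
assert (Hconst : forall t1 t2, t0 - m < t1 < t0 + m -> t0 - m < t2 < t0 + m ->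
  Re (phi (g t1)) = Re (phi (g t2))).
{ apply (imaginary_along qd g w phi sq s'); try easy; try lra.
  - intros s Hs. apply arc_Cdiff. lra.
  - apply branch_neq.
  - intros s Hs. split. apply (hol_phi ). now apply Hsm.
    split. now apply Hs', Hsm. apply sq_sqr. }
exists (t0 - m). split. lra. intros t Ht.
destruct (Rlt_dec t0 t) as [h|h]. apply H. lra.
split. apply Hsm. lra. rewrite (Hconst t t0); lra.
Qed.

(** The supremum of the lengths of final pieces on the trajectory is [1], as
[continuation] would extend any shorter piece. *)
Lemma arc_on_traj t : 0 < t < 1 -> on_traj t.
Proof.
revert t.
assert (Hall : forall e, 0 < e -> exists t0, 0 < t0 < e /\
   forall t, t0 < t < 1 -> on_traj t).
{ destruct arc_start as [al [Hal Hst]].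
  set (S := fun r => 0 <= r <= 1 /\ forall t, 1 - r < t < 1 -> on_traj t).
  destruct (completeness S) as [m [Hm1 Hm2]].
  { exists 1. intros r [Hr _]. lra. }
  { exists 0. split. lra. intros t Ht. lra. }
  assert (Hm : 1 - al <= m).
  { apply Hm1. split. lra. intros t Ht. apply Hst. lra. }
  assert (Hm' : m <= 1).
  { apply Hm2. intros r [Hr _]. lra. }
  assert (Hbelow : forall t, 1 - m < t < 1 -> on_traj t).
  { intros t Ht. apply NNPP. intros Hn.
    assert (m <= 1 - t); [|lra]. apply Hm2. intros r [Hr1 Hr2].
    apply Rnot_lt_le. intros h. apply Hn, Hr2. lra. }
  assert (Em : m = 1).
  { apply Rle_antisym. easy. apply Rnot_lt_le. intros h.
    destruct (continuation (1 - m)) as [t1 [Ht1 K]]. lra. easy.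
    assert (1 - t1 <= m); [|lra]. apply Hm1. split. lra.
    intros t Ht. apply K. lra. }
  intros e He. exists (Rmin e 1 / 2).
  assert (0 < Rmin e 1) by (apply Rmin_pos; lra).
  generalize (Rmin_l e 1) (Rmin_r e 1). intros.
  split. lra. intros t Ht. apply Hbelow. lra. }
intros t Ht. destruct (Hall t (proj1 Ht)) as [t0 [Ht0 K]]. apply K. lra.
Qed.

(** Both arcs are the part of the graph over [[0, b]], as the height of the competing
arc takes all these values. *)
Lemma arc_unique z : A z <-> exists t, 0 <= t <= 1 /\ traj t = z.
Proof.
destruct Hg as [_ [E0 [E1 HAz]]]. rewrite HAz.
assert (Hpt : forall t, 0 <= t <= 1 -> g t = Gam (Im (g t))).
{ intros t Ht.
  destruct (Req_dec t 0) as [->|h0]. rewrite E0. symmetry. exact HGb.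
  destruct (Req_dec t 1) as [->|h1]. rewrite E1. symmetry. exact HG0.
  destruct (arc_on_traj t) as [Q1 Q2]. lra. now apply level_unique. }
assert (Hrange : forall t, 0 <= t <= 1 -> 0 <= Im (g t) <= b).
{ intros t Ht.
  destruct (Req_dec t 0) as [->|h0]. rewrite E0. simpl. lra.
  destruct (Req_dec t 1) as [->|h1]. rewrite E1. simpl. lra.
  destruct (arc_on_traj t) as [[_ Q] _]. lra. lra. }
split; intros [t [Ht Et]].
- exists (1 - Im (g t) / b). assert (R := Hrange t Ht).
  assert (0 <= Im (g t) / b <= 1).
  { split. apply Rdiv_le_0_compat; lra.
    apply Rmult_le_reg_r with b. easy. unfold Rdiv.
    rewrite Rmult_assoc, Rinv_l; lra. }
  split. lra. unfold traj.
  replace (b + - b * (1 - Im (g t) / b)) with (Im (g t)) by (field; lra).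
  rewrite <- Et. symmetry. now apply Hpt.
- set (y := b + - b * t) in *. assert (Hy : 0 <= y <= b) by (unfold y; nra).
  assert (exists s, 0 <= s <= 1 /\ Im (g s) = y) as [s [Hs Es]].
  { destruct (Req_dec y 0) as [h0|h0].
    { exists 1. split. lra. rewrite E1. simpl. easy. }
    destruct (Req_dec y b) as [hb|hb].
    { exists 0. split. lra. rewrite E0. simpl. easy. }
    destruct (IVT_interv (fun s => y - Im (g s)) 0 1) as [s [Hs Es]].
    - intros s Hs. destruct (arc_Cdiff s Hs) as [l [_ Hl]].
      apply continuity_pt_minus. apply continuity_pt_const. easy.
      eapply derive_cont. exact Hl.
    - lra.
    - rewrite E0. simpl. lra.
    - rewrite E1. simpl. lra.
    - exists s. split. easy. lra. }
  exists s. split. easy. rewrite (Hpt s Hs), Es. exact Et.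
Qed.

End Trajectory.

End Differential.

(** * The theorem *)

Lemma Q_eq (lambda x : R) : 0 < lambda -> forall z,
  Q lambda x z = qd (2 / lambda) x z.
Proof.
intros Hl z. unfold Q, qd, z_lambda, zs.
replace (x + 2 * Ci / lambda)%C with ((x, 2 / lambda) : C).
2:{ apply injective_projections; simpl; field; lra. }
replace (- (lambda ^ 2 / 4))%C with (RtoC (- / (2 / lambda * (2 / lambda)))).
2:{ apply injective_projections; simpl; field; lra. }
replace (z ^ 2)%C with (z * z)%C by ring. easy.
Qed.

Lemma z_lambda_eq (lambda x : R) : 0 < lambda ->
  z_lambda lambda x = zs (2 / lambda) x.
Proof.
intros Hl. unfold z_lambda, zs. apply injective_projections; simpl; field; lra.
Qed.

Lemma qd_refl b x z : qd b x (refl_im z) = Cconj (qd b x z).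
Proof.
assert (Hi : forall u, Cconj (/ u)%C = (/ Cconj u)%C).
{ intros [u v]. apply injective_projections; simpl;
  unfold Rdiv; replace (- v * (- v * 1)) with (v * (v * 1)) by ring; ring. }
unfold qd. rewrite !Cconj_mul, Hi, Cconj_R.
f_equal. f_equal.
- unfold refl_im. apply injective_projections; simpl; ring.
- f_equal. unfold refl_im. apply injective_projections; simpl; ring.
Qed.

Lemma refl_im_involutive z : refl_im (refl_im z) = z.
Proof. unfold refl_im. apply injective_projections; simpl; ring. Qed.

Theorem theorem2p2 (lambda_c lambda x_star : R)
  (Hlc : is_lambda_c lambda_c) (Hlambda : lambda_c < lambda)
  (Hx : is_x_star lambda x_star) :
  let z_star := z_lambda lambda x_star in
  let q := Q lambda x_star in
  let is_gamma2 (A : C -> Prop) :=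
    (forall z, A z -> 0 < Re z) /\
    exists g, analytic_arc A z_star 1 g /\ imaginary_sqrt_integral q g in
  exists gamma1 gamma2 : C -> Prop,
    is_gamma2 gamma2 /\
    (forall A, is_gamma2 A -> forall z, A z <-> gamma2 z) /\
    (forall z, gamma1 z <-> exists z', gamma2 z' /\ z = refl_im z') /\
    (exists g, analytic_arc gamma1 (-1)%C (refl_im z_star) g /\
               imaginary_sqrt_integral q g).
Proof.
intros z_star q is_gamma2.
assert (Hl : 0 < lambda) by (destruct Hlc as [[H _] _]; lra).
set (b := 2 / lambda).
assert (Hb : 0 < b) by (apply Rdiv_lt_0_compat; lra).
set (x := x_star) in *.
assert (Eq : q = qd b x) by (apply functional_extensionality, Q_eq, Hl).
assert (Ez : z_star = zs b x) by now apply z_lambda_eq.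
destruct Hx as [[[Hx0 Hx1] [w [l [Hw [Hint Hre]]]]] _].
fold z_star q in Hw, Hint. rewrite Ez in Hw, Hint. rewrite Eq in Hw.
destruct (one_expansion b x Hb Hx0 Hx1) as [c1 [T1 [d1 [He1 [HT1 Hq1]]]]].
destruct (zs_expansion b x Hb Hx0 Hx1) as [c3 [T3 [d3 [He3 HT3]]]].
assert (Hc := equal_levels b x Hb Hx0 Hx1 c1 T1 d1 c3 T3 d3 w l He1 He3 Hw Hint Hre).
destruct (level_graph b x Hb Hx0 Hx1 c1 T1 d1 c3 T3 d3 He1 HT1 He3 HT3 Hc)
  as [Gam [HG0 [HGb [HGs HGF]]]].
assert (Hpar := traj_arc_param b Hb Gam HGF).
set (g := traj b Gam) in *.
assert (g0 : g 0 = zs b x) by now apply traj_0.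
assert (g1 : g 1 = RtoC 1) by now apply traj_1.
assert (Hst := traj_strip b x Hb c1 Gam HGs). fold g in Hst.
destruct (traj_data b x Hb Hx0 Hx1 c1 c3 T1 T3 d1 d3 He1 He3 Gam HG0 HGb HGs HGF)
  as [D1 [D2 [D3 [D4 [D5 D6]]]]].
fold g in D1, D2, D3, D4, D5, D6.
exists (fun z => exists z', (exists t, 0 <= t <= 1 /\ g t = z') /\ z = refl_im z'),
  (fun z => exists t, 0 <= t <= 1 /\ g t = z).
split; [|split; [|split]].
- split.
  + intros z [t [Ht <-]].
    destruct (Req_dec t 0) as [->|h0]. rewrite g0. exact Hx0.
    destruct (Req_dec t 1) as [->|h1]. rewrite g1. simpl. lra.
    apply (Hst t). lra.
  + exists g. split. rewrite Ez. now repeat split; try apply Hpar.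
    rewrite Eq.
    apply (imaginary_of_charts _ g (fun t => sq b x (g t)) (fun t => phi b x (g t))
      c3 c1 (Re c1)); try easy. intros t Ht. now apply Hst.
- intros A [HA [g' [Hg' [w' [Hw' Hint']]]]].
  rewrite Ez in Hg'. rewrite Eq in Hw'.
  exact (arc_unique b x Hb Hx0 Hx1 c1 T1 d1 He1 HT1 Hq1 Gam HG0 HGb HGs HGF
    A g' w' HA Hg' Hw' Hint').
- easy.
- exists (fun t => refl_im (g (1 - t))). split.
  + split; [|split; [|split]].
    * split; [|split].
      -- intros t Ht. apply chart_analytic, chart_flip.
         apply (traj_chart b Hb Gam HGF). lra.
      -- intros t Ht E.
         destruct (chart_Cdiff g _ (traj_chart b Hb Gam HGF (1 - t) ltac:(lra)))
           as [l' Hl'].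
         rewrite (Cderiv_path _ _ _ (Cderiv_flip _ _ _ Hl')) in E.
         apply (proj1 (proj2 Hpar) (1 - t) ltac:(lra)).
         rewrite (Cderiv_path _ _ _ Hl').
         rewrite <- (Cconj_conj l'), E. apply Cconj_R.
      -- intros s t Hs Ht E.
         apply (f_equal refl_im) in E. rewrite !refl_im_involutive in E.
         apply (proj2 (proj2 Hpar)) in E; lra.
    * rewrite Rminus_0_r, g1. unfold refl_im.
      apply injective_projections; simpl; ring.
    * rewrite Rminus_diag, g0, Ez. easy.
    * intros z. split.
      -- intros [z' [[t [Ht <-]] ->]]. exists (1 - t). split. lra.
         now replace (1 - (1 - t)) with t by ring.
      -- intros [t [Ht <-]]. exists (g (1 - t)). split. 2: easy.
         exists (1 - t). split. lra. easy.
  + rewrite Eq.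
    apply (imaginary_refl _ g (fun t => sq b x (g t)) (fun t => phi b x (g t))
      c3 c1 (Re c1)); try easy. apply qd_refl. intros t Ht. now apply Hst.
Qed.
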